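(* For $k\in\mathbb{R}$ let $S_k=\{(f,k)\in H_k\mid a(f,k)=0\text{ for some monic }a\in\mathcal{R}\}$. Then for all $k,l\in\mathbb{R}$: (1) $S_k+S_k\subset S_k$; (2) $S_kS_l\subset S_{k+l}$; (3) $\mathcal{R}_kS_l\subset S_{k+l}$; (4) $\mathcal{M}_k\subset S_k$. Consequently $\bigoplus_{k\in\mathbb{R}}S_k$ is a $\mathbb{C}$-subalgebra and a left $\mathcal{R}$-submodule of $H$.
   Context: Let $\mathrm{Hol}$ be the space of holomorphic functions on the upper half plane, $q=e^{2\pi iz}$, $f'=\frac{1}{2\pi i}\frac{df}{dz}$, and $E_2,E_4,E_6$ the Eisenstein series with constant term $1$. For $k\in\mathbb{R}$ let $D_kf=f'-\frac{k}{12}E_2f$. Let $H=\bigoplus_{n\in\mathbb{R}}H_n$ where each $H_n$ is a copy of $\mathrm{Hol}$, elements written $(f,n)$, with product $(f,n)(g,m)=(fg,n+m)$. $\mathrm{End}^i(H)$ denotes the $\mathbb{C}$-linear maps sending each $H_n$ into $H_{n+i}$ and $\mathrm{End}(H)=\bigoplus_i\mathrm{End}^i(H)$. Define $\delta(f,n)=(D_nf,n+2)$, $e_4(f,n)=(E_4f,n+4)$, $e_6(f,n)=(E_6f,n+6)$; $\mathcal{R}=\bigoplus_k\mathcal{R}_k$ is the $\mathbb{C}$-subalgebra of $\mathrm{End}(H)$ generated by $\delta,e_4,e_6$, graded by weight. $\mathcal{M}=\mathbb{C}[E_4,E_6]=\bigoplus_k\mathcal{M}_k$ is the ring of level-one holomorphic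 modular forms, identified with the subalgebra of $\mathcal{R}$ generated by $e_4,e_6$ (and $\mathcal{M}_k\subset H_k$ via $f\mapsto(f,k)$). Every nonzero $a\in\mathcal{R}$ is uniquely $a=a_n\delta^n+\cdots+a_0$ with $a_i\in\mathcal{M}$, $a_n\neq0$; $a$ is monic if $a_n=1$. Products $S_kS_l$ and $\mathcal{R}_kS_l$ mean sets of products $\phi\psi$ in $H$ and of $a\phi$. *)

(* Defs.v *)
From Stdlib Require Import Reals ClassicalEpsilon List.
From Coquelicot Require Import Coquelicot.

Open Scope R_scope.

Definition UHP (z : C) : Prop := 0 < Im z.

(* f : C -> C is holomorphic on the upper half plane: complex differentiable
   at every point of the (open) upper half plane.  Values off the upper half
   plane are irrelevant (all equalities below are only tested on UHP). *)
Definition holo (f : C -> C) : Prop :=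
  forall z : C, UHP z -> @ex_derive C_AbsRing C_NormedModule f z.

(* the complex derivative df/dz (total function; meaningful where f is
   complex differentiable, where the derivative is unique) *)
Definition derC (f : C -> C) (z : C) : C :=
  epsilon (inhabits (RtoC 0))
          (fun l : C => @is_derive C_AbsRing C_NormedModule f z l).

Definition dprime (f : C -> C) (z : C) : C :=
  Cdiv (derC f z) (Cmult (RtoC (2 * PI)) Ci).

Definition cexp (w : C) : C :=
  (exp (Re w) * cos (Im w), exp (Re w) * sin (Im w)).

Definition qpow (n : nat) (z : C) : C :=
  cexp (Cmult (RtoC (2 * PI * INR n)) (Cmult Ci z)).

Definition sigma (r n : nat) : R :=
  sum_f_R0 (fun d => if Nat.eqb (n mod (S d)) 0 then INR (S d) ^ r else 0)
           (pred n).

Definition CSeries (a : nat -> C) : C :=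
  (Series (fun n => Re (a n)), Series (fun n => Im (a n))).

Definition Eis (c : R) (r : nat) (z : C) : C :=
  Cplus (RtoC 1)
    (Cmult (RtoC c)
       (CSeries (fun n => Cmult (RtoC (sigma r (S n))) (qpow (S n) z)))).

Definition E2 : C -> C := Eis (-24) 1.
Definition E4 : C -> C := Eis 240 3.
Definition E6 : C -> C := Eis (-504) 5.

Definition Dk (k : R) (f : C -> C) : C -> C :=
  fun z => Cminus (dprime f z) (Cmult (RtoC (k / 12)) (Cmult (E2 z) (f z))).

(* An element of H is represented as a finite formal sum of homogeneous
   pieces (f, n), f in Hol, i.e. a list of pairs (weight, function).
   Its component in H_w is the sum of the functions carried with weight w. *)
Definition H : Type := list (R * (C -> C)).

Definition Hel (h : H) : Prop := forall p, In p h -> holo (snd p).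

Definition comp (h : H) (w : R) (z : C) : C :=
  fold_right (fun p acc => if Req_EM_T (fst p) w then Cplus (snd p z) acc else acc)
             (RtoC 0) h.

Definition Heq (h1 h2 : H) : Prop :=
  forall (w : R) (z : C), UHP z -> comp h1 w z = comp h2 w z.

Definition Hzero (h : H) : Prop := Heq h nil.

Definition hom (k : R) (f : C -> C) : H := (k, f) :: nil.

Definition Hadd (h1 h2 : H) : H := h1 ++ h2.
Definition Hscale (c : C) (h : H) : H :=
  map (fun p => (fst p, fun z => Cmult c (snd p z))) h.
Definition Hmul (h1 h2 : H) : H :=
  flat_map (fun p => map (fun q => (fst p + fst q, fun z => Cmult (snd p z) (snd q z))) h2) h1.
Definition Hone : H := hom 0 (fun _ => RtoC 1).

Definition Op : Type := H -> H.

Definition delta : Op := map (fun p => (fst p + 2, Dk (fst p) (snd p))).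
Definition e4 : Op := map (fun p => (fst p + 4, fun z => Cmult (E4 z) (snd p z))).
Definition e6 : Op := map (fun p => (fst p + 6, fun z => Cmult (E6 z) (snd p z))).

Definition Opconst (c : C) : Op := Hscale c.
Definition Opadd (a b : Op) : Op := fun h => Hadd (a h) (b h).
Definition Opcomp (a b : Op) : Op := fun h => a (b h).

Definition Opeq (a b : Op) : Prop := forall h, Hel h -> Heq (a h) (b h).

Inductive Ralg : Op -> Prop :=
| Ralg_const c : Ralg (Opconst c)
| Ralg_delta : Ralg delta
| Ralg_e4 : Ralg e4
| Ralg_e6 : Ralg e6
| Ralg_add a b : Ralg a -> Ralg b -> Ralg (Opadd a b)
| Ralg_comp a b : Ralg a -> Ralg b -> Ralg (Opcomp a b).

(* M = C[E4,E6] viewed inside R: the subalgebra generated by e4, e6 *)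
Inductive Malg : Op -> Prop :=
| Malg_const c : Malg (Opconst c)
| Malg_e4 : Malg e4
| Malg_e6 : Malg e6
| Malg_add a b : Malg a -> Malg b -> Malg (Opadd a b)
| Malg_comp a b : Malg a -> Malg b -> Malg (Opcomp a b).

Definition homog (k : R) (a : Op) : Prop :=
  forall (n : R) (f : C -> C), holo f ->
    exists g : C -> C, holo g /\ Heq (a (hom n f)) (hom (n + k) g).

Definition Rk (k : R) (a : Op) : Prop := Ralg a /\ homog k a.

Fixpoint Opiter (n : nat) (a : Op) : Op :=
  match n with O => fun h => h | S n' => Opcomp a (Opiter n' a) end.

Fixpoint lowterms (n : nat) (m : nat -> Op) : Op :=
  match n with
  | O => fun _ => nil
  | S n' => Opadd (lowterms n' m) (Opcomp (m n') (Opiter n' delta))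
  end.

Definition monic (a : Op) : Prop :=
  exists (n : nat) (m : nat -> Op), (forall i, Malg (m i)) /\
    Opeq a (Opadd (Opiter n delta) (lowterms n m)).

Definition inS (k : R) (f : C -> C) : Prop :=
  holo f /\ exists a : Op, Ralg a /\ monic a /\ Hzero (a (hom k f)).

Definition inSsum (h : H) : Prop := forall w : R, inS w (comp h w).

(* M_k : level-one modular forms of weight k = weight-k part of C[E4,E6] *)
Inductive MF : R -> (C -> C) -> Prop :=
| MF_zero k : MF k (fun _ => RtoC 0)
| MF_const c : MF 0 (fun _ => c)
| MF_E4 : MF 4 E4
| MF_E6 : MF 6 E6
| MF_add k f g : MF k f -> MF k g -> MF k (fun z => Cplus (f z) (g z))
| MF_mul k l f g : MF k f -> MF l g -> MF (k + l) (fun z => Cmult (f z) (g z)).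

(* Main.v *)
Require Import Defs.
From Stdlib Require Import Reals Lra Lia ClassicalEpsilon List Permutation Arith FunctionalExtensionality Classical.
From Coquelicot Require Import Coquelicot.
Open Scope R_scope.

(** The criterion is the one for integral elements in commutative algebra: finitely generated stable
    modules add and multiply, whereas explicit monic operators for a sum or a product would be hard
    to write down. The ring C[E4, E6] is not constant for [delta], so a module whose generators are
    sent into it by [delta] is stable only because the derivatives of [E4] and [E6] are again
    polynomials in them; this is where Ramanujan's identities enter. The ring acts through two
    commuting linear operators, and the basis theorem is proved for such operators. Equality in [H]
    concerns the upper half plane alone, so modules live in [graded], where it is Leibniz equality;
    but [delta] differentiates total functions and acts on lists, so elements of a module are lifted
    to lists before being differentiated. The divisor sum identities come from polynomials [h] with
    [h a (a + b) = h (a + b) b], built from [a^2 - a b + b^2] and [(a b (a - b))^2]: the quadruple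
    sums of [h a b] and [h a (a + b)] then differ by diagonal terms only, which reduce to power
    sums. *)

(** A function [f] of weight [k] lies in [S_k] exactly when it belongs to a finitely generated
    module over [C[E4, E6]] that is stable under the derivation [delta]. Such modules are closed under
    sums and products, which gives all the closure properties. One implication is immediate: a monic
    equation makes the iterated derivatives of [f] finitely generated. For the converse, [C[E4, E6]] is Noetherian
    (Hilbert's basis theorem), so the chain of submodules generated by [f, delta f, ..., delta^n f]
    stabilises, and this yields a monic operator killing [f].

    Stability of [C[E4, E6]] under [delta] is Ramanujan's pair of identities [D E4 = - E6 / 3] and
    [D E6 = - E4^2 / 2]. They are convolution identities between divisor sums, and follow
    from a bijection between quadruples [(a, b, x, y)] with [a x + b y = n].

    Applying [delta] repeatedly requires derivatives of holomorphic functions to be holomorphic; this is obtained from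
    Goursat's lemma and Cauchy's formula on rectangles. *)

(** * Complex derivatives *)

(** The derivative in little-o form: without a quotient, [y = z] is allowed, and products and
    compositions reduce to triangle inequalities. *)
Definition Cdiff (f : C -> C) (z l : C) : Prop :=
  forall eps, 0 < eps -> exists d, 0 < d /\ forall y, Cmod (y - z) < d ->
    Cmod (f y - f z - l * (y - z)) <= eps * Cmod (y - z).

Lemma is_derive_Cdiff f z l : @is_derive C_AbsRing C_NormedModule f z l <-> Cdiff f z l.
Proof.
  split.
  - intros [_ H] eps He.
    destruct (H z (fun P HP => HP) (mkposreal eps He)) as [d Hd].
    exists d. split. apply cond_pos.
    intros y Hy. specialize (Hd y Hy). simpl in Hd.
    change (Cmod ((f y - f z) - (y - z) * l)%C <= eps * Cmod (y-z)%C) in Hd.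
    replace (f y - f z - l * (y - z))%C with ((f y - f z) - (y - z) * l)%C by ring.
    exact Hd.
  - intros H. split. apply is_linear_scal_l.
    intros x Hx eps.
    (* The differential is required at every limit [x] of the neighbourhood filter of [z];
       uniqueness of limits forces [x = z]. *)
    assert (Ex : x = z).
    { symmetry. apply (@is_filter_lim_locally_unique C_AbsRing (AbsRing_NormedModule C_AbsRing)). exact Hx. }
    subst x.
    destruct (H eps (cond_pos eps)) as [d [Hd Hb]].
    exists (mkposreal d Hd). intros y Hy.
    specialize (Hb y Hy).
    change (Cmod ((f y - f z) - (y - z) * l)%C <= eps * Cmod (y-z)%C).
    replace ((f y - f z) - (y - z) * l)%C with (f y - f z - l * (y - z))%C by ring.
    exact Hb.
Qed.

Lemma Cdiff_ext_loc f g z l d : 0 < d -> (forall y, Cmod (y - z) < d -> f y = g y) ->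
  Cdiff f z l -> Cdiff g z l.
Proof.
  intros Hd E H eps He. destruct (H eps He) as [e [Hpe Hb]].
  exists (Rmin d e). split. now apply Rmin_glb_lt.
  intros y Hy. assert (Cmod (y-z) < d /\ Cmod (y-z) < e) as [H1 H2].
  { split; eapply Rlt_le_trans; try exact Hy; [apply Rmin_l | apply Rmin_r]. }
  rewrite <- (E y H1), <- (E z). now apply Hb.
  replace (z - z)%C with (RtoC 0) by ring. now rewrite Cmod_0.
Qed.

Lemma Cdiff_bound f z l : Cdiff f z l -> exists d, 0 < d /\ forall y, Cmod (y - z) < d ->
   Cmod (f y - f z) <= (Cmod l + 1) * Cmod (y - z).
Proof.
  intros H. destruct (H 1 Rlt_0_1) as [d [Hd Hb]]. exists d; split; auto.
  intros y Hy. specialize (Hb y Hy).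
  replace (f y - f z)%C with ((f y - f z - l * (y-z)) + l * (y-z))%C by ring.
  eapply Rle_trans. apply Cmod_triangle. rewrite Cmod_mult. lra.
Qed.

Lemma Cdiff_continuous f z l : Cdiff f z l -> forall eps, 0 < eps -> exists d, 0 < d /\
  forall y, Cmod (y - z) < d -> Cmod (f y - f z) < eps.
Proof.
  intros H eps He. destruct (Cdiff_bound f z l H) as [d [Hd Hb]].
  assert (P : 0 < Cmod l + 1) by (generalize (Cmod_ge_0 l); lra).
  exists (Rmin d (eps / (Cmod l + 1))). split.
  { apply Rmin_glb_lt; auto. now apply Rdiv_lt_0_compat. }
  intros y Hy.
  assert (Cmod (y-z) < d) as H1 by (eapply Rlt_le_trans; [exact Hy | apply Rmin_l]).
  assert (Cmod (y-z) < eps / (Cmod l + 1)) as H2 by (eapply Rlt_le_trans; [exact Hy | apply Rmin_r]).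
  eapply Rle_lt_trans. apply Hb; auto.
  apply Rmult_lt_compat_l with (r := Cmod l + 1) in H2; auto.
  replace ((Cmod l + 1) * (eps / (Cmod l + 1))) with eps in H2 by (field; lra). exact H2.
Qed.

Lemma Cdiff_const c z : Cdiff (fun _ => c) z 0.
Proof.
  intros eps He. exists 1; split; [lra|]. intros y _.
  replace (c - c - 0 * (y - z))%C with (RtoC 0) by ring. rewrite Cmod_0.
  generalize (Cmod_ge_0 (y - z)). nra.
Qed.

Lemma Cdiff_plus f g z l m : Cdiff f z l -> Cdiff g z m -> Cdiff (fun x => f x + g x)%C z (l + m).
Proof.
  intros Hf Hg eps He. destruct (Hf (eps/2)) as [d [Hd H1]]; [lra|].
  destruct (Hg (eps/2)) as [e [Hpe H2]]; [lra|].
  exists (Rmin d e). split. now apply Rmin_glb_lt.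
  intros y Hy.
  specialize (H1 y). specialize (H2 y).
  assert (Cmod (y-z) < d) as H3 by (eapply Rlt_le_trans; [exact Hy | apply Rmin_l]).
  assert (Cmod (y-z) < e) as H4 by (eapply Rlt_le_trans; [exact Hy | apply Rmin_r]).
  specialize (H1 H3). specialize (H2 H4).
  replace (f y + g y - (f z + g z) - (l + m) * (y - z))%C with
    ((f y - f z - l * (y - z)) + (g y - g z - m * (y - z)))%C by ring.
  eapply Rle_trans. apply Cmod_triangle. lra.
Qed.

Lemma Cdiff_mult f g z l m : Cdiff f z l -> Cdiff g z m ->
  Cdiff (fun x => f x * g x)%C z (l * g z + f z * m).
Proof.
  intros Hf Hg eps He.
  set (A := Cmod (f z) + Cmod (g z) + (Cmod l + 1) * (Cmod m + 1) + 1).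
  assert (PA : 0 < A /\ Cmod (f z) <= A /\ Cmod (g z) <= A /\ (Cmod l + 1) * (Cmod m + 1) <= A).
  { unfold A. generalize (Cmod_ge_0 (f z)) (Cmod_ge_0 (g z)) (Cmod_ge_0 l) (Cmod_ge_0 m). intros. repeat split; nra. }
  destruct PA as [PA [A1 [A2 A3]]].
  (* The error of the product splits into three terms, each at most [A * e * |y - z|]. The last one
     is quadratic in [|y - z|], which is why the radius is also capped by [e]. *)
  set (e := eps / (3 * A)). assert (Pe : 0 < e) by (apply Rdiv_lt_0_compat; lra).
  assert (Ee : e * A * 3 = eps) by (unfold e; field; lra).
  destruct (Hf e Pe) as [d1 [Hd1 H1]].
  destruct (Hg e Pe) as [d2 [Hd2 H2]].
  destruct (Cdiff_bound f z l Hf) as [d3 [Hd3 H3]].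
  destruct (Cdiff_bound g z m Hg) as [d4 [Hd4 H4]].
  exists (Rmin (Rmin d1 d2) (Rmin (Rmin d3 d4) e)). split.
  { repeat apply Rmin_glb_lt; auto. }
  intros y Hy.
  assert (Cmod (y-z) < d1 /\ Cmod (y-z) < d2 /\ Cmod (y-z) < d3 /\ Cmod (y-z) < d4 /\ Cmod (y-z) < e)
    as [K1 [K2 [K3 [K4 K5]]]].
  { revert Hy. unfold Rmin. repeat destruct Rle_dec; intros; repeat split; lra. }
  specialize (H1 y K1). specialize (H2 y K2). specialize (H3 y K3). specialize (H4 y K4).
  replace (f y * g y - f z * g z - (l * g z + f z * m) * (y - z))%C with
    ((f y - f z - l * (y - z)) * g z + f z * (g y - g z - m * (y - z)) + (f y - f z) * (g y - g z))%C by ring.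
  eapply Rle_trans. apply Cmod_triangle.
  eapply Rle_trans. apply Rplus_le_compat_r. apply Cmod_triangle.
  rewrite !Cmod_mult.
  set (h := Cmod (y - z)) in *. assert (Ph : 0 <= h) by apply Cmod_ge_0.
  generalize (Cmod_ge_0 (f z)) (Cmod_ge_0 (g z)) (Cmod_ge_0 l) (Cmod_ge_0 m). intros.
  assert (Q1 : Cmod (f y - f z - l * (y - z)) * Cmod (g z) <= e * h * A).
  { apply Rmult_le_compat; auto; apply Cmod_ge_0. }
  assert (Q2 : Cmod (f z) * Cmod (g y - g z - m * (y - z)) <= A * (e * h)).
  { apply Rmult_le_compat; auto; apply Cmod_ge_0. }
  assert (Q3 : Cmod (f y - f z) * Cmod (g y - g z) <= ((Cmod l + 1) * h) * ((Cmod m + 1) * h)).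
  { apply Rmult_le_compat; auto; apply Cmod_ge_0. }
  assert (Q4 : ((Cmod l + 1) * h) * ((Cmod m + 1) * h) <= A * (e * h)).
  { replace (((Cmod l + 1) * h) * ((Cmod m + 1) * h)) with (((Cmod l + 1) * (Cmod m + 1)) * (h * h)) by ring.
    apply Rmult_le_compat; auto; nra. }
  rewrite <- Ee. nra.
Qed.

Lemma Cdiff_comp f g z l m : Cdiff f z l -> Cdiff g (f z) m -> Cdiff (fun x => g (f x)) z (m * l).
Proof.
  intros Hf Hg eps He.
  set (A := Cmod l + 1). assert (PA : 1 <= A) by (unfold A; generalize (Cmod_ge_0 l); lra).
  set (B := Cmod m + 1). assert (PB : 1 <= B) by (unfold B; generalize (Cmod_ge_0 m); lra).
  destruct (Hg (eps / (2 * A))) as [d1 [Hd1 H1]]. { apply Rdiv_lt_0_compat; lra. }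
  destruct (Hf (eps / (2 * B))) as [d2 [Hd2 H2]]. { apply Rdiv_lt_0_compat; lra. }
  destruct (Cdiff_bound f z l Hf) as [d3 [Hd3 H3]].
  destruct (Cdiff_continuous f z l Hf d1 Hd1) as [d4 [Hd4 H4]].
  exists (Rmin d2 (Rmin d3 d4)). split. { repeat apply Rmin_glb_lt; auto. }
  intros y Hy.
  assert (Cmod (y-z) < d2 /\ Cmod (y-z) < d3 /\ Cmod (y-z) < d4) as [K2 [K3 K4]].
  { revert Hy. unfold Rmin. repeat destruct Rle_dec; intros; repeat split; lra. }
  specialize (H2 y K2). specialize (H3 y K3). specialize (H4 y K4). specialize (H1 (f y) H4).
  replace (g (f y) - g (f z) - m * l * (y - z))%C with
    ((g (f y) - g (f z) - m * (f y - f z)) + m * (f y - f z - l * (y - z)))%C by ring.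
  eapply Rle_trans. apply Cmod_triangle. rewrite Cmod_mult.
  set (h := Cmod (y - z)) in *. assert (Ph : 0 <= h) by apply Cmod_ge_0.
  assert (Q1 : eps / (2 * A) * Cmod (f y - f z) <= eps / 2 * h).
  { replace (eps / 2 * h) with (eps / (2 * A) * (A * h)) by (field; lra).
    apply Rmult_le_compat_l; auto. apply Rlt_le, Rdiv_lt_0_compat; lra. }
  assert (Q2 : Cmod m * Cmod (f y - f z - l * (y - z)) <= eps / 2 * h).
  { replace (eps / 2 * h) with (B * (eps / (2 * B) * h)) by (field; lra).
    apply Rmult_le_compat; auto; try apply Cmod_ge_0. unfold B; lra. }
  lra.
Qed.

Lemma Cdiff_unique f z l m : Cdiff f z l -> Cdiff f z m -> l = m.
Proof.
  intros H1 H2. apply is_derive_Cdiff, is_C_derive_unique in H1.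
  apply is_derive_Cdiff, is_C_derive_unique in H2. congruence.
Qed.

Lemma Cdiff_inv (z : C) : z <> RtoC 0 -> Cdiff (fun x => / x)%C z (- / (z * z)).
Proof.
  intros Hz eps He. assert (Pz := proj1 (Cmod_gt_0 z) Hz). set (r := Cmod z) in *.
  (* The error is [(y - z)^2 / (z^2 y)]. The first radius gives [|y| >= r / 2], and then the second
     gives [|y - z| <= eps * r^2 * |y|]. *)
  exists (Rmin (r / 2) (eps * r * r * r / 2)). split.
  { apply Rmin_glb_lt. lra. assert (0 < eps * r * r * r) by (repeat apply Rmult_lt_0_compat; auto). lra. }
  intros y Hy.
  assert (Cmod (y-z) < r / 2) as K1 by (eapply Rlt_le_trans; [exact Hy | apply Rmin_l]).
  assert (Cmod (y-z) < eps * r * r * r / 2) as K2 by (eapply Rlt_le_trans; [exact Hy | apply Rmin_r]).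
  assert (Ky : r / 2 <= Cmod y).
  { assert (r <= Cmod y + Cmod (y - z)).
    { unfold r. replace z with (y + - (y - z))%C at 1 by ring. rewrite <- (Cmod_opp (y - z)). apply Cmod_triangle. } lra. }
  assert (Hy0 : y <> RtoC 0). { intros ->. rewrite Cmod_0 in Ky. lra. }
  replace (/ y - / z - - / (z * z) * (y - z))%C with ((y - z) * (y - z) * / (z * z * y))%C by (field; auto).
  rewrite !Cmod_mult. rewrite Cmod_inv by (repeat apply Cmult_neq_0; auto).
  rewrite !Cmod_mult. fold r. set (h := Cmod (y - z)) in *. assert (Ph : 0 <= h) by apply Cmod_ge_0.
  assert (h * / (r * r * Cmod y) <= eps).
  { apply Rmult_le_reg_r with (r * r * Cmod y). repeat apply Rmult_lt_0_compat; lra.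
    rewrite Rmult_assoc, Rinv_l by (apply Rgt_not_eq; repeat apply Rmult_lt_0_compat; lra).
    assert (eps * (r * r * (r/2)) <= eps * (r * r * Cmod y)).
    { apply Rmult_le_compat_l. lra. apply Rmult_le_compat_l; nra. } nra. }
  nra.
Qed.

Lemma derC_Cdiff f z l : Cdiff f z l -> derC f z = l.
Proof.
  intros H. unfold derC. apply (Cdiff_unique f z); auto.
  apply is_derive_Cdiff. apply epsilon_spec. exists l. now apply is_derive_Cdiff.
Qed.

Lemma holo_Cdiff f z : holo f -> UHP z -> Cdiff f z (derC f z).
Proof.
  intros H Hz. destruct (H z Hz) as [l Hl]. apply is_derive_Cdiff in Hl.
  now rewrite (derC_Cdiff f z l Hl).
Qed.

Lemma Cdiff_holo f : (forall z, UHP z -> exists l, Cdiff f z l) -> holo f.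
Proof. intros H z Hz. destruct (H z Hz) as [l Hl]. exists l. now apply is_derive_Cdiff. Qed.

(** * Contour integrals over rectangles *)

Definition Ccont (f : C -> C) (z : C) : Prop :=
  forall eps, 0 < eps -> exists d, 0 < d /\ forall y, Cmod (y - z) < d -> Cmod (f y - f z) < eps.

Definition is_CInt (f : R -> C) (a b : R) (l : C) : Prop := @is_RInt C_R_NormedModule f a b l.
Definition ex_CInt (f : R -> C) (a b : R) : Prop := @ex_RInt C_R_NormedModule f a b.
Definition CInt (f : R -> C) (a b : R) : C := @RInt C_R_CompleteNormedModule f a b.

Lemma CInt_correct f a b : ex_CInt f a b -> is_CInt f a b (CInt f a b).
Proof. exact (@RInt_correct C_R_CompleteNormedModule f a b). Qed.

Lemma CInt_unique f a b l : is_CInt f a b l -> CInt f a b = l.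
Proof. exact (@is_RInt_unique C_R_CompleteNormedModule f a b l). Qed.

Lemma CInt_plus f g a b : ex_CInt f a b -> ex_CInt g a b -> CInt (fun t => f t + g t)%C a b = (CInt f a b + CInt g a b)%C.
Proof. exact (@RInt_plus C_R_CompleteNormedModule f g a b). Qed.

Lemma CInt_const c a b : CInt (fun _ => c) a b = (RtoC (b - a) * c)%C.
Proof. unfold CInt. rewrite RInt_const. apply scal_R_Cmult. Qed.

Lemma CInt_Chasles f a b c : ex_CInt f a b -> ex_CInt f b c -> CInt f a c = (CInt f a b + CInt f b c)%C.
Proof. intros. symmetry. now apply (@RInt_Chasles C_R_CompleteNormedModule). Qed.

(** Here [C] is a module over the reals, so a complex factor is not a scalar of the structure; the
    real and imaginary parts of [c * f] are integrated separately. *)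
Lemma is_CInt_scal f a b l c : is_CInt f a b l -> is_CInt (fun t => c * f t)%C a b (c * l)%C.
Proof.
  intros H. pose proof (is_RInt_fct_extend_fst _ _ _ _ H) as H1.
  pose proof (is_RInt_fct_extend_snd _ _ _ _ H) as H2.
  apply is_RInt_fct_extend_pair.
  - apply (is_RInt_minus (V := R_NormedModule));
    apply (is_RInt_scal (V := R_NormedModule)); assumption.
  - apply (is_RInt_plus (V := R_NormedModule));
    apply (is_RInt_scal (V := R_NormedModule)); assumption.
Qed.

Lemma CInt_scal f a b c : ex_CInt f a b -> CInt (fun t => c * f t)%C a b = (c * CInt f a b)%C.
Proof. intros H. apply CInt_unique, is_CInt_scal, CInt_correct, H. Qed.

Lemma ex_CInt_scal f a b c : ex_CInt f a b -> ex_CInt (fun t => c * f t)%C a b.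
Proof. intros [l H]. exists (c * l)%C. now apply is_CInt_scal. Qed.

Lemma CInt_ext f g a b : a <= b -> (forall t, a <= t <= b -> f t = g t) -> CInt f a b = CInt g a b.
Proof.
  intros Hab H. apply (@RInt_ext C_R_CompleteNormedModule). intros t. rewrite Rmin_left, Rmax_right by auto.
  intros. apply H. lra.
Qed.

Lemma norm_Cmod (c : C_R_NormedModule) : norm c = Cmod c.
Proof.
  destruct c as [x y]. unfold norm, Cmod; simpl. unfold prod_norm; simpl. f_equal.
  unfold norm; simpl. unfold abs; simpl. rewrite !Rmult_1_r.
  rewrite <- !Rabs_mult. rewrite !Rabs_pos_eq; auto; nra.
Qed.

Lemma CInt_bound f a b M : a <= b -> ex_CInt f a b -> (forall t, a <= t <= b -> Cmod (f t) <= M) ->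
  Cmod (CInt f a b) <= (b - a) * M.
Proof.
  intros Hab He H. rewrite <- norm_Cmod.
  apply (norm_RInt_le_const f a b); auto.
  - intros x Hx. rewrite norm_Cmod. now apply H.
  - now apply CInt_correct.
Qed.

Definition Rcont (f : R -> C) (t : R) : Prop :=
  forall eps, 0 < eps -> exists d, 0 < d /\ forall s, Rabs (s - t) < d -> Cmod (f s - f t) < eps.

Lemma ex_CInt_cont f a b : a <= b -> (forall t, a <= t <= b -> Rcont f t) -> ex_CInt f a b.
Proof.
  intros Hab H. apply (@ex_RInt_continuous C_R_CompleteNormedModule).
  rewrite Rmin_left, Rmax_right by auto. intros t Ht.
  intros P [eps HP].
  destruct (H t Ht eps (cond_pos eps)) as [d [Hd Hb]].
  exists (mkposreal d Hd). intros s Hs. apply HP.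
  assert (K := Hb s Hs). 
  pose proof (Rmax_Cmod (f s - f t)%C) as L.
  split.
  - change (Rabs (fst (f s) - fst (f t)) < eps).
    eapply Rle_lt_trans; [|exact K]. eapply Rle_trans; [|exact L]. apply Rmax_l.
  - change (Rabs (snd (f s) - snd (f t)) < eps).
    eapply Rle_lt_trans; [|exact K]. eapply Rle_trans; [|exact L]. apply Rmax_r.
Qed.

Lemma Cmod_horiz (s t y : R) : Cmod ((s, y) - (t, y))%C = Rabs (s - t).
Proof.
  replace ((s, y) - (t, y))%C with (RtoC (s - t)). apply Cmod_R.
  unfold RtoC, Cminus, Cplus, Copp; simpl. f_equal; ring.
Qed.

Lemma Cmod_vert (s t x : R) : Cmod ((x, s) - (x, t))%C = Rabs (s - t).
Proof.
  replace ((x, s) - (x, t))%C with (Ci * RtoC (s - t))%C.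
  rewrite Cmod_mult, Cmod_Ci, Cmod_R; ring.
  unfold RtoC, Cminus, Cplus, Copp, Ci, Cmult; simpl. f_equal; ring.
Qed.

Lemma ex_CInt_horiz f y a b : a <= b -> (forall t, a <= t <= b -> Ccont f (t, y)) ->
  ex_CInt (fun t => f (t, y)) a b.
Proof.
  intros Hab H. apply ex_CInt_cont; auto. intros t Ht eps He.
  destruct (H t Ht eps He) as [d [Hd Hb]]. exists d. split; auto.
  intros s Hs. apply Hb. now rewrite Cmod_horiz.
Qed.

Lemma ex_CInt_vert f x a b : a <= b -> (forall t, a <= t <= b -> Ccont f (x, t)) ->
  ex_CInt (fun t => f (x, t)) a b.
Proof.
  intros Hab H. apply ex_CInt_cont; auto. intros t Ht eps He.
  destruct (H t Ht eps He) as [d [Hd Hb]]. exists d. split; auto.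
  intros s Hs. apply Hb. now rewrite Cmod_vert.
Qed.

(** The contour integral along the boundary, counterclockwise: bottom minus top, plus right minus
    left with [dz = i dt] on the vertical sides. *)
Definition rect_integral (f : C -> C) (a b c d : R) : C :=
  (CInt (fun t => f (t, c)) a b - CInt (fun t => f (t, d)) a b
   + Ci * (CInt (fun t => f (b, t)) c d - CInt (fun t => f (a, t)) c d))%C.

Definition bdry (a b c d : R) (z : C) : Prop :=
  (a <= fst z <= b /\ (snd z = c \/ snd z = d)) \/ (c <= snd z <= d /\ (fst z = a \/ fst z = b)).

Definition rect (a b c d : R) (z : C) : Prop := a <= fst z <= b /\ c <= snd z <= d.

Lemma bdry_rect a b c d z : a <= b -> c <= d -> bdry a b c d z -> rect a b c d z.
Proof. unfold bdry, rect. intuition lra. Qed.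

Lemma ex_rect_integral f a b c d : a <= b -> c <= d -> (forall z, bdry a b c d z -> Ccont f z) ->
  ex_CInt (fun t => f (t, c)) a b /\ ex_CInt (fun t => f (t, d)) a b /\
  ex_CInt (fun t => f (b, t)) c d /\ ex_CInt (fun t => f (a, t)) c d.
Proof.
  intros Hab Hcd H. split; [|split; [|split]]; [apply ex_CInt_horiz | apply ex_CInt_horiz | apply ex_CInt_vert | apply ex_CInt_vert]; auto;
  intros; apply H; unfold bdry; simpl; intuition lra.
Qed.

Lemma rect_integral_split_x f a m b c d : a <= m <= b -> c <= d -> (forall z, bdry a b c d z -> Ccont f z) ->
  rect_integral f a b c d = (rect_integral f a m c d + rect_integral f m b c d)%C.
Proof.
  intros Hm Hcd H. unfold rect_integral.
  rewrite (CInt_Chasles (fun t => f (t, c)) a m b), (CInt_Chasles (fun t => f (t, d)) a m b).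
  ring.
  all: apply ex_CInt_horiz; try lra; intros; apply H; unfold bdry; simpl; intuition lra.
Qed.

Lemma rect_integral_split_y f a b c m d : a <= b -> c <= m <= d -> (forall z, bdry a b c d z -> Ccont f z) ->
  rect_integral f a b c d = (rect_integral f a b c m + rect_integral f a b m d)%C.
Proof.
  intros Hm Hcd H. unfold rect_integral.
  rewrite (CInt_Chasles (fun t => f (b, t)) c m d), (CInt_Chasles (fun t => f (a, t)) c m d).
  ring.
  all: apply ex_CInt_vert; try lra; intros; apply H; unfold bdry; simpl; intuition lra.
Qed.

Lemma rect_integral_plus f g a b c d : a <= b -> c <= d -> (forall z, bdry a b c d z -> Ccont f z) ->
  (forall z, bdry a b c d z -> Ccont g z) ->
  rect_integral (fun z => f z + g z)%C a b c d = (rect_integral f a b c d + rect_integral g a b c d)%C.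
Proof.
  intros Hab Hcd Hf Hg. destruct (ex_rect_integral f a b c d) as [F1 [F2 [F3 F4]]]; auto.
  destruct (ex_rect_integral g a b c d) as [G1 [G2 [G3 G4]]]; auto.
  unfold rect_integral. rewrite !CInt_plus; auto. ring.
Qed.

Lemma rect_integral_scal k f a b c d : a <= b -> c <= d -> (forall z, bdry a b c d z -> Ccont f z) ->
  rect_integral (fun z => k * f z)%C a b c d = (k * rect_integral f a b c d)%C.
Proof.
  intros Hab Hcd Hf. destruct (ex_rect_integral f a b c d) as [F1 [F2 [F3 F4]]]; auto.
  unfold rect_integral. rewrite !CInt_scal; auto. ring.
Qed.

Lemma rect_integral_ext f g a b c d : a <= b -> c <= d -> (forall z, bdry a b c d z -> f z = g z) ->
  rect_integral f a b c d = rect_integral g a b c d.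
Proof.
  intros Hab Hcd H. unfold rect_integral.
  rewrite (CInt_ext (fun t => f (t, c)) (fun t => g (t, c))),
   (CInt_ext (fun t => f (t, d)) (fun t => g (t, d))), 
   (CInt_ext (fun t => f (b, t)) (fun t => g (b, t))), 
   (CInt_ext (fun t => f (a, t)) (fun t => g (a, t))); auto;
  intros; apply H; unfold bdry; simpl; intuition lra.
Qed.

Lemma rect_integral_bound f a b c d M : a <= b -> c <= d -> (forall z, bdry a b c d z -> Ccont f z) ->
  (forall z, bdry a b c d z -> Cmod (f z) <= M) ->
  Cmod (rect_integral f a b c d) <= 2 * ((b - a) + (d - c)) * M.
Proof.
  intros Hab Hcd Hf HM. destruct (ex_rect_integral f a b c d) as [F1 [F2 [F3 F4]]]; auto.
  assert (K1 : Cmod (CInt (fun t => f (t, c)) a b) <= (b - a) * M).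
  { apply CInt_bound; auto. intros; apply HM; unfold bdry; simpl; intuition lra. }
  assert (K2 : Cmod (CInt (fun t => f (t, d)) a b) <= (b - a) * M).
  { apply CInt_bound; auto. intros; apply HM; unfold bdry; simpl; intuition lra. }
  assert (K3 : Cmod (CInt (fun t => f (b, t)) c d) <= (d - c) * M).
  { apply CInt_bound; auto. intros; apply HM; unfold bdry; simpl; intuition lra. }
  assert (K4 : Cmod (CInt (fun t => f (a, t)) c d) <= (d - c) * M).
  { apply CInt_bound; auto. intros; apply HM; unfold bdry; simpl; intuition lra. }
  unfold rect_integral. eapply Rle_trans. apply Cmod_triangle. rewrite Cmod_mult, Cmod_Ci, Rmult_1_l.
  assert (T : forall u v : C, Cmod (u - v) <= Cmod u + Cmod v).
  { intros. eapply Rle_trans. apply Cmod_triangle. rewrite Cmod_opp. lra. }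
  eapply Rle_trans. apply Rplus_le_compat; apply T. lra.
Qed.

Lemma Cdiff_Ccont f z l : Cdiff f z l -> Ccont f z.
Proof. intros H. exact (Cdiff_continuous f z l H). Qed.

Lemma Cdiff_affine (u v z : C) : Cdiff (fun x => u + v * x)%C z v.
Proof.
  intros eps He. exists 1; split; [lra|]. intros y _.
  replace (u + v * y - (u + v * z) - v * (y - z))%C with (RtoC 0) by ring. rewrite Cmod_0.
  generalize (Cmod_ge_0 (y - z)). nra.
Qed.

(** On opposite sides an affine function differs by a constant, [v i (c - d)] for bottom and top and
    [v (b - a)] for right and left; the two contributions cancel. *)
Lemma rect_integral_affine (u v : C) a b c d : a <= b -> c <= d -> rect_integral (fun z => u + v * z)%C a b c d = RtoC 0.
Proof.
  intros Hab Hcd.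
  destruct (ex_rect_integral (fun z => u + v * z)%C a b c d) as [F1 [F2 [F3 F4]]]; auto.
  { intros. eapply Cdiff_Ccont, Cdiff_affine. }
  unfold rect_integral.
  rewrite (CInt_ext (fun t => u + v * (t, c))%C (fun t => (u + v * (t, d)) + v * (Ci * RtoC (c - d)))%C); auto.
  rewrite (CInt_ext (fun t => u + v * (b, t))%C (fun t => (u + v * (a, t)) + v * RtoC (b - a))%C); auto.
  rewrite (CInt_plus (fun t => u + v * (t, d))%C (fun _ => v * (Ci * RtoC (c - d)))%C); auto.
  2: apply ex_RInt_const.
  rewrite (CInt_plus (fun t => u + v * (a, t))%C (fun _ => v * RtoC (b - a))%C); auto.
  2: apply ex_RInt_const.
  rewrite !CInt_const.
  replace (RtoC (c - d)) with (- RtoC (d - c))%C by (rewrite <- RtoC_opp; f_equal; ring).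
  ring.
  - intros. rewrite <- Cplus_assoc, <- Cmult_plus_distr_l. do 2 f_equal.
    unfold RtoC, Ci, Cplus, Cmult; simpl; f_equal; ring.
  - intros. rewrite <- Cplus_assoc, <- Cmult_plus_distr_l. do 2 f_equal.
    unfold RtoC, Ci, Cplus, Cmult; simpl; f_equal; ring.
Qed.

(** * Goursat's lemma by bisection *)

(** Serves to choose nested rectangles: [P] is the invariant kept at stage [n] and [Q] the relation
    between consecutive stages. The recursion runs in a subset type because each choice needs the
    proof of the previous invariant. *)
Lemma dependent_choice_nat {A : Type} (P : nat -> A -> Prop) (Q : nat -> A -> A -> Prop) (x0 : A) :
  P O x0 -> (forall n x, P n x -> exists y, P (S n) y /\ Q n x y) ->
  exists s : nat -> A, s O = x0 /\ forall n, P n (s n) /\ Q n (s n) (s (S n)).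
Proof.
  intros H0 HS.
  set (step := fun n (x : {x | P n x}) =>
     constructive_indefinite_description _ (HS n (proj1_sig x) (proj2_sig x))).
  set (t := fix t n : {x | P n x} := match n with
     | O => exist _ x0 H0
     | S m => exist _ (proj1_sig (step m (t m))) (proj1 (proj2_sig (step m (t m)))) end).
  exists (fun n => proj1_sig (t n)). split; auto.
  intros n. split. apply (proj2_sig (t n)).
  exact (proj2 (proj2_sig (step n (t n)))).
Qed.

(** The supremum of the left ends [s n] works, since every left end lies below every right end. *)
Lemma nested_intervals (s L : nat -> R) : (forall n, 0 <= L n) ->
  (forall n, s n <= s (S n) /\ s (S n) + L (S n) <= s n + L n) ->
  exists x, forall n, s n <= x <= s n + L n.
Proof.
  intros HL H.
  assert (M : forall n k, s n <= s (n + k)%nat /\ s (n + k)%nat + L (n + k)%nat <= s n + L n).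
  { intros n. induction k. rewrite Nat.add_0_r; lra.
    rewrite Nat.add_succ_r. specialize (H (n + k)%nat). lra. }
  assert (U : forall n m, s n <= s m + L m).
  { intros n m. destruct (Nat.le_gt_cases m n) as [K|K].
    - destruct (M m (n - m)%nat) as [_ K2]. replace (m + (n - m))%nat with n in K2 by lia.
      specialize (HL n). lra.
    - destruct (M n (m - n)%nat) as [K2 _]. replace (n + (m - n))%nat with m in K2 by lia.
      specialize (HL m). lra. }
  destruct (completeness (fun y => exists n, y = s n)) as [x [X1 X2]].
  - exists (s O + L O). intros y [n ->]. apply U.
  - exists (s O). now exists O.
  - exists x. intros n. split. apply X1. now exists n.
    apply X2. intros y [k ->]. apply U.
Qed.

(** The integral is the sum of those over the four quarters, so by the triangle inequality one
    quarter carries more than a fourth of the bound. *)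
Lemma rect_integral_bisect f a w c h e : 0 <= w -> 0 <= h ->
  (forall z, rect a (a + 2 * w) c (c + 2 * h) z -> Ccont f z) ->
  4 * e < Cmod (rect_integral f a (a + 2 * w) c (c + 2 * h)) ->
  exists a' c', (a' = a \/ a' = a + w) /\ (c' = c \/ c' = c + h) /\
    e < Cmod (rect_integral f a' (a' + w) c' (c' + h)).
Proof.
  intros Hw Hh Hf HJ.
  assert (E : rect_integral f a (a + 2 * w) c (c + 2 * h) =
    ((rect_integral f a (a + w) c (c + h) + rect_integral f a (a + w) (c + h) (c + h + h)) +
     (rect_integral f (a + w) (a + w + w) c (c + h) + rect_integral f (a + w) (a + w + w) (c + h) (c + h + h)))%C).
  { rewrite (rect_integral_split_x f a (a + w)); try lra.
    rewrite (rect_integral_split_y f a (a + w) c (c + h)); try lra.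
    rewrite (rect_integral_split_y f (a + w) (a + 2 * w) c (c + h)); try lra.
    replace (a + w + w) with (a + 2 * w) by ring. replace (c + h + h) with (c + 2 * h) by ring.
    reflexivity.
    all: intros z Hz; apply Hf; apply bdry_rect in Hz; try lra; unfold rect in *; lra. }
  rewrite E in HJ.
  destruct (Rlt_le_dec e (Cmod (rect_integral f a (a + w) c (c + h)))) as [K1|K1].
  { exists a, c. auto. }
  destruct (Rlt_le_dec e (Cmod (rect_integral f a (a + w) (c + h) (c + h + h)))) as [K2|K2].
  { exists a, (c + h). auto. }
  destruct (Rlt_le_dec e (Cmod (rect_integral f (a + w) (a + w + w) c (c + h)))) as [K3|K3].
  { exists (a + w), c. auto. }
  destruct (Rlt_le_dec e (Cmod (rect_integral f (a + w) (a + w + w) (c + h) (c + h + h)))) as [K4|K4].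
  { exists (a + w), (c + h). auto. }
  exfalso. apply Rlt_not_le in HJ. apply HJ.
  eapply Rle_trans. apply Cmod_triangle.
  eapply Rle_trans. apply Rplus_le_compat; apply Cmod_triangle. lra.
Qed.

Lemma Cmod_le_sum z : Cmod z <= Rabs (fst z) + Rabs (snd z).
Proof.
  replace z with (RtoC (fst z) + Ci * RtoC (snd z))%C at 1.
  eapply Rle_trans. apply Cmod_triangle. rewrite Cmod_mult, Cmod_Ci, !Cmod_R. lra.
  destruct z. unfold RtoC, Ci, Cplus, Cmult; simpl. f_equal; ring.
Qed.

(** A nonzero integral would leave, after [n] bisections, a rectangle with integral larger than
    [e / 4^n]. At the common point [f] is affine up to an error small against the distance, and
    affine functions integrate to zero, so these integrals are eventually smaller than that. *)
Lemma goursat f a b c d : a <= b -> c <= d ->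
  (forall z, rect a b c d z -> exists l, Cdiff f z l) -> rect_integral f a b c d = RtoC 0.
Proof.
  intros Hab Hcd Hf.
  destruct (Ceq_dec (rect_integral f a b c d) (RtoC 0)) as [E|E]; auto. exfalso.
  (* Half the modulus, so that the strict invariant [e * r n * r n < ...] holds at stage 0. *)
  set (e := Cmod (rect_integral f a b c d) / 2).
  assert (Pe : 0 < e). { apply Cmod_gt_0 in E. unfold e; lra. }
  assert (Hc : forall z, rect a b c d z -> Ccont f z).
  { intros z Hz. destruct (Hf z Hz) as [l Hl]. eapply Cdiff_Ccont; eauto. }
  set (r := fun n : nat => / 2 ^ n).
  assert (Pr : forall n, 0 < r n). { intros n. apply Rinv_0_lt_compat, pow_lt; lra. }
  assert (Er : forall n, r n = 2 * r (S n)). { intros n. unfold r. simpl. field. apply pow_nonzero; lra. }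
  set (w := fun n => (b - a) * r n). set (h := fun n => (d - c) * r n).
  assert (Pw : forall n, 0 <= w n). { intros n. unfold w. specialize (Pr n). nra. }
  assert (Ph : forall n, 0 <= h n). { intros n. unfold h. specialize (Pr n). nra. }
  assert (Ew : forall n, w n = 2 * w (S n)). { intros n. unfold w. rewrite (Er n). ring. }
  assert (Eh : forall n, h n = 2 * h (S n)). { intros n. unfold h. rewrite (Er n). ring. }
  destruct (dependent_choice_nat
    (fun n (p : R * R) => a <= fst p /\ fst p + w n <= b /\ c <= snd p /\ snd p + h n <= d /\
       e * r n * r n < Cmod (rect_integral f (fst p) (fst p + w n) (snd p) (snd p + h n)))
    (fun n p q => (fst p <= fst q /\ fst q + w (S n) <= fst p + w n) /\
                  (snd p <= snd q /\ snd q + h (S n) <= snd p + h n)) (a, c)) as [s [Hs0 Hs]].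
  - unfold w, h, r; simpl. rewrite Rinv_1, !Rmult_1_r.
    replace (a + (b - a)) with b by ring. replace (c + (d - c)) with d by ring.
    repeat split; try lra. unfold e. unfold e in Pe. lra.
  - intros n [a' c'] [H1 [H2 [H3 [H4 H5]]]]. simpl in *.
    rewrite (Ew n), (Eh n) in H5.
    destruct (rect_integral_bisect f a' (w (S n)) c' (h (S n)) (e * r (S n) * r (S n))) as [a2 [c2 [Ha [Hc2 HJ]]]]; auto.
    + intros z Hz. apply Hc. rewrite <- Ew, <- Eh in Hz. unfold rect in *; lra.
    + rewrite (Er n) in H5. lra.
    + exists (a2, c2). simpl. specialize (Ew n). specialize (Eh n).
      specialize (Pw (S n)). specialize (Ph (S n)).
      destruct Ha as [-> | ->], Hc2 as [-> | ->]; repeat split; try lra.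
  - destruct (nested_intervals (fun n => fst (s n)) w Pw) as [px Hpx].
    { intros n. apply (Hs n). }
    destruct (nested_intervals (fun n => snd (s n)) h Ph) as [py Hpy].
    { intros n. apply (Hs n). }
    set (p := (px, py) : C).
    destruct (Hf p) as [l Hl].
    { specialize (Hpx O). specialize (Hpy O). rewrite Hs0 in *. unfold w, h, r in *. simpl in *.
      rewrite Rinv_1 in *. unfold rect, p; simpl. lra. }
    (* The added 1 keeps [W] positive for a degenerate rectangle. At stage [N] width plus height is
       at most [W * r N]; the tolerance [e / (2 W^2)] times this length, times the perimeter, is
       then at most [e * r N * r N]. *)
    set (W := (b - a) + (d - c) + 1). assert (PW : 1 <= W) by (unfold W; lra).
    destruct (Hl (e / (2 * W * W))) as [dl [Hdl Hb]].
    { apply Rdiv_lt_0_compat; auto. nra. }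
    destruct (pow_lt_1_zero (/ 2)) with (y := dl / W) as [N HN].
    { rewrite Rabs_pos_eq; lra. }
    { apply Rdiv_lt_0_compat; lra. }
    specialize (HN N (le_n N)). rewrite pow_inv in HN. fold (r N) in HN.
    rewrite Rabs_pos_eq in HN by (apply Rlt_le, Pr).
    destruct (Hs N) as [[H1 [H2 [H3 [H4 H5]]]] _].
    specialize (Hpx N). specialize (Hpy N). simpl in Hpx, Hpy.
    set (A := fst (s N)) in *. set (B := snd (s N)) in *.
    (* [f] minus its first-order expansion at [p]; the integral is unchanged. *)
    set (g := fun z => (f z + ((- f p + l * p) + - l * z))%C).
    assert (Hfc : forall z, bdry A (A + w N) B (B + h N) z -> Ccont f z).
    { intros z Hz. apply Hc. apply bdry_rect in Hz; try (specialize (Pw N); specialize (Ph N); lra).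
      unfold rect in *; lra. }
    assert (Ac : forall z, Ccont (fun z => (- f p + l * p) + - l * z)%C z).
    { intros z. eapply Cdiff_Ccont, Cdiff_affine. }
    assert (EJ : rect_integral f A (A + w N) B (B + h N) = rect_integral g A (A + w N) B (B + h N)).
    { unfold g. specialize (Pw N). specialize (Ph N). rewrite rect_integral_plus; try lra; auto.
      rewrite rect_integral_affine by lra. ring. }
    assert (PT : 0 <= w N + h N) by (specialize (Pw N); specialize (Ph N); lra).
    assert (ET : w N + h N <= W * r N).
    { unfold w, h, W. specialize (Pr N). nra. }
    assert (ED : W * r N < dl).
    { apply Rmult_lt_compat_l with (r := W) in HN; try lra.
      replace (W * (dl / W)) with dl in HN by (field; lra). exact HN. }
    assert (BJ : Cmod (rect_integral g A (A + w N) B (B + h N)) <=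
       2 * ((A + w N - A) + (B + h N - B)) * (e / (2 * W * W) * (w N + h N))).
    { apply rect_integral_bound; try (specialize (Pw N); specialize (Ph N); lra).
      - intros z Hz. unfold g. destruct (Hf z) as [lz Hlz].
        { apply bdry_rect in Hz; try (specialize (Pw N); specialize (Ph N); lra).
          unfold rect in *; lra. }
        eapply Cdiff_Ccont. apply Cdiff_plus. exact Hlz. apply Cdiff_affine.
      - intros z Hz.
        assert (Dz : Cmod (z - p) <= w N + h N).
        { eapply Rle_trans. apply Cmod_le_sum. unfold p. simpl.
          apply bdry_rect in Hz; try (specialize (Pw N); specialize (Ph N); lra).
          unfold rect in Hz. apply Rplus_le_compat; apply Rabs_le; lra. }
        unfold g. replace (f z + (- f p + l * p + - l * z))%C with (f z - f p - l * (z - p))%C by ring.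
        eapply Rle_trans. apply Hb. lra.
        apply Rmult_le_compat_l; auto. apply Rlt_le, Rdiv_lt_0_compat; auto. nra. }
    rewrite EJ in H5.
    replace (A + w N - A + (B + h N - B)) with (w N + h N) in BJ by ring.
    assert (F : 2 * (w N + h N) * (e / (2 * W * W) * (w N + h N)) <= e * r N * r N).
    { replace (2 * (w N + h N) * (e / (2 * W * W) * (w N + h N))) with
        (e / (W * W) * ((w N + h N) * (w N + h N))) by (field; lra).
      replace (e * r N * r N) with (e / (W * W) * ((W * r N) * (W * r N))) by (field; lra).
      apply Rmult_le_compat_l. apply Rlt_le, Rdiv_lt_0_compat; auto; nra.
      apply Rmult_le_compat; auto. }
    lra.
Qed.

(** * Cauchy's formula *)

Lemma Ccont_const (k z : C) : Ccont (fun _ => k) z.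
Proof. eapply Cdiff_Ccont, Cdiff_const. Qed.

Lemma Ccont_plus f g z : Ccont f z -> Ccont g z -> Ccont (fun x => f x + g x)%C z.
Proof.
  intros Hf Hg eps He. destruct (Hf (eps/2)) as [d [Hd H1]]; [lra|].
  destruct (Hg (eps/2)) as [e [Hpe H2]]; [lra|].
  exists (Rmin d e). split. now apply Rmin_glb_lt.
  intros y Hy.
  assert (Cmod (y-z) < d) as H3 by (eapply Rlt_le_trans; [exact Hy | apply Rmin_l]).
  assert (Cmod (y-z) < e) as H4 by (eapply Rlt_le_trans; [exact Hy | apply Rmin_r]).
  specialize (H1 y H3). specialize (H2 y H4).
  replace (f y + g y - (f z + g z))%C with ((f y - f z) + (g y - g z))%C by ring.
  eapply Rle_lt_trans. apply Cmod_triangle. lra.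
Qed.

Lemma Ccont_mult f g z : Ccont f z -> Ccont g z -> Ccont (fun x => f x * g x)%C z.
Proof.
  intros Hf Hg eps He.
  set (A := Cmod (f z) + Cmod (g z) + 1).
  assert (PA : 0 < A /\ Cmod (f z) <= A /\ Cmod (g z) <= A).
  { unfold A. generalize (Cmod_ge_0 (f z)) (Cmod_ge_0 (g z)). intros. repeat split; lra. }
  destruct PA as [PA [A1 A2]].
  set (e := Rmin 1 (eps / (4 * A))).
  assert (Pe : 0 < e) by (apply Rmin_glb_lt; [lra | apply Rdiv_lt_0_compat; lra]).
  assert (Ee : e * A * 4 <= eps).
  { replace eps with (eps / (4 * A) * A * 4) by (field; lra).
    apply Rmult_le_compat_r; [lra|]. apply Rmult_le_compat_r; [lra|]. apply Rmin_r. }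
  assert (E1 : e <= 1) by apply Rmin_l.
  destruct (Hf e Pe) as [d1 [Hd1 H1]]. destruct (Hg e Pe) as [d2 [Hd2 H2]].
  exists (Rmin d1 d2). split. now apply Rmin_glb_lt.
  intros y Hy.
  assert (Cmod (y-z) < d1) as H3 by (eapply Rlt_le_trans; [exact Hy | apply Rmin_l]).
  assert (Cmod (y-z) < d2) as H4 by (eapply Rlt_le_trans; [exact Hy | apply Rmin_r]).
  specialize (H1 y H3). specialize (H2 y H4).
  replace (f y * g y - f z * g z)%C with
    ((f y - f z) * g z + f z * (g y - g z) + (f y - f z) * (g y - g z))%C by ring.
  eapply Rle_lt_trans. apply Cmod_triangle.
  eapply Rle_lt_trans. apply Rplus_le_compat_r. apply Cmod_triangle.
  rewrite !Cmod_mult.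
  generalize (Cmod_ge_0 (f z)) (Cmod_ge_0 (g z)) (Cmod_ge_0 (f y - f z)) (Cmod_ge_0 (g y - g z)). intros.
  assert (1 <= A) by (unfold A; lra).
  assert (Q1 : Cmod (f y - f z) * Cmod (g z) <= e * A) by (apply Rmult_le_compat; lra).
  assert (Q2 : Cmod (f z) * Cmod (g y - g z) <= A * e) by (apply Rmult_le_compat; lra).
  assert (Q3 : Cmod (f y - f z) * Cmod (g y - g z) <= e * e) by (apply Rmult_le_compat; lra).
  nra.
Qed.

Lemma Ccont_inv_sub (w z : C) : z <> w -> Ccont (fun x => / (x - w))%C z.
Proof.
  intros H. eapply Cdiff_Ccont.
  apply (Cdiff_comp (fun x => x - w)%C (fun x => / x)%C z 1).
  - apply (Cdiff_ext_loc (fun x => - w + 1 * x)%C _ z _ 1); [lra | intros; ring | apply Cdiff_affine].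
  - apply Cdiff_inv. now apply Cminus_eq_contra.
Qed.

Lemma Cdiff_inv_sub (w z : C) : z <> w -> exists l, Cdiff (fun x => / (x - w))%C z l.
Proof.
  intros H. eexists.
  apply (Cdiff_comp (fun x => x - w)%C (fun x => / x)%C z 1).
  - apply (Cdiff_ext_loc (fun x => - w + 1 * x)%C _ z _ 1); [lra | intros; ring | apply Cdiff_affine].
  - apply Cdiff_inv. now apply Cminus_eq_contra.
Qed.

(** Cutting off the strips left, right, below and above a small square around the puncture reduces
    the integral to that square. Its perimeter is [8 n], so boundedness of [f] makes the integral
    smaller than any positive number. *)
Lemma goursat_punctured f a b c d (u v : R) M : a < u < b -> c < v < d ->
  (forall z, rect a b c d z -> z <> (u, v) -> exists l, Cdiff f z l) ->
  (exists r, 0 < r /\ forall z, z <> (u, v) -> Cmod (z - (u, v)) < r -> Cmod (f z) <= M) ->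
  rect_integral f a b c d = RtoC 0.
Proof.
  intros Hu Hv Hf [r [Hr HM]].
  destruct (Ceq_dec (rect_integral f a b c d) (RtoC 0)) as [E|E]; auto. exfalso.
  apply Cmod_gt_0 in E. set (e := Cmod (rect_integral f a b c d)) in *.
  set (M' := Rmax M 0 + 1). assert (PM : 1 <= M') by (unfold M'; generalize (Rmax_r M 0); lra).
  assert (LM : M <= M') by (unfold M'; generalize (Rmax_l M 0); lra).
  assert (exists n, 0 < n /\ n < r / 2 /\ n < u - a /\ n < b - u /\ n < v - c /\ n < d - v /\ n < e / (8 * M')) as
    [n [N0 [N1 [N2 [N3 [N4 [N5 N6]]]]]]].
  { set (m := Rmin (Rmin (Rmin (r/2) (u - a)) (Rmin (b - u) (v - c))) (Rmin (d - v) (e / (8 * M')))).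
    assert (0 < m). { unfold m. repeat apply Rmin_glb_lt; try lra. apply Rdiv_lt_0_compat; lra. }
    assert (m <= r/2 /\ m <= u - a /\ m <= b - u /\ m <= v - c /\ m <= d - v /\ m <= e / (8 * M')).
    { unfold m, Rmin. repeat destruct Rle_dec; repeat split; lra. }
    exists (m / 2). lra. }
  assert (HC : forall z, rect a b c d z -> fst z <> u \/ snd z <> v -> exists l, Cdiff f z l).
  { intros z Hz Hn. apply Hf; auto. intros ->. simpl in Hn. intuition. }
  assert (HB : forall a' b' c' d', a <= a' <= b' -> b' <= b -> c <= c' <= d' -> d' <= d ->
     (a' <> u /\ b' <> u /\ c' <> v /\ d' <> v) ->
     forall z, bdry a' b' c' d' z -> Ccont f z).
  { intros a' b' c' d' A1 A2 A3 A4 A5 z Hz. destruct (HC z) as [l Hl].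
    - unfold bdry, rect in *. intuition lra.
    - unfold bdry in Hz. intuition congruence.
    - eapply Cdiff_Ccont; eauto. }
  assert (EJ : rect_integral f a b c d = rect_integral f (u - n) (u + n) (v - n) (v + n)).
  { rewrite (rect_integral_split_x f a (u - n) b); try lra. 2: apply HB; lra.
    rewrite (goursat f a (u - n)); try lra.
    2: { intros z Hz. unfold rect in Hz. apply HC. unfold rect; lra. left; lra. }
    rewrite (rect_integral_split_x f (u - n) (u + n) b); try lra. 2: apply HB; lra.
    rewrite (goursat f (u + n) b); try lra.
    2: { intros z Hz. unfold rect in Hz. apply HC. unfold rect; lra. left; lra. }
    rewrite (rect_integral_split_y f (u - n) (u + n) c (v - n) d); try lra. 2: apply HB; lra.
    rewrite (goursat f (u - n) (u + n) c (v - n)); try lra.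
    2: { intros z Hz. unfold rect in Hz. apply HC. unfold rect; lra. right; lra. }
    rewrite (rect_integral_split_y f (u - n) (u + n) (v - n) (v + n) d); try lra. 2: apply HB; lra.
    rewrite (goursat f (u - n) (u + n) (v + n) d); try lra.
    2: { intros z Hz. unfold rect in Hz. apply HC. unfold rect; lra. right; lra. }
    ring. }
  assert (B : e <= 2 * ((u + n - (u - n)) + (v + n - (v - n))) * M').
  { unfold e. rewrite EJ. apply rect_integral_bound; try lra. apply HB; lra.
    intros z Hz. eapply Rle_trans; [|exact LM]. apply HM.
    - intros ->. unfold bdry in Hz; simpl in Hz. lra.
    - eapply Rle_lt_trans. apply Cmod_le_sum. simpl. apply bdry_rect in Hz; try lra.
      unfold rect in Hz. assert (Rabs (fst z + - u) <= n) by (apply Rabs_le; lra).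
      assert (Rabs (snd z + - v) <= n) by (apply Rabs_le; lra). lra. }
  apply Rmult_lt_compat_r with (r := 8 * M') in N6; try lra.
  replace (e / (8 * M') * (8 * M')) with e in N6 by (field; lra). lra.
Qed.

Definition in_rect (a b c d : R) (w : C) : Prop := a < fst w < b /\ c < snd w < d.

Lemma bdry_not_in_rect a b c d z w : in_rect a b c d w -> bdry a b c d z -> z <> w.
Proof. intros [H1 H2] Hz ->. unfold bdry in Hz. lra. Qed.

(** The quotient [(f z - f w) / (z - w)] stays bounded near [w], so its integral vanishes by the
    punctured version of Goursat's lemma. The integral of [1 / (z - w)] is left unevaluated. *)
Lemma cauchy_formula f a b c d w : in_rect a b c d w ->
  (forall z, rect a b c d z -> exists l, Cdiff f z l) ->
  rect_integral (fun z => f z * / (z - w))%C a b c d = (f w * rect_integral (fun z => / (z - w)) a b c d)%C.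
Proof.
  intros Hw Hf. pose proof Hw as [Hu Hv].
  assert (Hfc : forall z, bdry a b c d z -> Ccont f z).
  { intros z Hz. destruct (Hf z) as [l Hl]. apply bdry_rect; auto; lra. eapply Cdiff_Ccont; eauto. }
  assert (Hi : forall z, bdry a b c d z -> Ccont (fun z => / (z - w))%C z).
  { intros z Hz. apply Ccont_inv_sub. eapply bdry_not_in_rect; eauto. }
  assert (E : rect_integral (fun z => (f z + - f w) * / (z - w))%C a b c d = RtoC 0).
  { destruct (Hf w) as [l Hl]. unfold rect; lra.
    destruct (Cdiff_bound f w l Hl) as [r [Hr Hb]].
    apply (goursat_punctured _ a b c d (fst w) (snd w) (Cmod l + 1)); auto;
    replace (fst w, snd w) with w by (destruct w; reflexivity).
    - intros z Hz Hzw. destruct (Hf z Hz) as [m Hm].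
      destruct (Cdiff_inv_sub w z Hzw) as [k Hk].
      eexists. apply Cdiff_mult. apply Cdiff_plus. exact Hm. apply Cdiff_const. exact Hk.
    - exists r. split; auto. intros z Hzw Hz.
      rewrite Cmod_mult, Cmod_inv by now apply Cminus_eq_contra.
      assert (0 < Cmod (z - w)) by (apply Cmod_gt_0; now apply Cminus_eq_contra).
      apply Rmult_le_reg_r with (Cmod (z - w)); auto.
      rewrite Rmult_assoc, Rinv_l, Rmult_1_r by lra. apply (Hb z Hz). }
  rewrite (rect_integral_ext _ (fun z => f z * / (z - w) + (- f w) * / (z - w))%C) in E; try lra.
  2: { intros; ring. }
  rewrite rect_integral_plus in E; try lra.
  2: { intros; apply Ccont_mult; auto. } 2: { intros; apply Ccont_mult; auto. apply Ccont_const. }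
  rewrite rect_integral_scal in E; auto; try lra.
  set (X := rect_integral (fun z => f z * / (z - w))%C a b c d) in *.
  set (Y := rect_integral (fun z => / (z - w))%C a b c d) in *.
  replace X with ((X + - f w * Y) + f w * Y)%C by ring. rewrite E. ring.
Qed.

(** * Derivatives of Cauchy integrals *)

Lemma in_rect_dist a b c d w : in_rect a b c d w ->
  exists r, 0 < r /\ forall z, bdry a b c d z -> r <= Cmod (z - w).
Proof.
  intros [H1 H2]. exists (Rmin (Rmin (fst w - a) (b - fst w)) (Rmin (snd w - c) (d - snd w))).
  split. repeat apply Rmin_glb_lt; lra.
  intros z Hz. eapply Rle_trans; [|apply Rmax_Cmod].
  set (m := Rmin (Rmin (fst w - a) (b - fst w)) (Rmin (snd w - c) (d - snd w))).
  assert (m <= fst w - a /\ m <= b - fst w /\ m <= snd w - c /\ m <= d - snd w).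
  { unfold m, Rmin. repeat destruct Rle_dec; repeat split; lra. }
  simpl. destruct Hz as [[_ [E|E]]|[_ [E|E]]]; rewrite E.
  - eapply Rle_trans; [|apply Rmax_r]. rewrite Rabs_left; lra.
  - eapply Rle_trans; [|apply Rmax_r]. rewrite Rabs_right; lra.
  - eapply Rle_trans; [|apply Rmax_l]. rewrite Rabs_left; lra.
  - eapply Rle_trans; [|apply Rmax_l]. rewrite Rabs_right; lra.
Qed.

(** Differentiation under the integral sign for a kernel [F] with derivative [G] in the parameter:
    the first-order error of [F] is quadratic in [|w' - w|] uniformly on the boundary, hence so is
    the error of the integral. *)
Lemma Cdiff_rect_integral_param phi (F G : C -> C -> C) a b c d M w r B : a <= b -> c <= d ->
  (forall z, bdry a b c d z -> Ccont phi z) ->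
  (forall z, bdry a b c d z -> Cmod (phi z) <= M) ->
  0 < r -> 0 <= B -> 
  (forall w', Cmod (w' - w) < r -> forall z, bdry a b c d z -> Ccont (fun z => F z w') z) ->
  (forall z, bdry a b c d z -> Ccont (fun z => G z w) z) ->
  (forall w', Cmod (w' - w) < r -> forall z, bdry a b c d z ->
     Cmod (F z w' - F z w - (w' - w) * G z w) <= B * (Cmod (w' - w) * Cmod (w' - w))) ->
  Cdiff (fun w => rect_integral (fun z => phi z * F z w)%C a b c d) w (rect_integral (fun z => phi z * G z w)%C a b c d).
Proof.
  intros Hab Hcd Hp HM Hr HB HF HG HR eps He.
  set (M' := Rmax M 0). assert (PM : 0 <= M') by apply Rmax_r. assert (LM : M <= M') by apply Rmax_l.
  set (T := 2 * ((b - a) + (d - c)) * M' * B + 1).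
  assert (PT : 0 < T).
  { unfold T. assert (0 <= 2 * ((b - a) + (d - c)) * M' * B) by (repeat apply Rmult_le_pos; lra). lra. }
  exists (Rmin r (eps / T)). split. apply Rmin_glb_lt; auto. now apply Rdiv_lt_0_compat.
  intros w' Hw'.
  assert (H1 : Cmod (w' - w) < r) by (eapply Rlt_le_trans; [exact Hw' | apply Rmin_l]).
  assert (H2 : Cmod (w' - w) < eps / T) by (eapply Rlt_le_trans; [exact Hw' | apply Rmin_r]).
  assert (H0 : Cmod (w - w) < r).
  { replace (w - w)%C with (RtoC 0) by ring. now rewrite Cmod_0. }
  assert (C1 : forall z, bdry a b c d z -> Ccont (fun z => phi z * F z w')%C z).
  { intros. apply Ccont_mult; auto. }
  assert (C2 : forall z, bdry a b c d z -> Ccont (fun z => phi z * F z w)%C z).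
  { intros. apply Ccont_mult; auto. }
  assert (C3 : forall z, bdry a b c d z -> Ccont (fun z => phi z * G z w)%C z).
  { intros. apply Ccont_mult; auto. }
  assert (E : (rect_integral (fun z => phi z * F z w')%C a b c d - rect_integral (fun z => phi z * F z w)%C a b c d -
     rect_integral (fun z => phi z * G z w)%C a b c d * (w' - w))%C =
     rect_integral (fun z => phi z * F z w' + (- (1) * (phi z * F z w) + (- (w' - w)) * (phi z * G z w)))%C a b c d).
  { rewrite rect_integral_plus; auto. rewrite rect_integral_plus; auto. rewrite !rect_integral_scal; auto. ring.
    intros; apply Ccont_mult; auto; apply Ccont_const.
    intros; apply Ccont_mult; auto; apply Ccont_const.
    intros; apply Ccont_plus; apply Ccont_mult; auto; apply Ccont_const. }
  rewrite E. set (h := Cmod (w' - w)) in *. assert (Ph : 0 <= h) by apply Cmod_ge_0.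
  eapply Rle_trans. apply rect_integral_bound with (M := M' * (B * (h * h))); auto.
  - intros. apply Ccont_plus; auto. apply Ccont_plus; apply Ccont_mult; auto; apply Ccont_const.
  - intros z Hz.
    replace (phi z * F z w' + (- (1) * (phi z * F z w) + (- (w' - w)) * (phi z * G z w)))%C with
     (phi z * (F z w' - F z w - (w' - w) * G z w))%C by ring.
    rewrite Cmod_mult. apply Rmult_le_compat; try apply Cmod_ge_0.
    eapply Rle_trans; [apply HM; auto | exact LM]. apply HR; auto.
  - apply Rmult_lt_compat_r with (r := T) in H2; auto.
    replace (eps / T * T) with eps in H2 by (field; lra). unfold T in H2.
    assert (0 <= 2 * ((b - a) + (d - c)) * M' * B) by (repeat apply Rmult_le_pos; lra).
    replace (2 * (b - a + (d - c)) * (M' * (B * (h * h)))) with ((h * (2 * ((b - a) + (d - c)) * M' * B)) * h) by ring.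
    apply Rmult_le_compat_r; auto. lra.
Qed.

Lemma Cmod_sub_lower (z w w' : C) r : r <= Cmod (z - w) -> Cmod (w' - w) < r / 2 -> r / 2 <= Cmod (z - w').
Proof.
  intros H1 H2. assert (Cmod (z - w) <= Cmod (z - w') + Cmod (w' - w)).
  { replace (z - w)%C with ((z - w') + (w' - w))%C by ring. apply Cmod_triangle. } lra.
Qed.

Lemma Cmod_pos_neq (z w : C) r : 0 < r -> r <= Cmod (z - w) -> z <> w.
Proof. intros H1 H2 ->. replace (w - w)%C with (RtoC 0) in H2 by ring. rewrite Cmod_0 in H2. lra. Qed.

Lemma Cmod_inv_le (z : C) r : 0 < r -> r <= Cmod z -> Cmod (/ z) <= / r.
Proof.
  intros H1 H2. rewrite Cmod_inv. apply Rinv_le_contravar; auto.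
  apply Cmod_gt_0. lra.
Qed.

(** The remainder of the kernel is [(w' - w)^2 / ((z - w)^2 (z - w'))]. With [r] the distance from
    [w] to the boundary, restricting to [|w' - w| < r / 2] keeps all denominators at least [r / 2]
    in modulus. *)
Lemma Cdiff_cauchy1 phi a b c d M w : in_rect a b c d w ->
  (forall z, bdry a b c d z -> Ccont phi z) ->
  (forall z, bdry a b c d z -> Cmod (phi z) <= M) ->
  Cdiff (fun w => rect_integral (fun z => phi z * / (z - w))%C a b c d) w
        (rect_integral (fun z => phi z * (/ (z - w) * / (z - w)))%C a b c d).
Proof.
  intros Hw Hp HM. destruct (in_rect_dist _ _ _ _ _ Hw) as [r [Hr Hd]]. destruct Hw as [Hw1 Hw2].
  assert (Pi : 0 < / (r / 2)) by (apply Rinv_0_lt_compat; lra).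
  apply (Cdiff_rect_integral_param phi (fun z w => / (z - w))%C (fun z w => / (z - w) * / (z - w))%C
    a b c d M w (r / 2) (/ (r/2) * / (r/2) * / (r/2))); auto; try lra.
  - repeat apply Rmult_le_pos; lra.
  - intros w' Hw' z Hz. apply Ccont_inv_sub. apply Cmod_pos_neq with (r/2); try lra.
    eapply Cmod_sub_lower; eauto.
  - intros z Hz. apply Ccont_mult; apply Ccont_inv_sub; apply Cmod_pos_neq with r; auto.
  - intros w' Hw' z Hz. specialize (Hd z Hz). pose proof (Cmod_sub_lower _ _ _ _ Hd Hw') as Hd'.
    assert (N1 : (z - w)%C <> RtoC 0) by (apply Cminus_eq_contra, Cmod_pos_neq with r; auto).
    assert (N2 : (z - w')%C <> RtoC 0) by (apply Cminus_eq_contra, Cmod_pos_neq with (r/2); auto; lra).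
    replace (/ (z - w') - / (z - w) - (w' - w) * (/ (z - w) * / (z - w)))%C with
      (/ (z - w) * / (z - w) * / (z - w') * ((w' - w) * (w' - w)))%C by (field; auto).
    rewrite !Cmod_mult. apply Rmult_le_compat_r. apply Rmult_le_pos; apply Cmod_ge_0.
    assert (Cmod (/ (z - w)) <= / (r/2)) by (apply Cmod_inv_le; lra).
    repeat apply Rmult_le_compat; auto; repeat apply Rmult_le_pos; try apply Cmod_ge_0.
    apply Cmod_inv_le; lra.
Qed.

(** With [A = 1 / (z - w)] and [B = 1 / (z - w')] the remainder is [(w' - w)^2 (A^2 B^2 + 2 A^3 B)],
    which gives the constant 3 in the bound. This second derivative is what makes the derivative of
    a holomorphic function differentiable. *)
Lemma Cdiff_cauchy2 phi a b c d M w : in_rect a b c d w ->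
  (forall z, bdry a b c d z -> Ccont phi z) ->
  (forall z, bdry a b c d z -> Cmod (phi z) <= M) ->
  exists l, Cdiff (fun w => rect_integral (fun z => phi z * (/ (z - w) * / (z - w)))%C a b c d) w l.
Proof.
  intros Hw Hp HM. destruct (in_rect_dist _ _ _ _ _ Hw) as [r [Hr Hd]]. destruct Hw as [Hw1 Hw2].
  assert (Pi : 0 < / (r / 2)) by (apply Rinv_0_lt_compat; lra).
  eexists.
  apply (Cdiff_rect_integral_param phi (fun z w => / (z - w) * / (z - w))%C 
    (fun z w => RtoC 2 * (/ (z - w) * / (z - w) * / (z - w)))%C
    a b c d M w (r / 2) (3 * (/ (r/2) * / (r/2) * / (r/2) * / (r/2)))); auto; try lra.
  - assert (0 <= / (r / 2) * / (r / 2) * / (r / 2) * / (r / 2)) by (repeat apply Rmult_le_pos; lra). lra.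
  - intros w' Hw' z Hz. apply Ccont_mult; apply Ccont_inv_sub; apply Cmod_pos_neq with (r/2); try lra;
    eapply Cmod_sub_lower; eauto.
  - intros z Hz. apply Ccont_mult. apply Ccont_const.
    repeat apply Ccont_mult; apply Ccont_inv_sub; apply Cmod_pos_neq with r; auto.
  - intros w' Hw' z Hz. specialize (Hd z Hz). pose proof (Cmod_sub_lower _ _ _ _ Hd Hw') as Hd'.
    assert (N1 : (z - w)%C <> RtoC 0) by (apply Cminus_eq_contra, Cmod_pos_neq with r; auto).
    assert (N2 : (z - w')%C <> RtoC 0) by (apply Cminus_eq_contra, Cmod_pos_neq with (r/2); auto; lra).
    set (A := (/ (z - w))%C). set (B := (/ (z - w'))%C).
    replace (B * B - A * A - (w' - w) * (2 * (A * A * A)))%C with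
      ((A * A * B * B + RtoC 2 * (A * A * A * B)) * ((w' - w) * (w' - w)))%C by (unfold A, B; field; auto).
    rewrite Cmod_mult. rewrite (Cmod_mult (w' - w)). apply Rmult_le_compat_r. apply Rmult_le_pos; apply Cmod_ge_0.
    assert (Cmod A <= / (r/2)) by (apply Cmod_inv_le; lra).
    assert (Cmod B <= / (r/2)) by (apply Cmod_inv_le; lra).
    eapply Rle_trans. apply Cmod_triangle. rewrite !Cmod_mult, Cmod_R, (Rabs_pos_eq 2) by lra.
    set (k := / (r/2)) in *.
    assert (Cmod A * Cmod A * Cmod B * Cmod B <= k * k * k * k).
    { repeat apply Rmult_le_compat; auto; repeat apply Rmult_le_pos; try apply Cmod_ge_0. }
    assert (Cmod A * Cmod A * Cmod A * Cmod B <= k * k * k * k).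
    { repeat apply Rmult_le_compat; auto; repeat apply Rmult_le_pos; try apply Cmod_ge_0. }
    lra.
Qed.

Lemma CInt_Im_ge f a b m : a <= b -> ex_CInt f a b -> (forall t, a <= t <= b -> m <= Im (f t)) ->
  (b - a) * m <= Im (CInt f a b).
Proof.
  intros Hab He H. apply CInt_correct in He.
  pose proof (is_RInt_fct_extend_snd _ _ _ _ He) as H2.
  apply (is_RInt_le (fun _ => m) (fun t => snd (f t)) a b); auto.
  apply (is_RInt_const (V := R_NormedModule)).
  intros; apply H; lra.
Qed.

Lemma CInt_Re_ge f a b m : a <= b -> ex_CInt f a b -> (forall t, a <= t <= b -> m <= Re (f t)) ->
  (b - a) * m <= Re (CInt f a b).
Proof.
  intros Hab He H. apply CInt_correct in He.
  pose proof (is_RInt_fct_extend_fst _ _ _ _ He) as H2.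
  apply (is_RInt_le (fun _ => m) (fun t => fst (f t)) a b); auto.
  apply (is_RInt_const (V := R_NormedModule)).
  intros; apply H; lra.
Qed.

(* Only the positivity of the imaginary part of the winding integral is needed, not its value 2 pi i. *)
Lemma winding_neq_0 a b c d w : in_rect a b c d w -> rect_integral (fun z => / (z - w))%C a b c d <> RtoC 0.
Proof.
  intros Hw. destruct w as [u v]. pose proof Hw as [H1 H2]. simpl in H1, H2.
  destruct (ex_rect_integral (fun z => / (z - (u, v)))%C a b c d) as [F1 [F2 [F3 F4]]]; try lra.
  { intros z Hz. apply Ccont_inv_sub. eapply bdry_not_in_rect; eauto. }
  assert (E : forall x y, (x, y) <> (u, v) -> let m := (x - u) * (x - u) + (y - v) * (y - v) in
     0 < m /\ (/ ((x, y) - (u, v)))%C = ((x - u) / m, - (y - v) / m)).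
  { intros x y Hn m. assert (0 < m).
    { destruct (Req_dec x u) as [Ex|N]; [destruct (Req_dec y v) as [Ey|N]|].
      - contradict Hn. now rewrite Ex, Ey.
      - generalize (Rle_0_sqr (x - u)) (Rsqr_pos_lt (y - v)). unfold m, Rsqr. intros. 
        assert (y - v <> 0) by lra. intuition lra.
      - generalize (Rle_0_sqr (y - v)) (Rsqr_pos_lt (x - u)). unfold m, Rsqr. intros.
        assert (x - u <> 0) by lra. intuition lra. }
    split; auto. unfold Cinv; simpl.
    replace ((x + - u) * ((x + - u) * 1) + (y + - v) * ((y + - v) * 1)) with m by (unfold m; ring).
    reflexivity. }
  assert (P : 0 < Im (rect_integral (fun z => / (z - (u, v)))%C a b c d)).
  (* All four sides contribute nonnegatively; the bottom one strictly, because the squared distance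
     to [(u, v)] is at most the squared diagonal [D]. Top and left enter the contour with a minus
     sign, hence the factor [- (1)] in [K2] and [K4]. *)
  { set (D := (b - a) * (b - a) + (d - c) * (d - c)). assert (PD : 0 < D) by (unfold D; nra).
    assert (K1 : (b - a) * ((v - c) / D) <= Im (CInt (fun t => / ((t, c) - (u, v)))%C a b)).
    { apply CInt_Im_ge; auto; try lra. intros t Ht. destruct (E t c) as [Pm ->].
      intros Q; injection Q; lra. simpl. replace (- (c - v)) with (v - c) by ring.
      apply Rmult_le_compat_l. lra. apply Rinv_le_contravar; auto. unfold D; nra. }
    assert (K2 : (b - a) * 0 <= Im (CInt (fun t => - (1) * / ((t, d) - (u, v)))%C a b)).
    { apply CInt_Im_ge; auto; try lra. now apply ex_CInt_scal. intros t Ht. destruct (E t d) as [Pm ->].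
      intros Q; injection Q; lra. simpl.
      set (m := (t - u) * (t - u) + (d - v) * (d - v)) in *.
      assert (0 < (d - v) / m) by (apply Rdiv_lt_0_compat; lra). unfold Rdiv in *. lra. }
    assert (K3 : (d - c) * 0 <= Re (CInt (fun t => / ((b, t) - (u, v)))%C c d)).
    { apply CInt_Re_ge; auto; try lra. intros t Ht. destruct (E b t) as [Pm ->].
      intros Q; injection Q; lra. simpl. apply Rlt_le, Rdiv_lt_0_compat; lra. }
    assert (K4 : (d - c) * 0 <= Re (CInt (fun t => - (1) * / ((a, t) - (u, v)))%C c d)).
    { apply CInt_Re_ge; auto; try lra. now apply ex_CInt_scal. intros t Ht. destruct (E a t) as [Pm ->].
      intros Q; injection Q; lra. simpl.
      set (m := (a - u) * (a - u) + (t - v) * (t - v)) in *.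
      assert (0 < (u - a) / m) by (apply Rdiv_lt_0_compat; lra). unfold Rdiv in *. lra. }
    rewrite CInt_scal in K2, K4 by assumption.
    assert (K5 : 0 < (b - a) * ((v - c) / D)).
    { apply Rmult_lt_0_compat. lra. apply Rdiv_lt_0_compat; lra. }
    unfold rect_integral.
    destruct (CInt (fun t => / ((t, c) - (u, v)))%C a b), (CInt (fun t => / ((t, d) - (u, v)))%C a b),
     (CInt (fun t => / ((b, t) - (u, v)))%C c d), (CInt (fun t => / ((a, t) - (u, v)))%C c d).
    simpl in *. lra. }
  intros Q. rewrite Q in P. simpl in P. lra.
Qed.

(** On a small square around the point, [f] is the quotient [K / W] of the Cauchy integrals of [f]
    and of 1, with [W] nonzero. So [derC f] equals [K' / W - K W' / W^2] near the centre, and every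
    function in this expression is differentiable there. *)
Lemma holo_derC f : holo f -> holo (derC f).
Proof.
  intros Hf. apply Cdiff_holo. intros z0 Hz0. unfold UHP in Hz0.
  destruct (Cdiff_continuous f z0 _ (holo_Cdiff f z0 Hf Hz0) 1 Rlt_0_1) as [d [Hd Hb]].
  (* Half the height keeps the square inside the upper half plane; [d / 4] keeps it within distance
     [d], where [f] is bounded, since the distance is estimated by the sum of the coordinates. *)
  set (s := Rmin (Im z0 / 2) (d / 4)).
  assert (Ps : 0 < s) by (apply Rmin_glb_lt; lra).
  assert (S1 : s <= Im z0 / 2) by apply Rmin_l. assert (S2 : s <= d / 4) by apply Rmin_r.
  destruct z0 as [x0 y0]. simpl in Hz0, S1.
  set (a := x0 - s). set (b := x0 + s). set (c := y0 - s). set (e := y0 + s).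
  assert (Hr : forall z, rect a b c e z -> UHP z /\ Cmod (f z) <= Cmod (f (x0, y0)) + 1).
  { intros [x y] [K1 K2]. unfold a, b, c, e in *. simpl in *. split. unfold UHP; simpl; lra.
    assert (K3 : Cmod ((x, y) - (x0, y0)) < d).
    { eapply Rle_lt_trans. apply Cmod_le_sum. simpl.
      assert (Rabs (x + - x0) <= s) by (apply Rabs_le; lra).
      assert (Rabs (y + - y0) <= s) by (apply Rabs_le; lra). lra. }
    specialize (Hb _ K3). replace (f (x, y)) with (f (x0, y0) + (f (x, y) - f (x0, y0)))%C by ring.
    eapply Rle_trans. apply Cmod_triangle. lra. }
  assert (Hab : a <= b /\ c <= e) by (unfold a, b, c, e; lra). destruct Hab as [Hab Hce].
  assert (Hi : forall w, Cmod (w - (x0, y0)) < s -> in_rect a b c e w).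
  { intros [x y] Hw. pose proof (Rmax_Cmod ((x, y) - (x0, y0))%C) as L. simpl in L.
    pose proof (Rmax_l (Rabs (x + - x0)) (Rabs (y + - y0))) as L1.
    pose proof (Rmax_r (Rabs (x + - x0)) (Rabs (y + - y0))) as L2.
    assert (M1 : Rabs (x + - x0) < s) by lra. assert (M2 : Rabs (y + - y0) < s) by lra.
    apply Rabs_def2 in M1. apply Rabs_def2 in M2. unfold in_rect, a, b, c, e; simpl. lra. }
  assert (HD : forall z, rect a b c e z -> Cdiff f z (derC f z)).
  { intros z Hz. apply holo_Cdiff; auto. now apply Hr. }
  assert (HC : forall z, bdry a b c e z -> Ccont f z).
  { intros z Hz. eapply Cdiff_Ccont, HD, bdry_rect; auto. }
  assert (HM : forall z, bdry a b c e z -> Cmod (f z) <= Cmod (f (x0, y0)) + 1).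
  { intros z Hz. now apply Hr, bdry_rect. }
  assert (HC1 : forall z, bdry a b c e z -> Ccont (fun _ => RtoC 1) z) by (intros; apply Ccont_const).
  assert (HM1 : forall z, bdry a b c e z -> Cmod (RtoC 1) <= 1) by (intros; rewrite Cmod_1; lra).
  set (K := fun w => rect_integral (fun z => f z * / (z - w))%C a b c e).
  set (K' := fun w => rect_integral (fun z => f z * (/ (z - w) * / (z - w)))%C a b c e).
  set (W := fun w => rect_integral (fun z => RtoC 1 * / (z - w))%C a b c e).
  set (W' := fun w => rect_integral (fun z => RtoC 1 * (/ (z - w) * / (z - w)))%C a b c e).
  assert (NW : forall w, in_rect a b c e w -> W w <> RtoC 0).
  { intros w Hw. unfold W. rewrite (rect_integral_ext _ (fun z => / (z - w))%C); auto. now apply winding_neq_0.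
    intros; ring. }
  assert (E : forall w, in_rect a b c e w -> f w = (K w * / W w)%C).
  { intros w Hw. unfold K. rewrite (cauchy_formula f); auto.
    2: { intros z Hz. eexists. now apply HD. }
    rewrite (rect_integral_ext (fun z => / (z - w))%C (fun z => RtoC 1 * / (z - w))%C); auto.
    fold (W w). specialize (NW w Hw). now field.
    intros; ring. }
  assert (HK : forall w, in_rect a b c e w -> Cdiff K w (K' w)).
  { intros w Hw. exact (Cdiff_cauchy1 f a b c e _ w Hw HC HM). }
  assert (HW : forall w, in_rect a b c e w -> Cdiff W w (W' w)).
  { intros w Hw. exact (Cdiff_cauchy1 (fun _ => RtoC 1) a b c e _ w Hw HC1 HM1). }
  assert (D : forall w, in_rect a b c e w ->
     Cdiff (fun w => K w * / W w)%C w (K' w * / W w + K w * (- / (W w * W w) * W' w))%C).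
  { intros w Hw. apply (Cdiff_mult K (fun w => / W w)%C). now apply HK.
    apply (Cdiff_comp W Cinv w (W' w)). now apply HW. apply Cdiff_inv, NW, Hw. }
  assert (Hc : in_rect a b c e (x0, y0)).
  { apply Hi. replace ((x0, y0) - (x0, y0))%C with (RtoC 0) by ring. now rewrite Cmod_0. }
  destruct (Cdiff_cauchy2 f a b c e _ _ Hc HC HM) as [k Hk].
  destruct (Cdiff_cauchy2 (fun _ => RtoC 1) a b c e _ _ Hc HC1 HM1) as [m Hm].
  assert (Hk0 := HK _ Hc).
  assert (Hm0 := HW _ Hc).
  eexists.
  apply (Cdiff_ext_loc (fun w => (K' w * / W w + K w * ((- (1)) * / (W w * W w) * W' w)))%C) with (d := s); auto.
  { intros w Hw. symmetry. apply derC_Cdiff.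
    assert (Iw := Hi w Hw).
    apply (Cdiff_ext_loc (fun w => K w * / W w)%C) with (d := s - Cmod (w - (x0, y0))). lra.
    - intros y Hy. symmetry. apply E, Hi.
      replace (y - (x0, y0))%C with ((y - w) + (w - (x0, y0)))%C by ring.
      eapply Rle_lt_trans. apply Cmod_triangle. lra.
    - replace (- (1) * / (W w * W w))%C with (- / (W w * W w))%C by (field; auto). apply D; auto. }
  assert (N0 := NW _ Hc).
  eapply (Cdiff_plus (fun w => K' w * / W w)%C (fun w => K w * ((- (1)) * / (W w * W w) * W' w))%C);
    [eapply (Cdiff_mult K' (fun w => / W w)%C) |
     eapply (Cdiff_mult K (fun w => (- (1)) * / (W w * W w) * W' w)%C)].
  - exact Hk.
  - apply (Cdiff_comp W Cinv (x0, y0) (W' (x0, y0))). exact Hm0. now apply Cdiff_inv.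
  - exact Hk0.
  - eapply (Cdiff_mult (fun w => (- (1)) * / (W w * W w))%C W'); [|exact Hm].
    eapply (Cdiff_mult (fun _ => (- (1))%C) (fun w => / (W w * W w))%C). apply Cdiff_const.
    eapply (Cdiff_comp (fun w => W w * W w)%C Cinv (x0, y0)).
    apply (Cdiff_mult W W); exact Hm0. apply Cdiff_inv. now apply Cmult_neq_0.
Qed.

(** * q-series *)

Definition is_Csum (u : nat -> C) (l : C) : Prop :=
  is_series (fun n => Re (u n)) (Re l) /\ is_series (fun n => Im (u n)) (Im l).

Lemma CSeries_unique u l : is_Csum u l -> CSeries u = l.
Proof.
  intros [H1 H2]. unfold CSeries. rewrite (is_series_unique _ _ H1), (is_series_unique _ _ H2).
  now destruct l.
Qed.

Lemma is_Csum_ext u v l : (forall n, u n = v n) -> is_Csum u l -> is_Csum v l.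
Proof.
  intros E [H1 H2]. split; [apply (is_series_ext (fun n => Re (u n))) | apply (is_series_ext (fun n => Im (u n)))];
  auto; intros; now rewrite E.
Qed.

Lemma is_Csum_plus u v k l : is_Csum u k -> is_Csum v l -> is_Csum (fun n => u n + v n)%C (k + l).
Proof.
  intros [H1 H2] [H3 H4]. split.
  - exact (is_series_plus _ _ _ _ H1 H3).
  - exact (is_series_plus _ _ _ _ H2 H4).
Qed.

Lemma is_Csum_scal c u l : is_Csum u l -> is_Csum (fun n => c * u n)%C (c * l).
Proof.
  intros [H1 H2]. split.
  - exact (is_series_minus _ _ _ _ (is_series_scal (Re c) _ _ H1) (is_series_scal (Im c) _ _ H2)).
  - exact (is_series_plus _ _ _ _ (is_series_scal (Re c) _ _ H2) (is_series_scal (Im c) _ _ H1)).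
Qed.

Lemma Im_le_Cmod c : Rabs (Im c) <= Cmod c.
Proof. eapply Rle_trans; [|apply Rmax_Cmod]. apply Rmax_r. Qed.

Lemma is_Csum_dom u v : (forall n, Cmod (u n) <= v n) -> ex_series v -> is_Csum u (CSeries u).
Proof.
  intros H Hv. split; simpl; apply Series_correct.
  - apply (@ex_series_le R_AbsRing R_CompleteNormedModule _ v); auto. intros n.
    eapply Rle_trans; [|apply H]. apply re_le_Cmod.
  - apply (@ex_series_le R_AbsRing R_CompleteNormedModule _ v); auto. intros n.
    eapply Rle_trans; [|apply H]. apply Im_le_Cmod.
Qed.

Lemma Rabs_Series_le (u v : nat -> R) : (forall n, Rabs (u n) <= v n) -> ex_series v ->
  Rabs (Series u) <= Series v.
Proof.
  intros H Hv. assert (Ha : ex_series (fun n => Rabs (u n))).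
  { apply (@ex_series_le R_AbsRing R_CompleteNormedModule _ v); auto. intros n.
    change (Rabs (Rabs (u n)) <= v n). rewrite Rabs_Rabsolu. auto. }
  eapply Rle_trans. now apply Series_Rabs.
  apply Series_le; auto. intros n. split; auto. apply Rabs_pos.
Qed.

Lemma CSeries_dom_le u v : (forall n, Cmod (u n) <= v n) -> ex_series v ->
  Cmod (CSeries u) <= 2 * Series v.
Proof.
  intros H Hv. eapply Rle_trans. apply Cmod_le_sum. simpl.
  assert (Rabs (Series (fun n => Re (u n))) <= Series v).
  { apply Rabs_Series_le; auto. intros n. eapply Rle_trans; [|apply H]. apply re_le_Cmod. }
  assert (Rabs (Series (fun n => Im (u n))) <= Series v).
  { apply Rabs_Series_le; auto. intros n. eapply Rle_trans; [|apply H]. apply Im_le_Cmod. }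
  lra.
Qed.

(** * Power series on the unit disc *)

Lemma is_lim_seq_succ_ratio : is_lim_seq (fun n => (INR n + 2) / (INR n + 1)) 1.
Proof.
  apply (is_lim_seq_ext (fun n => 1 + / (INR (S n)))).
  - intros n. rewrite S_INR. field. generalize (pos_INR n); lra.
  - replace (Finite 1) with (Finite (1 + 0)) by (f_equal; ring).
    apply is_lim_seq_plus'. apply is_lim_seq_const.
    apply (is_lim_seq_incr_1 (fun n => / INR n)).
    replace (Finite 0) with (Rbar_inv p_infty) by reflexivity.
    apply is_lim_seq_inv. apply is_lim_seq_INR. discriminate.
Qed.

Lemma is_lim_seq_pow_const (u : nat -> R) l p : is_lim_seq u (Finite l) -> is_lim_seq (fun n => u n ^ p) (Finite (l ^ p)).
Proof.
  intros H. induction p; simpl. apply is_lim_seq_const.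
  now apply is_lim_seq_mult'.
Qed.

Lemma ex_series_poly_geom p rho : 0 <= rho < 1 -> ex_series (fun n => (INR n + 1) ^ p * rho ^ n).
Proof.
  intros [H0 H1]. destruct (Req_dec rho 0) as [->|Hn].
  (* d'Alembert's criterion asks for nonzero terms, so [rho = 0] is treated apart. *)
  { apply (ex_series_incr_1 (fun n => (INR n + 1) ^ p * 0 ^ n)).
    apply (ex_series_ext (fun n => 0)). intros n. rewrite pow_ne_zero by discriminate. now rewrite Rmult_0_r.
    exists 0. apply (is_series_Reals (fun n => 0)). intros eps He. exists O. intros n _.
    unfold R_dist. rewrite sum_cte. rewrite Rmult_0_l, Rminus_0_r, Rabs_R0. auto. }
  assert (P : forall n, 0 < INR n + 1) by (intros n; generalize (pos_INR n); lra).
  apply ex_series_Rabs, ex_series_DAlembert with (k := rho); auto.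
  - intros n. apply Rgt_not_eq, Rmult_lt_0_compat; apply pow_lt; auto; lra.
  - apply (is_lim_seq_ext (fun n => ((INR n + 2) / (INR n + 1)) ^ p * rho)).
    + intros n. rewrite S_INR. assert (Q := P n).
      replace (INR n + 1 + 1) with (INR n + 2) by ring.
      rewrite Rabs_pos_eq.
      unfold Rdiv at 1. rewrite Rpow_mult_distr, pow_inv. simpl. field. split; apply pow_nonzero; lra.
      apply Rlt_le, Rdiv_lt_0_compat; apply Rmult_lt_0_compat; apply pow_lt; lra.
    + replace (Finite rho) with (Finite (1 ^ p * rho)) by (rewrite pow1; f_equal; ring).
      apply is_lim_seq_mult'. apply is_lim_seq_pow_const, is_lim_seq_succ_ratio.
      apply is_lim_seq_const.
Qed.

(** Polynomial growth gives convergence on the whole unit disc and survives both the operator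
    [q d/dq] and convolution. *)
Definition polybound (a : nat -> R) : Prop :=
  exists K p, 0 <= K /\ forall n, Rabs (a n) <= K * (INR n + 1) ^ p.

Definition qser (a : nat -> R) (q : C) : C := CSeries (fun n => RtoC (a n) * q ^ n)%C.

Lemma polybound_mul_n a : polybound a -> polybound (fun n => INR n * a n).
Proof.
  intros [K [p [HK H]]]. exists K, (S p). split; auto. intros n. rewrite Rabs_mult, Rabs_pos_eq by apply pos_INR.
  simpl. specialize (H n). generalize (pos_INR n) (Rabs_pos (a n)). intros.
  assert (INR n * Rabs (a n) <= (INR n + 1) * (K * (INR n + 1) ^ p)).
  { apply Rmult_le_compat; lra. } lra.
Qed.

Lemma qser_term_bound a K p q rho n : (forall n, Rabs (a n) <= K * (INR n + 1) ^ p) ->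
  Cmod q <= rho -> Cmod (RtoC (a n) * q ^ n) <= K * ((INR n + 1) ^ p * rho ^ n).
Proof.
  intros H Hq. rewrite Cmod_mult, Cmod_R, Cmod_pow, <- Rmult_assoc.
  apply Rmult_le_compat; auto. apply Rabs_pos. apply pow_le, Cmod_ge_0.
  apply pow_incr. split; auto. apply Cmod_ge_0.
Qed.

Lemma qser_correct a q : polybound a -> Cmod q < 1 -> is_Csum (fun n => RtoC (a n) * q ^ n)%C (qser a q).
Proof.
  intros [K [p [HK H]]] Hq. apply is_Csum_dom with (v := fun n => K * ((INR n + 1) ^ p * Cmod q ^ n)).
  - intros n. apply qser_term_bound; auto. lra.
  - apply (ex_series_scal (V := R_NormedModule) K). apply ex_series_poly_geom. split; auto. apply Cmod_ge_0.
Qed.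

(** Induction: the remainder for [n + 1] is [x] times the one for [n] plus [n (x - y)^2 y^(n-1)],
    and [n^2 + n <= (n + 1)^2]. The factor [rho ^ 2] stands on the left to avoid the exponent
    [n - 2]; for [n = 0] the default [pred 0 = 0] is harmless because of the factor [INR n]. *)
Lemma pow_remainder (x y : C) rho n : 0 <= rho -> Cmod x <= rho -> Cmod y <= rho ->
  Cmod (x ^ n - y ^ n - RtoC (INR n) * (x - y) * y ^ pred n) * rho ^ 2 <=
    INR n ^ 2 * Cmod (x - y) ^ 2 * rho ^ n.
Proof.
  intros Hr Hx Hy. induction n.
  - simpl. replace (1 - 1 - 0 * (x - y) * 1)%C with (RtoC 0) by ring. rewrite Cmod_0. lra.
  - set (h := Cmod (x - y)) in *. assert (Ph : 0 <= h) by apply Cmod_ge_0.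
    assert (E : (x ^ S n - y ^ S n - RtoC (INR (S n)) * (x - y) * y ^ pred (S n))%C =
      (x * (x ^ n - y ^ n - RtoC (INR n) * (x - y) * y ^ pred n) + RtoC (INR n) * ((x - y) * (x - y)) * y ^ pred n)%C).
    { rewrite S_INR, RtoC_plus. simpl pred. destruct n.
      - simpl. ring.
      - simpl pred. rewrite !(Cpow_S _ (S n)), !(Cpow_S _ n). ring. }
    rewrite E. assert (B : Cmod (RtoC (INR n) * ((x - y) * (x - y)) * y ^ pred n) * rho ^ 2 <= INR n * h ^ 2 * rho ^ S n).
    { rewrite !Cmod_mult, Cmod_R, Cmod_pow, Rabs_pos_eq by apply pos_INR. fold h.
      destruct n. simpl. lra.
      simpl pred. replace (INR (S n) * h ^ 2 * rho ^ S (S n)) with (INR (S n) * (h * h) * rho ^ n * rho ^ 2) by (simpl; ring).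
      apply Rmult_le_compat_r. apply pow_le; auto. apply Rmult_le_compat_l.
      apply Rmult_le_pos. apply pos_INR. nra. apply pow_incr. split; auto. apply Cmod_ge_0. }
    eapply Rle_trans. apply Rmult_le_compat_r. apply pow_le; auto. apply Cmod_triangle.
    rewrite Cmod_mult. rewrite Rmult_plus_distr_r.
    eapply Rle_trans. apply Rplus_le_compat; [|exact B].
    rewrite Rmult_assoc. apply Rmult_le_compat; [apply Cmod_ge_0| |exact Hx|exact IHn].
    apply Rmult_le_pos. apply Cmod_ge_0. apply pow_le; auto.
    rewrite S_INR. simpl. generalize (pos_INR n). intros.
    assert (0 <= rho * rho ^ n * (h * h)). { apply Rmult_le_pos. apply Rmult_le_pos; auto. now apply pow_le. nra. }
    nra.
Qed.

Definition qser' (a : nat -> R) (q : C) : C := CSeries (fun n => RtoC (INR n * a n) * q ^ pred n)%C.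

Lemma qser'_correct a q : polybound a -> Cmod q < 1 ->
  is_Csum (fun n => RtoC (INR n * a n) * q ^ pred n)%C (qser' a q).
Proof.
  intros Ha Hq. destruct (polybound_mul_n a Ha) as [K [p [HK H]]].
  (* Strictly between [|q|] and 1, and positive even for [q = 0], so that the shifted exponent can
     be paid for by a factor [1 / rho]. *)
  set (rho := (Cmod q + 1) / 2).
  assert (Hr : 0 < rho < 1 /\ Cmod q <= rho) by (unfold rho; generalize (Cmod_ge_0 q); lra).
  apply is_Csum_dom with (v := fun n => (K / rho) * ((INR n + 1) ^ p * rho ^ n)).
  - intros n. rewrite Cmod_mult, Cmod_R, Cmod_pow.
    replace (K / rho * ((INR n + 1) ^ p * rho ^ n)) with (K * (INR n + 1) ^ p * (rho ^ n / rho)) by (field; lra).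
    apply Rmult_le_compat; auto. apply Rabs_pos. apply pow_le, Cmod_ge_0.
    destruct n. simpl. apply Rmult_le_reg_r with rho. lra. unfold Rdiv. rewrite Rmult_assoc, Rinv_l; lra.
    simpl. replace (rho * rho ^ n / rho) with (rho ^ n) by (field; lra). apply pow_incr. generalize (Cmod_ge_0 q); lra.
  - apply (ex_series_scal (V := R_NormedModule) (K / rho)). apply ex_series_poly_geom. lra.
Qed.

(** The remainders of [pow_remainder] sum to a multiple of [|y - q|^2]; the majorant needs two more
    powers of [n] than the coefficients and a radius [rho] between [|q|] and 1. *)
Lemma qser_Cdiff a q : polybound a -> Cmod q < 1 -> Cdiff (qser a) q (qser' a q).
Proof.
  intros Ha Hq eps He. destruct Ha as [K [p [HK H]]] eqn:EHa.
  set (rho := (Cmod q + 1) / 2).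
  assert (Hr : 0 < rho < 1 /\ Cmod q < rho) by (unfold rho; generalize (Cmod_ge_0 q); lra).
  set (T := Series (fun n => (INR n + 1) ^ (p + 2) * rho ^ n)).
  assert (HT : ex_series (fun n => (INR n + 1) ^ (p + 2) * rho ^ n)) by (apply ex_series_poly_geom; lra).
  assert (PT : 0 <= T).
  { unfold T. assert (P : forall n, Rabs ((INR n + 1) ^ (p + 2) * rho ^ n) <= (INR n + 1) ^ (p + 2) * rho ^ n).
    { intros n. rewrite Rabs_pos_eq. lra. apply Rmult_le_pos; apply pow_le; generalize (pos_INR n); lra. }
    pose proof (Rabs_Series_le _ _ P HT). generalize (Rabs_pos (Series (fun n => (INR n + 1) ^ (p + 2) * rho ^ n))). lra. }
  set (B := 2 * (K / rho ^ 2 * T) + 1).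
  assert (Pk : 0 <= K / rho ^ 2). { apply Rmult_le_pos; auto. apply Rlt_le, Rinv_0_lt_compat, pow_lt; lra. }
  assert (PB : 0 < B). { unfold B. assert (0 <= K / rho ^ 2 * T) by (apply Rmult_le_pos; auto). lra. }
  exists (Rmin (rho - Cmod q) (eps / B)). split. apply Rmin_glb_lt. lra. now apply Rdiv_lt_0_compat.
  intros y Hy. set (h := Cmod (y - q)) in *. assert (Ph : 0 <= h) by apply Cmod_ge_0.
  assert (H1 : h < rho - Cmod q) by (eapply Rlt_le_trans; [exact Hy | apply Rmin_l]).
  assert (H2 : h < eps / B) by (eapply Rlt_le_trans; [exact Hy | apply Rmin_r]).
  assert (Hyr : Cmod y <= rho).
  { replace y with (q + (y - q))%C by ring. eapply Rle_trans. apply Cmod_triangle. fold h. lra. }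
  set (r := fun n => (RtoC (a n) * (y ^ n - q ^ n - RtoC (INR n) * (y - q) * q ^ pred n))%C).
  set (v := fun n => (K / rho ^ 2 * h ^ 2) * ((INR n + 1) ^ (p + 2) * rho ^ n)).
  assert (Hv : ex_series v) by (apply (ex_series_scal (V := R_NormedModule) (K / rho ^ 2 * h ^ 2)); exact HT).
  assert (Br : forall n, Cmod (r n) <= v n).
  { intros n. unfold r, v. rewrite Cmod_mult, Cmod_R.
    pose proof (pow_remainder y q rho n) as R0. fold h in R0.
    assert (R1 : Cmod (y ^ n - q ^ n - RtoC (INR n) * (y - q) * q ^ pred n) <= INR n ^ 2 * h ^ 2 * rho ^ n / rho ^ 2).
    { assert (P2 : 0 < rho ^ 2) by (apply pow_lt; lra).
      apply Rmult_le_reg_r with (rho ^ 2); auto. unfold Rdiv. rewrite (Rmult_assoc _ (/ rho ^ 2)), Rinv_l by lra.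
      rewrite Rmult_1_r. apply R0; lra. }
    replace (K / rho ^ 2 * h ^ 2 * ((INR n + 1) ^ (p + 2) * rho ^ n)) with
      ((K * (INR n + 1) ^ p) * ((INR n + 1) ^ 2 * h ^ 2 * rho ^ n / rho ^ 2)) by (rewrite pow_add; field; lra).
    apply Rmult_le_compat; auto. apply Rabs_pos. apply Cmod_ge_0.
    eapply Rle_trans. exact R1. unfold Rdiv. apply Rmult_le_compat_r. apply Rlt_le, Rinv_0_lt_compat, pow_lt; lra.
    apply Rmult_le_compat_r. apply pow_le; lra. apply Rmult_le_compat_r. apply pow_le; lra.
    apply pow_incr. generalize (pos_INR n); lra. }
  assert (E : CSeries r = (qser a y - qser a q - qser' a q * (y - q))%C).
  { apply CSeries_unique.
    apply (is_Csum_ext (fun n => (RtoC (a n) * y ^ n + ((- (1)) * (RtoC (a n) * q ^ n)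
       + (- (y - q)) * (RtoC (INR n * a n) * q ^ pred n)))%C)).
    { intros n. unfold r. rewrite RtoC_mult. ring. }
    replace (qser a y - qser a q - qser' a q * (y - q))%C with
     (qser a y + ((- (1)) * qser a q + (- (y - q)) * qser' a q))%C by ring.
    apply is_Csum_plus. apply qser_correct; auto. lra.
    apply is_Csum_plus; apply is_Csum_scal. apply qser_correct; auto.
    apply qser'_correct; auto. }
  rewrite <- E. eapply Rle_trans. apply CSeries_dom_le with (v := v); auto.
  unfold v. rewrite Series_scal_l. fold T.
  apply Rmult_lt_compat_r with (r := B) in H2; auto. unfold Rdiv in H2. rewrite Rmult_assoc, Rinv_l in H2 by lra.
  replace (2 * (K / rho ^ 2 * h ^ 2 * T)) with ((h * (2 * (K / rho ^ 2 * T))) * h) by ring.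
  apply Rmult_le_compat_r; auto. unfold B in H2. lra.
Qed.

Lemma q_qser' a q : polybound a -> Cmod q < 1 -> (q * qser' a q)%C = qser (fun n => INR n * a n) q.
Proof.
  intros Ha Hq. symmetry. apply CSeries_unique.
  apply (is_Csum_ext (fun n => q * (RtoC (INR n * a n) * q ^ pred n))%C).
  - intros [|n]. simpl. rewrite Rmult_0_l. ring. simpl pred. rewrite Cpow_S. ring.
  - apply is_Csum_scal. now apply qser'_correct.
Qed.

Lemma is_Csum_mult (u v : nat -> C) (k l : C) : is_Csum u k -> is_Csum v l ->
  ex_series (fun n => Cmod (u n)) -> ex_series (fun n => Cmod (v n)) ->
  is_Csum (fun n => (sum_f_R0 (fun k => Re (u k) * Re (v (n - k)%nat)) n - sum_f_R0 (fun k => Im (u k) * Im (v (n - k)%nat)) n,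
                     sum_f_R0 (fun k => Re (u k) * Im (v (n - k)%nat)) n + sum_f_R0 (fun k => Im (u k) * Re (v (n - k)%nat)) n)) (k * l).
Proof.
  intros [U1 U2] [V1 V2] Hu Hv.
  assert (DR : forall w : nat -> C, ex_series (fun n => Cmod (w n)) -> ex_series (fun n => Rabs (Re (w n)))).
  { intros w Hw. apply (@ex_series_le R_AbsRing R_CompleteNormedModule _ (fun n => Cmod (w n))); auto. intros n.
    change (Rabs (Rabs (Re (w n))) <= Cmod (w n)). rewrite Rabs_Rabsolu. apply re_le_Cmod. }
  assert (DI : forall w : nat -> C, ex_series (fun n => Cmod (w n)) -> ex_series (fun n => Rabs (Im (w n)))).
  { intros w Hw. apply (@ex_series_le R_AbsRing R_CompleteNormedModule _ (fun n => Cmod (w n))); auto. intros n.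
    change (Rabs (Rabs (Im (w n))) <= Cmod (w n)). rewrite Rabs_Rabsolu. apply Im_le_Cmod. }
  split; simpl.
  - apply (is_series_minus (V := R_NormedModule)).
    + apply (is_series_mult (fun n => Re (u n)) (fun n => Re (v n))); auto.
    + apply (is_series_mult (fun n => Im (u n)) (fun n => Im (v n))); auto.
  - apply (is_series_plus (V := R_NormedModule)).
    + apply (is_series_mult (fun n => Re (u n)) (fun n => Im (v n))); auto.
    + apply (is_series_mult (fun n => Im (u n)) (fun n => Re (v n))); auto.
Qed.

Definition conv (a b : nat -> R) (n : nat) : R := sum_f_R0 (fun k => a k * b (n - k)%nat) n.

Lemma qser_mult a b q : polybound a -> polybound b -> Cmod q < 1 ->
  (qser a q * qser b q)%C = qser (conv a b) q.
Proof.
  intros Ha Hb Hq.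
  assert (A : forall a, polybound a -> ex_series (fun n => Cmod (RtoC (a n) * q ^ n))).
  { clear -Hq. intros a [K [p [HK H]]].
    apply (@ex_series_le R_AbsRing R_CompleteNormedModule _ (fun n => K * ((INR n + 1) ^ p * Cmod q ^ n))).
    - intros n. change (Rabs (Cmod (RtoC (a n) * q ^ n)) <= K * ((INR n + 1) ^ p * Cmod q ^ n)).
      rewrite Rabs_pos_eq by apply Cmod_ge_0. apply qser_term_bound; auto; lra.
    - apply (ex_series_scal (V := R_NormedModule) K). apply ex_series_poly_geom. split; auto. apply Cmod_ge_0. }
  symmetry. apply CSeries_unique.
  eapply is_Csum_ext. 2: { apply is_Csum_mult; [apply qser_correct | apply qser_correct | apply A | apply A]; auto. }
  (* Induction on the upper bound [m] with [n] fixed, because [n] also occurs in the exponents. *)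
  intros n. assert (G : forall m, (m <= n)%nat -> 
    (RtoC (sum_f_R0 (fun k => a k * b (n - k)%nat)%R m) * q ^ n)%C =
    (sum_f_R0 (fun k => Re (RtoC (a k) * q ^ k) * Re (RtoC (b (n - k)%nat) * q ^ (n - k))) m
      - sum_f_R0 (fun k => Im (RtoC (a k) * q ^ k) * Im (RtoC (b (n - k)%nat) * q ^ (n - k))) m,
     sum_f_R0 (fun k => Re (RtoC (a k) * q ^ k) * Im (RtoC (b (n - k)%nat) * q ^ (n - k))) m
      + sum_f_R0 (fun k => Im (RtoC (a k) * q ^ k) * Re (RtoC (b (n - k)%nat) * q ^ (n - k))) m)).
  { assert (T : forall k, (k <= n)%nat -> (q ^ n)%C = (q ^ k * q ^ (n - k))%C).
    { intros k Hk. rewrite <- Cpow_add_r. f_equal. lia. }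
    induction m; intros Hm.
    - cbn [sum_f_R0]. rewrite (T O) by lia. destruct (q ^ 0)%C, (q ^ (n - 0))%C.
      unfold RtoC, Cmult, Re, Im; simpl. f_equal; ring.
    - rewrite !tech5. rewrite RtoC_plus, Cmult_plus_distr_r, IHm by lia.
      rewrite (T (S m)) by lia. destruct (q ^ S m)%C, (q ^ (n - S m))%C.
      set (s1 := sum_f_R0 _ m). set (s2 := sum_f_R0 _ m). set (s3 := sum_f_R0 _ m). set (s4 := sum_f_R0 _ m).
      unfold RtoC, Cmult, Cplus, Re, Im; cbn [fst snd]. unfold s1, s2, s3, s4, RtoC, Cmult, Re, Im; cbn [fst snd]. f_equal; ring. }
  symmetry. now apply G.
Qed.

(** * The complex exponential and the variable q *)

Lemma cexp_plus a b : cexp (a + b) = (cexp a * cexp b)%C.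
Proof.
  destruct a as [a1 a2], b as [b1 b2]. unfold cexp, Cmult, Cplus, Re, Im; simpl.
  rewrite exp_plus, cos_plus, sin_plus. f_equal; ring.
Qed.

Lemma Cmod_cexp w : Cmod (cexp w) = exp (Re w).
Proof.
  unfold cexp, Cmod; simpl. rewrite !Rmult_1_r.
  replace (exp (Re w) * cos (Im w) * (exp (Re w) * cos (Im w)) + exp (Re w) * sin (Im w) * (exp (Re w) * sin (Im w)))
   with (Rsqr (exp (Re w)) * (Rsqr (sin (Im w)) + Rsqr (cos (Im w)))) by (unfold Rsqr; ring).
  rewrite sin2_cos2, Rmult_1_r. apply sqrt_Rsqr. apply Rlt_le, exp_pos.
Qed.

Lemma Cdiff_cexp_0 : Cdiff cexp 0 1.
Proof.
  assert (D1 := derivable_pt_lim_exp 0). assert (D2 := derivable_pt_lim_cos 0). assert (D3 := derivable_pt_lim_sin 0).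
  rewrite exp_0 in D1. rewrite sin_0 in D2. rewrite cos_0 in D3.
  assert (G : forall f l, derivable_pt_lim f 0 l -> forall eps, 0 < eps -> exists d, 0 < d /\ forall x, Rabs x < d ->
     Rabs (f x - f 0 - l * x) <= eps * Rabs x).
  { intros f l Hf eps He. destruct (Hf eps He) as [d Hd]. exists d. split. apply cond_pos.
    intros x Hx. destruct (Req_dec x 0) as [->|Hn].
    - replace (f 0 - f 0 - l * 0) with 0 by ring. rewrite Rabs_R0. lra.
    - specialize (Hd x Hn Hx). rewrite Rplus_0_l in Hd.
      replace (f x - f 0 - l * x) with (((f x - f 0) / x - l) * x) by (field; auto).
      rewrite Rabs_mult. apply Rmult_le_compat_r. apply Rabs_pos. lra. }
  (* The errors added below amount to at most [7 * (e * h)], so [eps / 12] leaves room; [e <= 1]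
     bounds the factor [1 + x] by 2. *)
  intros eps He. set (e := Rmin 1 (eps / 12)).
  assert (Pe : 0 < e) by (apply Rmin_glb_lt; lra).
  assert (Le : e <= 1 /\ e <= eps / 12) by (split; [apply Rmin_l | apply Rmin_r]).
  destruct (G _ _ D1 e Pe) as [d1 [Pd1 B1]]. destruct (G _ _ D2 e Pe) as [d2 [Pd2 B2]].
  destruct (G _ _ D3 e Pe) as [d3 [Pd3 B3]].
  exists (Rmin (Rmin d1 d2) (Rmin d3 e)). split. { apply Rmin_glb_lt; apply Rmin_glb_lt; assumption. }
  intros y Hy. replace (y - 0)%C with y in * by ring. 
  assert (Cmod y < d1 /\ Cmod y < d2 /\ Cmod y < d3 /\ Cmod y < e) as [K1 [K2 [K3 K4]]].
  { revert Hy. unfold Rmin at 1 2 3. repeat destruct Rle_dec; intros; repeat split; lra. }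
  destruct y as [x y]. set (h := Cmod (x, y)) in *.
  assert (Hx : Rabs x <= h) by (apply (re_le_Cmod (x, y))).
  assert (Hyy : Rabs y <= h) by (apply (Im_le_Cmod (x, y))).
  specialize (B1 x). specialize (B2 y). specialize (B3 y).
  rewrite exp_0 in B1. rewrite cos_0 in B2. rewrite sin_0 in B3.
  assert (B1' : Rabs (exp x - 1 - 1 * x) <= e * h).
  { eapply Rle_trans. apply B1; lra. apply Rmult_le_compat_l; lra. }
  assert (B2' : Rabs (cos y - 1 - -0 * y) <= e * h).
  { eapply Rle_trans. apply B2; lra. apply Rmult_le_compat_l; lra. }
  assert (B3' : Rabs (sin y - 0 - 1 * y) <= e * h).
  { eapply Rle_trans. apply B3; lra. apply Rmult_le_compat_l; lra. }
  replace (cexp (x, y) - cexp 0 - 1 * (x, y))%C with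
    ((exp x - 1 - 1 * x) * cos y + (1 + x) * (cos y - 1 - - 0 * y),
     (exp x - 1 - 1 * x) * sin y + x * (sin y - 0 - 1 * y) + (sin y - 0 - 1 * y) + x * y).
  2: { unfold cexp, Cminus, Cplus, Copp, Cmult, RtoC, Re, Im; simpl. rewrite exp_0, cos_0, sin_0. f_equal; ring. }
  assert (Ph : 0 <= h) by apply Cmod_ge_0.
  assert (C1 : Rabs (cos y) <= 1) by (apply Rabs_le; generalize (COS_bound y); lra).
  assert (C2 : Rabs (sin y) <= 1) by (apply Rabs_le; generalize (SIN_bound y); lra).
  eapply Rle_trans. apply Cmod_le_sum. simpl fst. simpl snd.
  assert (T1 : Rabs ((exp x - 1 - 1 * x) * cos y) <= e * h).
  { rewrite Rabs_mult. replace (e * h) with (e * h * 1) by ring. apply Rmult_le_compat; auto; apply Rabs_pos. }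
  assert (T2 : Rabs ((1 + x) * (cos y - 1 - - 0 * y)) <= 2 * (e * h)).
  { rewrite Rabs_mult. apply Rmult_le_compat; auto; try apply Rabs_pos.
    eapply Rle_trans. apply Rabs_triang. rewrite Rabs_R1. lra. }
  assert (T3 : Rabs ((exp x - 1 - 1 * x) * sin y) <= e * h).
  { rewrite Rabs_mult. replace (e * h) with (e * h * 1) by ring. apply Rmult_le_compat; auto; apply Rabs_pos. }
  assert (T4 : Rabs (x * (sin y - 0 - 1 * y)) <= 1 * (e * h)).
  { rewrite Rabs_mult. apply Rmult_le_compat; auto; try apply Rabs_pos. lra. }
  assert (T5 : Rabs (x * y) <= e * h).
  { rewrite Rabs_mult. apply Rmult_le_compat; auto; try apply Rabs_pos. lra. }
  eapply Rle_trans. apply Rplus_le_compat. apply Rabs_triang.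
  eapply Rle_trans. apply Rabs_triang. apply Rplus_le_compat_r.
  eapply Rle_trans. apply Rabs_triang. apply Rplus_le_compat_r. apply Rabs_triang.
  assert (e * h <= eps / 12 * h) by (apply Rmult_le_compat_r; lra). assert (0 <= eps * h) by (apply Rmult_le_pos; lra). lra.
Qed.

Lemma Cdiff_cexp w : Cdiff cexp w (cexp w).
Proof.
  assert (E : forall y, (cexp w * cexp (y - w))%C = cexp y).
  { intros y. rewrite <- cexp_plus. f_equal. ring. }
  apply (Cdiff_ext_loc (fun y => cexp w * cexp (y - w))%C _ w _ 1); [lra | auto |].
  assert (D : Cdiff (fun y => cexp w * cexp (y - w))%C w (0 * cexp (w - w) + cexp w * (1 * 1))%C).
  { apply (Cdiff_mult (fun _ => cexp w) (fun y => cexp (y - w))%C). apply Cdiff_const.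
    apply (Cdiff_comp (fun y => y - w)%C cexp w 1 1).
    - apply (Cdiff_ext_loc (fun x => - w + 1 * x)%C _ w _ 1); [lra | intros; ring | apply Cdiff_affine].
    - replace (w - w)%C with (RtoC 0) by ring. apply Cdiff_cexp_0. }
  replace (0 * cexp (w - w) + cexp w * (1 * 1))%C with (cexp w) in D by ring. exact D.
Qed.

Definition qz (z : C) : C := qpow 1 z.

Lemma qpow_pow n z : qpow n z = (qz z ^ n)%C.
Proof.
  induction n.
  - unfold qpow. simpl. rewrite Rmult_0_r. replace (RtoC 0 * (Ci * z))%C with (RtoC 0) by ring.
    unfold cexp, RtoC, Re, Im; simpl. rewrite exp_0, cos_0, sin_0. f_equal; ring.
  - rewrite Cpow_S, <- IHn. unfold qz, qpow. rewrite <- cexp_plus. f_equal.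
    rewrite S_INR. simpl INR. rewrite !RtoC_mult, RtoC_plus. ring.
Qed.

Lemma Cmod_qz z : UHP z -> Cmod (qz z) < 1.
Proof.
  intros Hz. unfold qz, qpow. rewrite Cmod_cexp. rewrite <- exp_0. apply exp_increasing.
  destruct z as [x y]. unfold UHP in Hz. simpl in *. generalize PI_RGT_0. intros. nra.
Qed.

Lemma Cdiff_qz z : Cdiff qz z (qz z * (RtoC (2 * PI) * Ci)).
Proof.
  apply (Cdiff_comp (fun z => RtoC (2 * PI * INR 1) * (Ci * z))%C cexp).
  - apply (Cdiff_ext_loc (fun x => RtoC 0 + (RtoC (2 * PI) * Ci) * x)%C _ z _ 1); [lra | | apply Cdiff_affine].
    intros. simpl INR. rewrite Rmult_1_r. ring.
  - apply Cdiff_cexp.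
Qed.

Lemma qser_qz_Cdiff a z : polybound a -> UHP z ->
  Cdiff (fun z => qser a (qz z)) z (qser (fun n => INR n * a n) (qz z) * (RtoC (2 * PI) * Ci)).
Proof.
  intros Ha Hz. rewrite <- q_qser' by (auto; now apply Cmod_qz).
  replace (qz z * qser' a (qz z) * (RtoC (2 * PI) * Ci))%C with
   (qser' a (qz z) * (qz z * (RtoC (2 * PI) * Ci)))%C by ring.
  apply (Cdiff_comp qz (qser a)). apply Cdiff_qz. apply qser_Cdiff; auto. now apply Cmod_qz.
Qed.

(** * Eisenstein series as q-series *)

(** The constant term needs its own case: [sigma r 0] evaluates to 1, which would give [c] instead
    of 1. *)
Definition eis_coef (c : R) (r n : nat) : R := match n with O => 1 | S _ => c * Defs.sigma r n end.

Lemma sigma_bound r n : Rabs (Defs.sigma r n) <= (INR n + 1) ^ (S r).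
Proof.
  assert (G : forall m, (m <= n)%nat -> Rabs (sum_f_R0 (fun d => if Nat.eqb (n mod (S d)) 0 then INR (S d) ^ r else 0) m)
    <= (INR m + 1) * (INR n + 1) ^ r).
  { assert (T : forall d, (d <= n)%nat -> Rabs (if Nat.eqb (n mod (S d)) 0 then INR (S d) ^ r else 0) <= (INR n + 1) ^ r).
    { intros d Hd. assert (0 <= INR (S d) <= INR n + 1). { rewrite S_INR. apply le_INR in Hd. generalize (pos_INR d). lra. }
      destruct (Nat.eqb _ 0).
      - rewrite Rabs_pos_eq. apply pow_incr; auto. now apply pow_le.
      - rewrite Rabs_R0. apply pow_le. generalize (pos_INR n); lra. }
    induction m; intros Hm.
    - simpl sum_f_R0. simpl INR. rewrite Rplus_0_l, Rmult_1_l. now apply (T O).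
    - rewrite tech5. eapply Rle_trans. apply Rabs_triang. rewrite (S_INR m).
      specialize (IHm (Nat.le_trans _ _ _ (Nat.le_succ_diag_r m) Hm)). specialize (T (S m) Hm). lra. }
  unfold Defs.sigma. eapply Rle_trans. apply G. lia. simpl. apply Rmult_le_compat_r.
  apply pow_le. generalize (pos_INR n); lra. assert (pred n <= n)%nat as Q by lia. apply le_INR in Q. lra.
Qed.

Lemma eis_coef_bound c r : polybound (eis_coef c r).
Proof.
  exists (Rabs c + 1), (S r). split. generalize (Rabs_pos c); lra.
  intros n. assert (1 <= (INR n + 1) ^ S r). { apply pow_R1_Rle. generalize (pos_INR n); lra. }
  destruct n.
  - simpl eis_coef. rewrite Rabs_R1. generalize (Rabs_pos c). nra.
  - unfold eis_coef. rewrite Rabs_mult. pose proof (sigma_bound r (S n)). generalize (Rabs_pos c) (Rabs_pos (Defs.sigma r (S n))). 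
    intros. assert (Rabs c * Rabs (Defs.sigma r (S n)) <= Rabs c * (INR (S n) + 1) ^ S r) by (apply Rmult_le_compat_l; auto). nra.
Qed.

Lemma Eis_qser c r z : UHP z -> Eis c r z = qser (eis_coef c r) (qz z).
Proof.
  intros Hz. pose proof (Cmod_qz z Hz) as Hq. symmetry. apply CSeries_unique.
  set (u := fun n => (RtoC (Defs.sigma r (S n)) * qpow (S n) z)%C).
  assert (Hu : is_Csum u (CSeries u)).
  (* The series in [Eis] starts at exponent 1, so [sigma_bound] gives [(n + 2)^(r + 1)]; the factor
     [2 ^ S r] comes from [n + 2 <= 2 (n + 1)]. *)
  { apply is_Csum_dom with (v := fun n => 2 ^ S r * ((INR n + 1) ^ S r * Cmod (qz z) ^ n)).
    - intros n. unfold u. rewrite qpow_pow, Cmod_mult, Cmod_R, Cmod_pow.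
      rewrite <- Rmult_assoc. apply Rmult_le_compat. apply Rabs_pos. apply pow_le, Cmod_ge_0.
      eapply Rle_trans. apply sigma_bound. rewrite <- Rpow_mult_distr. apply pow_incr. rewrite S_INR. generalize (pos_INR n); lra.
      simpl. assert (0 <= Cmod (qz z) ^ n) by apply pow_le, Cmod_ge_0. nra.
    - apply (ex_series_scal (V := R_NormedModule) (2 ^ S r)). apply ex_series_poly_geom. split; auto. apply Cmod_ge_0. }
  assert (G : is_Csum (fun n => RtoC (eis_coef c r (S n)) * qz z ^ S n)%C (RtoC c * CSeries u)).
  { apply (is_Csum_ext (fun n => RtoC c * u n)%C). intros n. unfold u, eis_coef. rewrite qpow_pow, RtoC_mult. ring.
    now apply is_Csum_scal. }
  unfold Eis. fold u. destruct G as [G1 G2].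
  split.
  - apply is_series_decr_1. match goal with |- is_series _ ?x => replace x with (Re (RtoC c * CSeries u)) end. exact G1.
    unfold plus, opp; simpl. ring.
  - apply is_series_decr_1. match goal with |- is_series _ ?x => replace x with (Im (RtoC c * CSeries u)) end. exact G2.
    unfold plus, opp; simpl. ring.
Qed.

Lemma UHP_open z : UHP z -> forall y, Cmod (y - z) < Im z -> UHP y.
Proof.
  intros Hz y Hy. unfold UHP. pose proof (Im_le_Cmod (y - z)) as L.
  assert (E : Im (y - z) = Im y - Im z) by (destruct y, z; simpl; ring). rewrite E in L.
  assert (K : Rabs (Im y - Im z) < Im z) by lra. apply Rabs_def2 in K. lra.
Qed.

Lemma Eis_Cdiff c r z : UHP z ->
  Cdiff (Eis c r) z (qser (fun n => INR n * eis_coef c r n) (qz z) * (RtoC (2 * PI) * Ci)).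
Proof.
  intros Hz. apply (Cdiff_ext_loc (fun z => qser (eis_coef c r) (qz z))) with (d := Im z); auto.
  - intros y Hy. symmetry. apply Eis_qser. eapply UHP_open; eauto.
  - apply qser_qz_Cdiff; auto. apply eis_coef_bound.
Qed.

Lemma holo_Eis c r : holo (Eis c r).
Proof. apply Cdiff_holo. intros z Hz. eexists. now apply Eis_Cdiff. Qed.

Lemma dprime_Eis c r z : UHP z -> dprime (Eis c r) z = qser (fun n => INR n * eis_coef c r n) (qz z).
Proof.
  intros Hz. unfold dprime. rewrite (derC_Cdiff _ _ _ (Eis_Cdiff c r z Hz)).
  field. split. apply Ci_nz. intros E. apply RtoC_inj in E. generalize PI_RGT_0. lra.
Qed.

Lemma qser_ext a b q : (forall n, a n = b n) -> qser a q = qser b q.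
Proof.
  intros H. unfold qser, CSeries. f_equal; apply Series_ext; intros n; now rewrite H.
Qed.

Lemma qser_linear x y a b q : polybound a -> polybound b -> Cmod q < 1 ->
  qser (fun n => x * a n + y * b n) q = (RtoC x * qser a q + RtoC y * qser b q)%C.
Proof.
  intros Ha Hb Hq. apply CSeries_unique.
  apply (is_Csum_ext (fun n => (RtoC x * (RtoC (a n) * q ^ n) + RtoC y * (RtoC (b n) * q ^ n))%C)).
  - intros n. rewrite RtoC_plus, !RtoC_mult. ring.
  - apply is_Csum_plus; apply is_Csum_scal; now apply qser_correct.
Qed.

Lemma polybound_conv a b : polybound a -> polybound b -> polybound (conv a b).
Proof.
  intros [K [p [HK Ha]]] [L [s [HL Hb]]]. exists (K * L), (S (p + s)). split. now apply Rmult_le_pos.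
  intros n. assert (G : forall m, (m <= n)%nat -> Rabs (sum_f_R0 (fun k => a k * b (n - k)%nat) m) <= (INR m + 1) * (K * L * (INR n + 1) ^ (p + s))).
  { assert (T : forall k, (k <= n)%nat -> Rabs (a k * b (n - k)%nat) <= K * L * (INR n + 1) ^ (p + s)).
    { intros k Hk. rewrite Rabs_mult.
      replace (K * L * (INR n + 1) ^ (p + s)) with ((K * (INR n + 1) ^ p) * (L * (INR n + 1) ^ s)) by (rewrite pow_add; ring).
      apply Rmult_le_compat; try apply Rabs_pos.
      - eapply Rle_trans. apply Ha. apply Rmult_le_compat_l; auto. apply pow_incr. apply le_INR in Hk. generalize (pos_INR k); lra.
      - eapply Rle_trans. apply Hb. apply Rmult_le_compat_l; auto. apply pow_incr.
        assert (n - k <= n)%nat as Q by lia. apply le_INR in Q. generalize (pos_INR (n - k)); lra. }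
    induction m; intros Hm.
    - simpl sum_f_R0. simpl INR. rewrite Rplus_0_l, Rmult_1_l. now apply T.
    - rewrite tech5. eapply Rle_trans. apply Rabs_triang. rewrite S_INR. specialize (IHm (Nat.le_trans _ _ _ (Nat.le_succ_diag_r m) Hm)).
      specialize (T (S m) Hm). lra. }
  unfold conv. eapply Rle_trans. apply G; auto. simpl. lra.
Qed.

(** * Convolution of divisor sums *)

Definition Lsum {T : Type} (f : T -> R) (l : list T) : R := fold_right Rplus 0 (map f l).

Lemma Lsum_nil {T} (f : T -> R) : Lsum f nil = 0.
Proof. reflexivity. Qed.

Lemma Lsum_cons {T} (f : T -> R) x l : Lsum f (x :: l) = f x + Lsum f l.
Proof. reflexivity. Qed.

Lemma Lsum_app {T} (f : T -> R) l m : Lsum f (l ++ m) = Lsum f l + Lsum f m.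
Proof. induction l; simpl. unfold Lsum; simpl; ring. rewrite !Lsum_cons, IHl. ring. Qed.

Lemma Lsum_perm {T} (f : T -> R) l m : Permutation l m -> Lsum f l = Lsum f m.
Proof. induction 1; auto. - rewrite !Lsum_cons; lra. - rewrite !Lsum_cons; lra. - lra. Qed.

Lemma Lsum_ext {T} (f g : T -> R) l : (forall x, In x l -> f x = g x) -> Lsum f l = Lsum g l.
Proof.
  induction l; intros H; auto. rewrite !Lsum_cons, IHl, H; auto. left; auto. intros; apply H; right; auto.
Qed.

Lemma Lsum_map {T U} (f : U -> R) (g : T -> U) l : Lsum f (map g l) = Lsum (fun x => f (g x)) l.
Proof. unfold Lsum. now rewrite map_map. Qed.

Lemma Lsum_plus {T} (f g : T -> R) l : Lsum (fun x => f x + g x) l = Lsum f l + Lsum g l.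
Proof. induction l. unfold Lsum; simpl; ring. rewrite !Lsum_cons, IHl. ring. Qed.

Lemma Lsum_scal {T} c (f : T -> R) l : Lsum (fun x => c * f x) l = c * Lsum f l.
Proof. induction l. unfold Lsum; simpl; ring. rewrite !Lsum_cons, IHl. ring. Qed.

Lemma Lsum_const {T} c (l : list T) : Lsum (fun _ => c) l = INR (length l) * c.
Proof. induction l. unfold Lsum; simpl; ring. rewrite Lsum_cons, IHl. simpl length. rewrite S_INR. ring. Qed.

Lemma Lsum_filter_if {T} (f : T -> R) p l :
  Lsum f (filter p l) = Lsum (fun x => if p x then f x else 0) l.
Proof.
  induction l; auto. simpl. rewrite Lsum_cons, <- IHl.
  destruct (p a). apply Lsum_cons. ring.
Qed.

Lemma Lsum_prod {T U} (f : T -> R) (g : U -> R) l m :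
  Lsum (fun p => f (fst p) * g (snd p)) (list_prod l m) = Lsum f l * Lsum g m.
Proof.
  induction l. unfold Lsum; simpl; ring.
  simpl. rewrite Lsum_app, Lsum_map, IHl, Lsum_cons. simpl. rewrite Lsum_scal. ring.
Qed.

Lemma Lsum_reindex {T U} (f : U -> R) (phi : T -> U) (psi : U -> T) l m : NoDup l -> NoDup m ->
  (forall x, In x l -> In (phi x) m /\ psi (phi x) = x) ->
  (forall y, In y m -> In (psi y) l /\ phi (psi y) = y) ->
  Lsum (fun x => f (phi x)) l = Lsum f m.
Proof.
  intros Nl Nm H1 H2. rewrite <- Lsum_map. apply Lsum_perm. apply NoDup_Permutation; auto.
  - clear H2. induction Nl; simpl; constructor.
    + intros K. apply in_map_iff in K. destruct K as [y [E Hy]].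
      assert (y = x). { rewrite <- (proj2 (H1 y (or_intror Hy))), E. apply H1. now left. }
      subst. contradiction.
    + apply IHNl. intros; apply H1; now right.
  - intros y. rewrite in_map_iff. split.
    + intros [x [<- Hx]]. now apply H1.
    + intros Hy. exists (psi y). split; apply H2; auto.
Qed.

Lemma Lsum_indicator {T} (eqb : T -> T -> bool) (He : forall x y, eqb x y = true <-> x = y) (ks : list T) (c : R) (k : T) :
  NoDup ks -> In k ks -> Lsum (fun j => if eqb k j then c else 0) ks = c.
Proof.
  induction 1; intros Hk; [destruct Hk|]. rewrite Lsum_cons. destruct Hk as [->|Hk].
  - rewrite (proj2 (He k k) eq_refl). rewrite (Lsum_ext _ (fun _ => 0)).
    rewrite Lsum_const; ring. intros j Hj. destruct (eqb k j) eqn:E; auto. apply He in E. subst; contradiction.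
  - destruct (eqb k x) eqn:E. apply He in E; subst; contradiction. rewrite IHNoDup; auto. ring.
Qed.

Lemma Lsum_exchange {T U} (f : T -> U -> R) l m :
  Lsum (fun x => Lsum (f x) m) l = Lsum (fun y => Lsum (fun x => f x y) l) m.
Proof.
  induction l. unfold Lsum at 1; simpl. rewrite (Lsum_ext _ (fun _ => 0)). rewrite Lsum_const; ring. auto.
  rewrite Lsum_cons, IHl, <- Lsum_plus. apply Lsum_ext. intros; now rewrite Lsum_cons.
Qed.

Lemma Lsum_fiber {T U} (eqb : U -> U -> bool) (He : forall x y, eqb x y = true <-> x = y)
  (f : T -> R) (key : T -> U) (l : list T) (ks : list U) : NoDup ks -> (forall x, In x l -> In (key x) ks) ->
  Lsum f l = Lsum (fun k => Lsum f (filter (fun x => eqb (key x) k) l)) ks.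
Proof.
  intros N H. rewrite (Lsum_ext (fun k => Lsum f (filter (fun x => eqb (key x) k) l))
    (fun k => Lsum (fun x => if eqb (key x) k then f x else 0) l)) by (intros; apply Lsum_filter_if).
  rewrite <- Lsum_exchange. apply Lsum_ext. intros x Hx. symmetry. apply (Lsum_indicator eqb He); auto.
Qed.

Lemma NoDup_list_prod {T U} (l : list T) (m : list U) : NoDup l -> NoDup m -> NoDup (list_prod l m).
Proof.
  intros Nl Nm. induction Nl; simpl. constructor.
  apply NoDup_app; auto.
  - apply FinFun.Injective_map_NoDup; auto. intros u v E. now injection E.
  - intros [u v] H1 H2. apply in_map_iff in H1. destruct H1 as [w [E _]]. injection E as -> ->.
    apply in_prod_iff in H2. tauto.
Qed.

(** * Quadruples of positive integers with a x + b y = n *)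

(** Entries are stored as [((a, b), (x, y))]. Positivity and [a x + b y = n] force all four into the
    range from 1 to [n], so the finite box loses nothing. *)
Definition quads (n : nat) : list ((nat * nat) * (nat * nat)) :=
  let l := seq 1 n in
  filter (fun p => Nat.eqb (fst (fst p) * fst (snd p) + snd (fst p) * snd (snd p)) n)
    (list_prod (list_prod l l) (list_prod l l)).

Definition divs (n : nat) : list (nat * nat) :=
  filter (fun p => Nat.eqb (fst p * snd p) n) (list_prod (seq 1 n) (seq 1 n)).

Lemma In_quads n a b x y : In ((a, b), (x, y)) (quads n) <->
  (1 <= a /\ 1 <= b /\ 1 <= x /\ 1 <= y /\ a * x + b * y = n)%nat.
Proof.
  unfold quads. rewrite filter_In, !in_prod_iff, !in_seq, Nat.eqb_eq. simpl. split.
  - lia.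
  - intros [Ha [Hb [Hx [Hy E]]]]. repeat split; nia.
Qed.

Lemma In_divs n d e : In (d, e) (divs n) <-> (1 <= d /\ 1 <= e /\ d * e = n)%nat.
Proof.
  unfold divs. rewrite filter_In, !in_prod_iff, !in_seq, Nat.eqb_eq. simpl. split.
  - lia.
  - intros [Ha [Hb E]]. repeat split; nia.
Qed.

Lemma NoDup_quads n : NoDup (quads n).
Proof. apply NoDup_filter. repeat apply NoDup_list_prod; apply seq_NoDup. Qed.

Lemma NoDup_divs n : NoDup (divs n).
Proof. apply NoDup_filter. apply NoDup_list_prod; apply seq_NoDup. Qed.

Definition qsum (n : nat) (h : R -> R -> R) : R :=
  Lsum (fun p => h (INR (fst (fst p))) (INR (snd (fst p)))) (quads n).

Definition pair_eqb (p q : nat * nat) : bool := Nat.eqb (fst p) (fst q) && Nat.eqb (snd p) (snd q).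

Lemma pair_eqb_eq p q : pair_eqb p q = true <-> p = q.
Proof.
  destruct p, q. unfold pair_eqb. rewrite Bool.andb_true_iff, !Nat.eqb_eq. simpl.
  split. intros [-> ->]; auto. intros E; injection E; auto.
Qed.

Lemma In_filter_quads n P a b x y : In ((a, b), (x, y)) (filter P (quads n)) <->
  (1 <= a /\ 1 <= b /\ 1 <= x /\ 1 <= y /\ a * x + b * y = n)%nat /\ P ((a, b), (x, y)) = true.
Proof. now rewrite filter_In, In_quads. Qed.

Lemma Lsum_trichotomy {T} (f : T -> R) (u v : T -> nat) l :
  Lsum f l = Lsum f (filter (fun p => Nat.ltb (u p) (v p)) l) + Lsum f (filter (fun p => Nat.ltb (v p) (u p)) l)
    + Lsum f (filter (fun p => Nat.eqb (u p) (v p)) l).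
Proof.
  rewrite !Lsum_filter_if, <- !Lsum_plus. apply Lsum_ext. intros x _.
  destruct (Nat.ltb_spec (u x) (v x)), (Nat.ltb_spec (v x) (u x)), (Nat.eqb_spec (u x) (v x)); try lia; ring.
Qed.

(** If [a = b = d], then [d (x + y) = n]. The codivisor [e = x + y] splits into two positive parts
    in [e - 1] ways. *)
Lemma Lsum_divs_diag_ab n (h : R -> R -> R) :
  Lsum (fun p => h (INR (fst (fst p))) (INR (snd (fst p))))
    (filter (fun p => Nat.eqb (fst (fst p)) (snd (fst p))) (quads n)) =
  Lsum (fun p => (INR (snd p) - 1) * h (INR (fst p)) (INR (fst p))) (divs n).
Proof.
  rewrite (Lsum_fiber pair_eqb pair_eqb_eq _ (fun p => (fst (fst p), fst (snd p) + snd (snd p))%nat) _ (divs n)).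
  2: apply NoDup_divs.
  2: { intros [[a b] [x y]] H. apply In_filter_quads in H. simpl in H. destruct H as [H E]. apply Nat.eqb_eq in E.
       apply In_divs. simpl. subst. lia. }
  apply Lsum_ext. intros [d e] Hde. apply In_divs in Hde. simpl fst; simpl snd.
  rewrite <- (Lsum_reindex _ (fun x => ((d, d), (x, e - x)))%nat (fun p => fst (snd p)) (seq 1 (e - 1))).
  - simpl. rewrite Lsum_const, length_seq, minus_INR by lia. simpl. ring.
  - apply seq_NoDup.
  - apply NoDup_filter, NoDup_filter, NoDup_quads.
  - intros x Hx. apply in_seq in Hx. split; auto. rewrite filter_In, In_filter_quads, pair_eqb_eq. simpl.
    rewrite Nat.eqb_refl.
    assert (d * x + d * (e - x) = n)%nat by (rewrite <- Nat.mul_add_distr_l; replace (x + (e - x))%nat with e; lia).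
    repeat split; try lia. f_equal. lia.
  - intros [[a b] [x y]]. rewrite filter_In, In_filter_quads, pair_eqb_eq. simpl. intros [[H E] K].
    apply Nat.eqb_eq in E. injection K as <- <-. subst b. split. apply in_seq; lia. repeat f_equal. lia.
Qed.

(** If [x = y = e], then [(a + b) e = n], so [d = a + b] is a divisor and [a] runs from 1 to
    [d - 1]. *)
Lemma Lsum_divs_diag_xy n (h : R -> R -> R) :
  Lsum (fun p => h (INR (fst (fst p))) (INR (snd (fst p))))
    (filter (fun p => Nat.eqb (fst (snd p)) (snd (snd p))) (quads n)) =
  Lsum (fun p => Lsum (fun a => h (INR a) (INR (fst p) - INR a)) (seq 1 (fst p - 1))) (divs n).
Proof.
  rewrite (Lsum_fiber pair_eqb pair_eqb_eq _ (fun p => (fst (fst p) + snd (fst p), fst (snd p))%nat) _ (divs n)).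
  2: apply NoDup_divs.
  2: { intros [[a b] [x y]] H. apply In_filter_quads in H. simpl in H. destruct H as [H E]. apply Nat.eqb_eq in E.
       apply In_divs. simpl. subst. lia. }
  apply Lsum_ext. intros [d e] Hde. apply In_divs in Hde. simpl fst; simpl snd.
  rewrite <- (Lsum_reindex _ (fun a => ((a, d - a), (e, e)))%nat (fun p => fst (fst p)) (seq 1 (d - 1))).
  - apply Lsum_ext. intros a Ha. apply in_seq in Ha. simpl. rewrite minus_INR by lia. reflexivity.
  - apply seq_NoDup.
  - apply NoDup_filter, NoDup_filter, NoDup_quads.
  - intros x Hx. apply in_seq in Hx. split; auto. rewrite filter_In, In_filter_quads, pair_eqb_eq. simpl.
    rewrite Nat.eqb_refl.
    assert (x * e + (d - x) * e = n)%nat by (rewrite <- Nat.mul_add_distr_r; replace (x + (d - x))%nat with d; lia).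
    repeat split; try lia. f_equal. lia.
  - intros [[a b] [x y]]. rewrite filter_In, In_filter_quads, pair_eqb_eq. simpl. intros [[H E] K].
    apply Nat.eqb_eq in E. injection K as <- <-. subst y. split. apply in_seq; lia. repeat f_equal. lia.
Qed.

(* The substitutions (a,b,x,y) -> (a,a+b,x-y,y) on {x > y} and (a,b,x,y) -> (a+b,b,x,y-x) on {x < y} preserve
   a x + b y and together biject {x <> y} onto {a <> b}. *)
Lemma qsum_invariant n (h : R -> R -> R) : (forall a b, h a (a + b) = h (a + b) b) ->
  qsum n (fun a b => h a b) - qsum n (fun a b => h a (a + b)) =
  Lsum (fun p => (INR (snd p) - 1) * h (INR (fst p)) (INR (fst p))
     - Lsum (fun a => h (INR a) (INR (fst p))) (seq 1 (fst p - 1))) (divs n).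
Proof.
  intros Hh. unfold qsum.
  rewrite (Lsum_trichotomy _ (fun p => fst (fst p)) (fun p => snd (fst p))).
  rewrite (Lsum_trichotomy (fun p => h (INR (fst (fst p))) (INR (fst (fst p)) + INR (snd (fst p))))
     (fun p => fst (snd p)) (fun p => snd (snd p))).
  rewrite Lsum_divs_diag_ab, (Lsum_divs_diag_xy n (fun a b => h a (a + b))).
  assert (E1 : Lsum (fun p => h (INR (fst (fst p))) (INR (fst (fst p)) + INR (snd (fst p))))
     (filter (fun p => Nat.ltb (snd (snd p)) (fst (snd p))) (quads n)) =
     Lsum (fun p => h (INR (fst (fst p))) (INR (snd (fst p)))) (filter (fun p => Nat.ltb (fst (fst p)) (snd (fst p))) (quads n))).
  { rewrite <- (Lsum_reindex (fun p => h (INR (fst (fst p))) (INR (snd (fst p)))) (fun p => ((fst (fst p), fst (fst p) + snd (fst p)), (fst (snd p) - snd (snd p), snd (snd p))))%nat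
      (fun p => ((fst (fst p), snd (fst p) - fst (fst p)), (fst (snd p) + snd (snd p), snd (snd p))))%nat
      (filter (fun p => Nat.ltb (snd (snd p)) (fst (snd p))) (quads n))
      (filter (fun p => Nat.ltb (fst (fst p)) (snd (fst p))) (quads n))).
    - apply Lsum_ext. intros p _. simpl. now rewrite plus_INR.
    - apply NoDup_filter, NoDup_quads.
    - apply NoDup_filter, NoDup_quads.
    - intros [[a b] [x y]]. simpl. rewrite !In_filter_quads. simpl. rewrite !Nat.ltb_lt. intros H.
      split; [repeat split; try lia; nia | repeat f_equal; lia].
    - intros [[a b] [x y]]. simpl. rewrite !In_filter_quads. simpl. rewrite !Nat.ltb_lt. intros H.
      split; [repeat split; try lia; nia | repeat f_equal; lia]. }
  (* On this half [Hh] turns [h a (a + b)] into [h (a + b) b], the value of [h] at the image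
     quadruple. *)
  assert (E2 : Lsum (fun p => h (INR (fst (fst p))) (INR (fst (fst p)) + INR (snd (fst p))))
     (filter (fun p => Nat.ltb (fst (snd p)) (snd (snd p))) (quads n)) =
     Lsum (fun p => h (INR (fst (fst p))) (INR (snd (fst p)))) (filter (fun p => Nat.ltb (snd (fst p)) (fst (fst p))) (quads n))).
  { rewrite <- (Lsum_reindex (fun p => h (INR (fst (fst p))) (INR (snd (fst p)))) (fun p => ((fst (fst p) + snd (fst p), snd (fst p)), (fst (snd p), snd (snd p) - fst (snd p))))%nat
      (fun p => ((fst (fst p) - snd (fst p), snd (fst p)), (fst (snd p), snd (snd p) + fst (snd p))))%nat
      (filter (fun p => Nat.ltb (fst (snd p)) (snd (snd p))) (quads n))
      (filter (fun p => Nat.ltb (snd (fst p)) (fst (fst p))) (quads n))).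
    - apply Lsum_ext. intros p _. simpl. now rewrite plus_INR, Hh.
    - apply NoDup_filter, NoDup_quads.
    - apply NoDup_filter, NoDup_quads.
    - intros [[a b] [x y]]. simpl. rewrite !In_filter_quads. simpl. rewrite !Nat.ltb_lt. intros H.
      split; [repeat split; try lia; nia | repeat f_equal; lia].
    - intros [[a b] [x y]]. simpl. rewrite !In_filter_quads. simpl. rewrite !Nat.ltb_lt. intros H.
      split; [repeat split; try lia; nia | repeat f_equal; lia]. }
  rewrite E1, E2.
  rewrite (Lsum_ext (fun p => (INR (snd p) - 1) * h (INR (fst p)) (INR (fst p))
     - Lsum (fun a => h (INR a) (INR (fst p))) (seq 1 (fst p - 1)))
    (fun p => (INR (snd p) - 1) * h (INR (fst p)) (INR (fst p)) + (-1) *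
       Lsum (fun a => h (INR a) (INR a + (INR (fst p) - INR a))) (seq 1 (fst p - 1)))).
  - rewrite Lsum_plus, Lsum_scal. ring.
  - intros p _. rewrite (Lsum_ext (fun a => h (INR a) (INR (fst p))) (fun a => h (INR a) (INR a + (INR (fst p) - INR a)))).
    ring. intros. f_equal. ring.
Qed.

Lemma qsum_swap n h : qsum n (fun a b => h b a) = qsum n h.
Proof.
  unfold qsum. rewrite <- (Lsum_reindex (fun p => h (INR (fst (fst p))) (INR (snd (fst p))))
    (fun p => ((snd (fst p), fst (fst p)), (snd (snd p), fst (snd p))))
    (fun p => ((snd (fst p), fst (fst p)), (snd (snd p), fst (snd p)))) (quads n)); auto using NoDup_quads.
  - intros [[a b] [x y]]. simpl. rewrite !In_quads. intros; split; auto; lia.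
  - intros [[a b] [x y]]. simpl. rewrite !In_quads. intros; split; auto; lia.
Qed.

Lemma sum_f_R0_Lsum f n : sum_f_R0 f n = Lsum f (seq 0 (S n)).
Proof.
  induction n. unfold Lsum; simpl; ring.
  rewrite tech5, IHn, (seq_S (S n)), Lsum_app, Lsum_cons. rewrite Lsum_nil. rewrite Nat.add_0_l. ring.
Qed.

Lemma sigma_divs r n : (1 <= n)%nat -> Defs.sigma r n = Lsum (fun p => INR (fst p) ^ r) (divs n).
Proof.
  intros Hn. unfold Defs.sigma. rewrite sum_f_R0_Lsum. replace (S (pred n)) with n by lia.
  rewrite <- (Lsum_map (fun d => if Nat.eqb (n mod d) 0 then INR d ^ r else 0) S), seq_shift, <- Lsum_filter_if.
  apply (Lsum_reindex (fun p => INR (fst p) ^ r) (fun d => (d, n / d)%nat) fst).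
  - apply NoDup_filter, seq_NoDup.
  - apply NoDup_divs.
  - intros d Hd. rewrite filter_In, in_seq, Nat.eqb_eq in Hd. destruct Hd as [Hd E]. split; auto.
    apply In_divs. apply Nat.Div0.div_exact in E. split. lia. split; [|lia].
    destruct (n / d)%nat; lia.
  - intros [d e] H. apply In_divs in H. simpl. destruct H as [H1 [H2 H3]]. subst n. split.
    + rewrite filter_In, in_seq, Nat.eqb_eq. split. nia. rewrite Nat.mul_comm. apply Nat.Div0.mod_mul.
    + f_equal. rewrite Nat.mul_comm. apply Nat.div_mul. lia.
Qed.

(** Quadruples are grouped by [k = a x]: then [(a, x)] factors [k] and [(b, y)] factors [n - k], and
    the sum over each group is a product. *)
Lemma qsum_conv n r s : qsum n (fun a b => a ^ r * b ^ s) =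
  Lsum (fun k => Defs.sigma r k * Defs.sigma s (n - k)) (seq 1 (n - 1)).
Proof.
  unfold qsum.
  rewrite (Lsum_fiber Nat.eqb Nat.eqb_eq _ (fun p => fst (fst p) * fst (snd p))%nat _ (seq 1 (n - 1))).
  2: apply seq_NoDup.
  2: { intros [[a b] [x y]] H. apply In_quads in H. simpl. apply in_seq. nia. }
  apply Lsum_ext. intros k Hk. apply in_seq in Hk.
  rewrite !sigma_divs by lia.
  rewrite <- (Lsum_prod (fun p => INR (fst p) ^ r) (fun p => INR (fst p) ^ s)).
  symmetry. apply (Lsum_reindex (fun p => INR (fst (fst p)) ^ r * INR (snd (fst p)) ^ s)
    (fun p => ((fst (fst p), fst (snd p)), (snd (fst p), snd (snd p))))
    (fun p => ((fst (fst p), fst (snd p)), (snd (fst p), snd (snd p))))).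
  - apply NoDup_list_prod; apply NoDup_divs.
  - apply NoDup_filter, NoDup_quads.
  - intros [[a x] [b y]]. rewrite in_prod_iff, !In_divs. intros H. split; auto.
    rewrite In_filter_quads. simpl. rewrite Nat.eqb_eq. lia.
  - intros [[a b] [x y]]. rewrite In_filter_quads. simpl. rewrite Nat.eqb_eq. intros H. split; auto.
    rewrite in_prod_iff, !In_divs. lia.
Qed.

(** * Power sums and convolutions of divisor sums *)

(** Faulhaber's formulas, written in [D = m + 1] because they are applied to sums over [a < d],
    where [m = d - 1]. *)
Lemma Lsum_powers m : let D := INR m + 1 in
  Lsum (fun _ => 1) (seq 1 m) = D - 1 /\
  Lsum (fun a => INR a ^ 1) (seq 1 m) = D^2/2 - D/2 /\
  Lsum (fun a => INR a ^ 2) (seq 1 m) = D^3/3 - D^2/2 + D/6 /\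
  Lsum (fun a => INR a ^ 3) (seq 1 m) = D^4/4 - D^3/2 + D^2/4 /\
  Lsum (fun a => INR a ^ 4) (seq 1 m) = D^5/5 - D^4/2 + D^3/3 - D/30 /\
  Lsum (fun a => INR a ^ 5) (seq 1 m) = D^6/6 - D^5/2 + 5*D^4/12 - D^2/12 /\
  Lsum (fun a => INR a ^ 6) (seq 1 m) = D^7/7 - D^6/2 + D^5/2 - D^3/6 + D/42.
Proof.
  induction m.
  - unfold Lsum; simpl. repeat split; field.
  - cbv zeta in *. rewrite seq_S, !Lsum_app, !Lsum_cons. change (1 + m)%nat with (S m).
    rewrite !Lsum_nil. rewrite S_INR.
    destruct IHm as [-> [-> [-> [-> [-> [-> ->]]]]]]. repeat split; field.
Qed.

Lemma Lsum_poly6 d (c0 c1 c2 c3 c4 c5 c6 : R) : (1 <= d)%nat -> let D := INR d in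
  Lsum (fun a => c0 * 1 + c1 * INR a ^ 1 + c2 * INR a ^ 2 + c3 * INR a ^ 3 + c4 * INR a ^ 4 + c5 * INR a ^ 5 + c6 * INR a ^ 6)
     (seq 1 (d - 1)) =
  c0 * (D - 1) + c1 * (D^2/2 - D/2) + c2 * (D^3/3 - D^2/2 + D/6) + c3 * (D^4/4 - D^3/2 + D^2/4) +
  c4 * (D^5/5 - D^4/2 + D^3/3 - D/30) + c5 * (D^6/6 - D^5/2 + 5*D^4/12 - D^2/12) +
  c6 * (D^7/7 - D^6/2 + D^5/2 - D^3/6 + D/42).
Proof.
  intros Hd. rewrite !Lsum_plus, !Lsum_scal.
  destruct (Lsum_powers (d - 1)) as [-> [-> [-> [-> [-> [-> ->]]]]]].
  rewrite minus_INR by lia. simpl INR. replace (INR d - 1 + 1) with (INR d) by ring. reflexivity.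
Qed.

Lemma qsum_linear n c f d g : qsum n (fun a b => c * f a b + d * g a b) = c * qsum n f + d * qsum n g.
Proof. unfold qsum. now rewrite Lsum_plus, !Lsum_scal. Qed.

Lemma qsum_ext n f g : (forall a b, f a b = g a b) -> qsum n f = qsum n g.
Proof. intros H. apply Lsum_ext. auto. Qed.

Definition sconv (r s n : nat) : R := Lsum (fun k => Defs.sigma r k * Defs.sigma s (n - k)) (seq 1 (n - 1)).

Lemma sconv_comm r s n : sconv r s n = sconv s r n.
Proof.
  unfold sconv. rewrite <- !qsum_conv, <- qsum_swap. apply qsum_ext. intros; ring.
Qed.

(** The form [a^2 - a b + b^2] takes the same value at [(a, a + b)] and at [(a + b, b)], so its
    square is admissible in [qsum_invariant]. In the difference only [-4 (a b^3 + a^3 b)] survives,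
    which gives the factor -8. On the divisor side [(e - 1) d^4] with [d e = n] produces
    [n sigma_3], and the [d^4] terms cancel. *)
Lemma sconv_13 n : (1 <= n)%nat ->
  -8 * sconv 1 3 n = INR n * Defs.sigma 3 n - 7/10 * Defs.sigma 5 n - 1/3 * Defs.sigma 3 n + 1/30 * Defs.sigma 1 n.
Proof.
  intros Hn. set (h := fun a b : R => (a^2 - a*b + b^2)^2).
  assert (E : qsum n (fun a b => h a b) - qsum n (fun a b => h a (a + b)) = -8 * sconv 1 3 n).
  { transitivity (1 * qsum n h + (-1) * qsum n (fun a b => h a (a + b))).
    { change (qsum n (fun a b => h a b)) with (qsum n h). ring. }
    rewrite <- qsum_linear. rewrite (qsum_ext n _ (fun a b => -4 * (a ^ 1 * b ^ 3) + -4 * (a ^ 3 * b ^ 1))).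
    2: { intros a b. unfold h. ring. }
    rewrite qsum_linear, !qsum_conv. fold (sconv 1 3 n). fold (sconv 3 1 n). rewrite (sconv_comm 3 1). ring. }
  rewrite <- E, qsum_invariant by (intros; unfold h; ring). rewrite !sigma_divs by auto.
  rewrite (Lsum_ext _ (fun p => (INR n * INR (fst p) ^ 3 + (-7/10) * INR (fst p) ^ 5) + ((-1/3) * INR (fst p) ^ 3 + 1/30 * INR (fst p) ^ 1))).
  rewrite !Lsum_plus, !Lsum_scal. field.
  intros [d e] H. apply In_divs in H. cbn [fst snd].
  (* The value [h a d] expanded in powers of [a], padded with zeros to degree six. *)
  rewrite (Lsum_ext _ (fun a => INR d ^ 4 * 1 + (-2 * INR d ^ 3) * INR a ^ 1 + (3 * INR d ^ 2) * INR a ^ 2 + (-2 * INR d) * INR a ^ 3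
    + 1 * INR a ^ 4 + 0 * INR a ^ 5 + 0 * INR a ^ 6)).
  2: { intros a _. unfold h. ring. }
  rewrite Lsum_poly6 by lia. destruct H as [H1 [H2 H3]]. rewrite <- H3, mult_INR. unfold h. field.
Qed.

(* The coefficients of the two invariants are chosen so that the terms in sigma_7 cancel. *)
Lemma sconv_15_33 n : (1 <= n)%nat ->
  12096 * sconv 1 5 n - 57600 * sconv 3 3 n =
   -1008 * (INR n * Defs.sigma 5 n) + 504 * Defs.sigma 5 n + 480 * Defs.sigma 3 n + 24 * Defs.sigma 1 n.
Proof.
  intros Hn. set (h := fun a b : R => -1008 * (a^2 - a*b + b^2)^3 + 17928 * (a * b * (a - b))^2).
  assert (E : qsum n (fun a b => h a b) - qsum n (fun a b => h a (a + b)) = 12096 * sconv 1 5 n - 57600 * sconv 3 3 n).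
  { transitivity (1 * qsum n h + (-1) * qsum n (fun a b => h a (a + b))).
    { change (qsum n (fun a b => h a b)) with (qsum n h). ring. }
    rewrite <- qsum_linear. rewrite (qsum_ext n _ (fun a b => 1 * (6048 * (a ^ 1 * b ^ 5) + 6048 * (a ^ 5 * b ^ 1)) + (-57600) * (a ^ 3 * b ^ 3))).
    2: { intros a b. unfold h. ring. }
    rewrite !qsum_linear, !qsum_conv. fold (sconv 1 5 n). fold (sconv 5 1 n). fold (sconv 3 3 n). rewrite (sconv_comm 5 1). ring. }
  rewrite <- E, qsum_invariant by (intros; unfold h; ring). rewrite !sigma_divs by auto.
  rewrite (Lsum_ext _ (fun p => ((-1008 * INR n) * INR (fst p) ^ 5 + 504 * INR (fst p) ^ 5) + (480 * INR (fst p) ^ 3 + 24 * INR (fst p) ^ 1))).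
  rewrite !Lsum_plus, !Lsum_scal. ring.
  intros [d e] H. apply In_divs in H. cbn [fst snd].
  rewrite (Lsum_ext _ (fun a => (-1008 * INR d ^ 6) * 1 + (3 * 1008 * INR d ^ 5) * INR a ^ 1
    + ((-6 * 1008 + 17928) * INR d ^ 4) * INR a ^ 2 + ((7 * 1008 - 2 * 17928) * INR d ^ 3) * INR a ^ 3
    + ((-6 * 1008 + 17928) * INR d ^ 2) * INR a ^ 4 + (3 * 1008 * INR d) * INR a ^ 5 + (-1008) * INR a ^ 6)).
  2: { intros a _. unfold h. ring. }
  rewrite Lsum_poly6 by lia. destruct H as [H1 [H2 H3]]. rewrite <- H3, mult_INR. unfold h. field.
Qed.

Lemma conv_eis c r d s n : (1 <= n)%nat -> conv (eis_coef c r) (eis_coef d s) n =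
  d * Defs.sigma s n + c * Defs.sigma r n + c * d * sconv r s n.
Proof.
  intros Hn. unfold conv. rewrite sum_f_R0_Lsum. destruct n as [|n]; [lia|].
  change (seq 0 (S (S n))) with (O :: seq 1 (S n)). rewrite Lsum_cons.
  rewrite seq_S, Lsum_app, Lsum_cons, Lsum_nil.
  change (1 + n)%nat with (S n). rewrite Nat.sub_diag, Nat.sub_0_r.
  unfold sconv. replace (S n - 1)%nat with n by lia.
  rewrite (Lsum_ext _ (fun k => (c * d) * (Defs.sigma r k * Defs.sigma s (S n - k)))).
  rewrite Lsum_scal. unfold eis_coef. ring.
  intros k Hk. apply in_seq in Hk. unfold eis_coef. destruct k; [lia|].
  destruct (S n - S k)%nat eqn:E; [lia|]. ring.
Qed.

(** * Ramanujan's identities *)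

(** For positive [n] this is 720 times [sconv_13]: the products are [3 * 240 = 720] and
    [24 * 240 = 8 * 720]. *)
Lemma ramanujan_E4_coef n : 3 * (INR n * eis_coef 240 3 n) =
  conv (eis_coef (-24) 1) (eis_coef 240 3) n - eis_coef (-504) 5 n.
Proof.
  destruct n. unfold conv, eis_coef; simpl; ring.
  rewrite conv_eis by lia. pose proof (sconv_13 (S n)) as H. unfold eis_coef.
  specialize (H ltac:(lia)). lra.
Qed.

(** For positive [n] this is [sconv_15_33] with its terms rearranged, where [12096 = 24 * 504] and
    [57600 = 240^2]. *)
Lemma ramanujan_E6_coef n : 2 * (INR n * eis_coef (-504) 5 n) =
  conv (eis_coef (-24) 1) (eis_coef (-504) 5) n - conv (eis_coef 240 3) (eis_coef 240 3) n.
Proof.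
  destruct n. unfold conv, eis_coef; simpl; ring.
  rewrite !conv_eis by lia. pose proof (sconv_15_33 (S n)) as H. unfold eis_coef.
  specialize (H ltac:(lia)). lra.
Qed.

Lemma Dk_E4 z : UHP z -> Dk 4 E4 z = (RtoC (-1/3) * E6 z)%C.
Proof.
  intros Hz. pose proof (Cmod_qz z Hz) as Hq. unfold Dk, E4, E2, E6.
  rewrite dprime_Eis, !Eis_qser by auto.
  rewrite (qser_ext (fun n => INR n * eis_coef 240 3 n)
    (fun n => 1/3 * conv (eis_coef (-24) 1) (eis_coef 240 3) n + (-1/3) * eis_coef (-504) 5 n)).
  2: { intros n. pose proof (ramanujan_E4_coef n). lra. }
  rewrite qser_linear, <- qser_mult; auto using polybound_conv, eis_coef_bound.
  replace (4 / 12) with (1/3) by field. ring.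
Qed.

Lemma Dk_E6 z : UHP z -> Dk 6 E6 z = (RtoC (-1/2) * (E4 z * E4 z))%C.
Proof.
  intros Hz. pose proof (Cmod_qz z Hz) as Hq. unfold Dk, E4, E2, E6.
  rewrite dprime_Eis, !Eis_qser by auto.
  rewrite (qser_ext (fun n => INR n * eis_coef (-504) 5 n)
    (fun n => 1/2 * conv (eis_coef (-24) 1) (eis_coef (-504) 5) n + (-1/2) * conv (eis_coef 240 3) (eis_coef 240 3) n)).
  2: { intros n. pose proof (ramanujan_E6_coef n). lra. }
  rewrite qser_linear, <- !qser_mult; auto using polybound_conv, eis_coef_bound.
  replace (6 / 12) with (1/2) by field. ring.
Qed.

(** * Noetherian modules *)

(* Elements of H seen through their components, so that equality in H becomes Leibniz equality. *)
Definition graded : Type := R -> {z : C | UHP z} -> C.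

Definition vzero : graded := fun _ _ => RtoC 0.
Definition vadd (u v : graded) : graded := fun w z => (u w z + v w z)%C.
Definition vscal (c : C) (u : graded) : graded := fun w z => (c * u w z)%C.

Ltac vring := intros; repeat (apply functional_extensionality; intro);
  unfold vzero, vadd, vscal; try ring.

Record linop (T : graded -> graded) : Prop := {
  linop_add : forall u v, T (vadd u v) = vadd (T u) (T v);
  linop_scal : forall c u, T (vscal c u) = vscal c (T u) }.

Lemma linop_zero T : linop T -> T vzero = vzero.
Proof.
  intros H. replace vzero with (vscal 0 vzero) at 1 by vring. rewrite (linop_scal _ H). vring.
Qed.

(** With [ops = nil] this is the linear span, with the multiplications by [E4] and [E6] the
    C[E4, E6]-module. Generators form a predicate, so that a whole submodule can be the generating
    set when an operator is adjoined. *)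
Inductive gen (ops : list (graded -> graded)) (G : graded -> Prop) : graded -> Prop :=
| gen_in v : G v -> gen ops G v
| gen_zero : gen ops G vzero
| gen_add u v : gen ops G u -> gen ops G v -> gen ops G (vadd u v)
| gen_scal c u : gen ops G u -> gen ops G (vscal c u)
| gen_op T u : In T ops -> gen ops G u -> gen ops G (T u).

Record submod (ops : list (graded -> graded)) (P : graded -> Prop) : Prop := {
  submod_zero : P vzero;
  submod_add : forall u v, P u -> P v -> P (vadd u v);
  submod_scal : forall c u, P u -> P (vscal c u);
  submod_op : forall T u, In T ops -> P u -> P (T u) }.

Lemma gen_submod ops G : submod ops (gen ops G).
Proof. split; intros; [apply gen_zero | apply gen_add | apply gen_scal | apply gen_op]; auto. Qed.

Lemma gen_min ops G P : submod ops P -> (forall v, G v -> P v) -> forall v, gen ops G v -> P v.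
Proof. intros [H1 H2 H3 H4] HG v Hv. induction Hv; auto. Qed.

Lemma gen_incl ops ops' G G' : incl ops ops' -> (forall v, G v -> gen ops' G' v) ->
  forall v, gen ops G v -> gen ops' G' v.
Proof.
  intros Hi HG. apply gen_min; auto.
  destruct (gen_submod ops' G') as [H1 H2 H3 H4]. split; auto.
Qed.

Definition noeth (ops : list (graded -> graded)) (W : graded -> Prop) : Prop :=
  forall P, submod ops P -> (forall v, P v -> W v) ->
    exists l, (forall v, In v l -> P v) /\ (forall v, P v -> gen ops (fun x => In x l) v).

Lemma gen_cons_span a l v : gen nil (fun x => In x (a :: l)) v ->
  exists c w, gen nil (fun x => In x l) w /\ v = vadd (vscal c a) w.
Proof.
  induction 1 as [v Hv| |u v Hu [c1 [w1 [H1 E1]]] Hv [c2 [w2 [H2 E2]]]|c u Hu [c1 [w1 [H1 E1]]]|T u [] _ _].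
  - destruct Hv as [->|Hv].
    + exists (RtoC 1), vzero. split. apply gen_zero. vring.
    + exists (RtoC 0), v. split. now apply gen_in. vring.
  - exists (RtoC 0), vzero. split. apply gen_zero. vring.
  - exists (c1 + c2)%C, (vadd w1 w2). split. now apply gen_add. subst. vring.
  - exists (c * c1)%C, (vscal c w1). split. now apply gen_scal. subst. vring.
Qed.

(** Finite-dimensional linear algebra, by induction on the spanning list. Either some element of [P]
    has a nonzero coefficient on the head [a] and serves as a pivot, or [P] lies in the span of the
    tail. *)
Lemma noeth_span l : noeth nil (gen nil (fun x => In x l)).
Proof.
  induction l as [|a l IH]; intros P HP HW.
  - exists nil. split. intros v []. intros v Hv. apply (gen_min nil (fun x => In x nil)).
    + apply gen_submod.
    + intros x [].
    + now apply HW.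
  - set (S := gen nil (fun x => In x l)) in *.
    destruct (IH (fun v => P v /\ S v)) as [l' [H1 H2]].
    { destruct HP as [Z A B _]. destruct (gen_submod nil (fun x => In x l)) as [Z' A' B' _].
      split.
      - auto.
      - intros u v [] []; split; [now apply A | now apply A'].
      - intros c u []; split; [now apply B | now apply B'].
      - intros ? ? []. }
    { tauto. }
    destruct (classic (exists c w, c <> RtoC 0 /\ S w /\ P (vadd (vscal c a) w))) as [[c [w [Hc [Hw Hp]]]]|N].
    + exists (vadd (vscal c a) w :: l'). split.
      { intros v [<-|Hv]; auto. now apply H1. }
      intros v Hv. destruct (gen_cons_span a l v (HW v Hv)) as [d [w' [Hw' E]]].
      set (q := vadd (vscal c a) w) in *.
      set (r := vadd v (vscal (- (d / c)) q)).
      assert (Er : r = vadd w' (vscal (- (d / c)) w)).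
      { unfold r, q. subst v. vring. now field. }
      replace v with (vadd r (vscal (d / c) q)) by (unfold r; vring).
      apply gen_add.
      * apply (gen_incl nil nil (fun x => In x l')). apply incl_refl.
        { intros x Hx. apply gen_in. now right. }
        apply H2. split.
        { unfold r. apply (submod_add _ _ HP); auto. now apply (submod_scal _ _ HP). }
        rewrite Er. apply gen_add; auto. now apply gen_scal.
      * apply gen_scal, gen_in. now left.
    + exists l'. split. intros v Hv. now apply H1.
      intros v Hv. apply H2. split; auto.
      destruct (gen_cons_span a l v (HW v Hv)) as [d [w' [Hw' E]]].
      destruct (Ceq_dec d (RtoC 0)) as [->|Hd].
      * replace v with w'; auto. subst v. vring.
      * exfalso. apply N. exists d, w'. subst v. auto.
Qed.

Fixpoint opow (x : graded -> graded) (n : nat) (v : graded) : graded :=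
  match n with O => v | S n => x (opow x n v) end.

Lemma opow_linop x n : linop x -> linop (opow x n).
Proof.
  intros Hx. induction n; split; intros; simpl; auto.
  - now rewrite (linop_add _ IHn), (linop_add _ Hx).
  - now rewrite (linop_scal _ IHn), (linop_scal _ Hx).
Qed.

Lemma opow_comm x T n : (forall v, T (x v) = x (T v)) -> forall v, T (opow x n v) = opow x n (T v).
Proof. intros H. induction n; intros v; simpl; auto. now rewrite H, IHn. Qed.

Lemma opow_add x m n v : opow x (m + n) v = opow x m (opow x n v).
Proof. induction m; simpl; auto. now rewrite IHm. Qed.

(* Sums of x^i w_i with w_i in W and i < d. *)
Fixpoint low (W : graded -> Prop) (x : graded -> graded) (d : nat) (v : graded) : Prop :=
  match d with
  | O => v = vzero
  | S d => exists u w, low W x d u /\ W w /\ v = vadd u (opow x d w)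
  end.

Lemma low_submod ops W x d : submod ops W -> linop x -> (forall T, In T ops -> linop T) ->
  (forall T, In T ops -> forall v, T (x v) = x (T v)) -> submod ops (low W x d).
Proof.
  intros HW Hx HT HC. pose proof (fun n => opow_linop x n Hx) as HP.
  induction d as [|d [Z A B D]]; split; simpl.
  - reflexivity.
  - intros u v -> ->. vring.
  - intros c u ->. vring.
  - intros T u Hin ->. apply linop_zero; auto.
  - exists vzero, vzero. split; auto. split. apply (submod_zero _ _ HW).
    rewrite linop_zero by auto. vring.
  - intros u v [u1 [w1 [H1 [H2 ->]]]] [u2 [w2 [H3 [H4 ->]]]].
    exists (vadd u1 u2), (vadd w1 w2). split; auto. split. now apply (submod_add _ _ HW).
    rewrite (linop_add _ (HP d)). vring.
  - intros c u [u1 [w1 [H1 [H2 ->]]]].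
    exists (vscal c u1), (vscal c w1). split; auto. split. now apply (submod_scal _ _ HW).
    rewrite (linop_scal _ (HP d)). vring.
  - intros T u Hin [u1 [w1 [H1 [H2 ->]]]].
    exists (T u1), (T w1). split; auto. split. now apply (submod_op _ _ HW).
    rewrite (linop_add _ (HT T Hin)). f_equal. apply opow_comm. now apply HC.
Qed.

Lemma low_succ W x d v : W vzero -> linop x -> low W x d v -> low W x (S d) v.
Proof.
  intros H0 Hx H. exists v, vzero. split; auto. split; auto.
  rewrite linop_zero by now apply opow_linop. vring.
Qed.

Lemma low_mono W x d e v : W vzero -> linop x -> (d <= e)%nat -> low W x d v -> low W x e v.
Proof. intros H0 Hx Hde H. induction Hde; auto. now apply low_succ. Qed.

Lemma low_x W x d v : W vzero -> linop x -> low W x d v -> low W x (S d) (x v).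
Proof.
  intros H0 Hx. revert v. induction d; intros v H.
  - simpl in H. subst v. rewrite linop_zero by auto. apply low_succ; auto. reflexivity.
  - destruct H as [u [w [H1 [H2 ->]]]]. exists (x u), w. split. now apply IHd. split; auto.
    now rewrite (linop_add _ Hx).
Qed.

Lemma low_opow W x d n v : W vzero -> linop x -> low W x d v -> low W x (n + d) (opow x n v).
Proof. intros H0 Hx H. induction n; auto. exact (low_x W x (n + d) (opow x n v) H0 Hx IHn). Qed.

(** Finitely many elements of the union of an increasing chain lie in one member of it; this turns
    finite generation of the union into stabilisation. *)
Lemma bounded_witness {T : Type} (Q : nat -> T -> Prop) (l : list T) :
  (forall d v, Q d v -> Q (S d) v) -> (forall v, In v l -> exists d, Q d v) ->
  exists D, forall v, In v l -> Q D v.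
Proof.
  intros HS. assert (M : forall d e v, (d <= e)%nat -> Q d v -> Q e v).
  { intros d e v H. induction H; auto. }
  induction l as [|a l IH]; intros H.
  - exists O. intros v [].
  - destruct IH as [D HD]. { intros; apply H; now right. }
    destruct (H a) as [d Hd]. { now left. }
    exists (max d D). intros v [<-|Hv]. apply M with d; auto; lia. apply M with D; auto; lia.
Qed.

Lemma list_choice {T U : Type} (Q : T -> U -> Prop) (l : list T) :
  (forall v, In v l -> exists p, Q v p) -> exists l', (forall p, In p l' -> exists v, Q v p) /\ (forall v, In v l -> exists p, In p l' /\ Q v p).
Proof.
  induction l as [|a l IH]; intros H.
  - exists nil. split. intros p []. intros v [].
  - destruct IH as [l' [H1 H2]]. { intros; apply H; now right. }
    destruct (H a) as [p Hp]. { now left. }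
    exists (p :: l'). split.
    + intros r [<-|Hr]; eauto.
    + intros v [<-|Hv]. exists p. split; auto. now left.
      destruct (H2 v Hv) as [r [Hr Q2]]. exists r. split; auto. now right.
Qed.

(* Hilbert's basis theorem, by way of the modules of leading coefficients in each degree. *)
Lemma noeth_adjoin ops x W : submod ops W -> linop x -> (forall T, In T ops -> linop T) ->
  (forall T, In T ops -> forall v, T (x v) = x (T v)) ->
  noeth ops W -> noeth (x :: ops) (gen (x :: ops) W).
Proof.
  intros HW Hx HT HC HN P HP HPW.
  pose proof (submod_zero _ _ HW) as W0.
  pose proof (fun d => low_submod ops W x d HW Hx HT HC) as HL.
  assert (Hall : forall v, gen (x :: ops) W v -> exists d, low W x d v).
  { apply gen_min.
    - split.
      + exists O. reflexivity.
      + intros u v [d Hd] [e He]. exists (max d e). apply (submod_add _ _ (HL _)).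
        apply low_mono with d; auto; lia. apply low_mono with e; auto; lia.
      + intros c u [d Hd]. exists d. now apply (submod_scal _ _ (HL _)).
      + intros T u [<-|Hin] [d Hd].
        * exists (S d). now apply low_x.
        * exists d. now apply (submod_op _ _ (HL _)).
    - intros v Hv. exists 1%nat, vzero, v. split. reflexivity. split; auto. simpl. vring. }
  (* Expansions in powers of [x] need not be unique, so a degree is only the upper bound carried by
     [low], and [w] is a leading coefficient relative to a chosen expansion. *)
  set (L := fun d w => W w /\ exists u, low W x d u /\ P (vadd u (opow x d w))).
  assert (LS : forall d, submod ops (L d)).
  { intros d. pose proof (opow_linop x d Hx) as Ho. split; unfold L.
    - split; auto. exists vzero. split. apply (submod_zero _ _ (HL d)).
      rewrite linop_zero by auto. replace (vadd vzero vzero) with vzero by vring. apply (submod_zero _ _ HP).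
    - intros u v [U1 [u1 [U2 U3]]] [V1 [v1 [V2 V3]]]. split. now apply (submod_add _ _ HW).
      exists (vadd u1 v1). split. now apply (submod_add _ _ (HL d)).
      rewrite (linop_add _ Ho).
      replace (vadd (vadd u1 v1) (vadd (opow x d u) (opow x d v))) with
       (vadd (vadd u1 (opow x d u)) (vadd v1 (opow x d v))) by vring. now apply (submod_add _ _ HP).
    - intros c u [U1 [u1 [U2 U3]]]. split. now apply (submod_scal _ _ HW).
      exists (vscal c u1). split. now apply (submod_scal _ _ (HL d)).
      rewrite (linop_scal _ Ho).
      replace (vadd (vscal c u1) (vscal c (opow x d u))) with (vscal c (vadd u1 (opow x d u))) by vring.
      now apply (submod_scal _ _ HP).
    - intros T u Hin [U1 [u1 [U2 U3]]]. split. now apply (submod_op _ _ HW).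
      exists (T u1). split. now apply (submod_op _ _ (HL d)).
      rewrite <- opow_comm by now apply HC. rewrite <- (linop_add _ (HT T Hin)).
      apply (submod_op _ _ HP); auto. now right. }
  assert (LU : forall d w, L d w -> L (S d) w).
  { intros d w [W1 [u [U1 U2]]]. split; auto. exists (x u). split. now apply low_x.
    simpl. rewrite <- (linop_add _ Hx). apply (submod_op _ _ HP); auto. now left. }
  assert (LM : forall d e w, (d <= e)%nat -> L d w -> L e w).
  { intros d e w H. induction H; auto. }
  (* The [L d] increase, because applying [x] raises the degree and keeps the leading coefficient.
     Their union is finitely generated, hence equal to some [L D]. *)
  destruct (HN (fun w => exists d, L d w)) as [linf [I1 I2]].
  { split.
    - exists O. apply (submod_zero _ _ (LS O)).
    - intros u v [d Hd] [e He]. exists (max d e). apply (submod_add _ _ (LS _)).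
      apply LM with d; auto; lia. apply LM with e; auto; lia.
    - intros c u [d Hd]. exists d. now apply (submod_scal _ _ (LS _)).
    - intros T u Hin [d Hd]. exists d. now apply (submod_op _ _ (LS _)). }
  { intros v [d [Hd _]]. exact Hd. }
  destruct (bounded_witness L linf LU I1) as [D HD].
  assert (Linf : forall d w, L d w -> L D w).
  { intros d w Hw. apply (gen_min ops (fun x => In x linf)); auto. apply I2. eauto. }
  (* Generators of [L d] are lifted to elements of [P]. Since [ops] commute with [x], whatever
     produces [w] from the generators of [L d] produces from their lifts an element with leading
     coefficient [w]. *)
  assert (lift : forall d, exists B, (forall p, In p B -> P p) /\ forall w, L d w ->
     exists g u, gen (x :: ops) (fun x => In x B) g /\ low W x d u /\ g = vadd u (opow x d w)).
  { intros d. pose proof (opow_linop x d Hx) as Ho. destruct (HN (L d) (LS d)) as [l [K1 K2]].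
    { intros v [Hv _]. exact Hv. }
    destruct (list_choice (fun w p => P p /\ exists u, low W x d u /\ p = vadd u (opow x d w)) l) as [B [B1 B2]].
    { intros v Hv. destruct (K1 v Hv) as [_ [u [U1 U2]]]. exists (vadd u (opow x d v)). eauto. }
    exists B. split. { intros p Hp. now destruct (B1 p Hp) as [v [Hv _]]. }
    intros w Hw. apply K2 in Hw. revert w Hw. apply gen_min.
    - split.
      + exists vzero, vzero. split. apply gen_zero. split. apply (submod_zero _ _ (HL d)).
        rewrite linop_zero by auto. vring.
      + intros u v [g1 [u1 [G1 [U1 E1]]]] [g2 [u2 [G2 [U2 E2]]]].
        exists (vadd g1 g2), (vadd u1 u2). split. now apply gen_add. split. now apply (submod_add _ _ (HL d)).
        subst. rewrite (linop_add _ Ho). vring.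
      + intros c u [g1 [u1 [G1 [U1 E1]]]]. exists (vscal c g1), (vscal c u1). split. now apply gen_scal.
        split. now apply (submod_scal _ _ (HL d)). subst. rewrite (linop_scal _ Ho). vring.
      + intros T u Hin [g1 [u1 [G1 [U1 E1]]]]. exists (T g1), (T u1). split. apply gen_op; auto. now right.
        split. now apply (submod_op _ _ (HL d)). subst. rewrite (linop_add _ (HT T Hin)). f_equal.
        apply opow_comm. now apply HC.
    - intros v Hv. destruct (B2 v Hv) as [p [Hp [_ [u [U1 U2]]]]]. exists p, u. split; auto. now apply gen_in. }
  assert (big : forall n, exists B, (forall p, In p B -> P p) /\ forall d, (d < n)%nat -> forall w, L d w ->
     exists g u, gen (x :: ops) (fun x => In x B) g /\ low W x d u /\ g = vadd u (opow x d w)).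
  { induction n as [|n [B [B1 B2]]].
    - exists nil. split. intros p []. intros d Hd. lia.
    - destruct (lift n) as [B' [B1' B2']]. exists (B ++ B'). split.
      + intros p Hp. apply in_app_or in Hp. destruct Hp; auto.
      + intros d Hd w Hw. assert (d < n \/ d = n)%nat as [Hd'| ->] by lia.
        * destruct (B2 d Hd' w Hw) as [g [u [G1 G2]]]. exists g, u. split; auto.
          revert G1. apply gen_incl. apply incl_refl. intros v Hv. apply gen_in, in_or_app. now left.
        * destruct (B2' w Hw) as [g [u [G1 G2]]]. exists g, u. split; auto.
          revert G1. apply gen_incl. apply incl_refl. intros v Hv. apply gen_in, in_or_app. now right. }
  destruct (big (S D)) as [B [B1 B2]].
  exists B. split; auto.
  (* Above degree [D] the lifts for [L D] suffice, multiplied by [x^(d - D)]. *)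
  assert (lift' : forall d w, L d w -> exists g u, gen (x :: ops) (fun x => In x B) g /\ low W x d u /\ g = vadd u (opow x d w)).
  { intros d w Hw. destruct (Nat.le_gt_cases d D) as [Hd|Hd].
    - apply B2; auto. lia.
    - destruct (B2 D (Nat.lt_succ_diag_r D) w (Linf d w Hw)) as [g [u [G1 [G2 G3]]]].
      pose proof (opow_linop x (d - D) Hx) as Ho.
      exists (opow x (d - D) g), (opow x (d - D) u). split; [|split].
      + clear -G1. induction (d - D)%nat; auto. simpl. apply gen_op; auto. now left.
      + replace d with ((d - D) + D)%nat at 1 by lia. now apply low_opow.
      + subst g. rewrite (linop_add _ Ho). f_equal. rewrite <- opow_add. f_equal. lia. }
  assert (GP : forall g, gen (x :: ops) (fun x => In x B) g -> P g) by (apply gen_min; auto).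
  intros v Hv. destruct (Hall v (HPW v Hv)) as [d Hd]. revert v Hv Hd.
  induction d as [|d IH]; intros v Hv Hd.
  - simpl in Hd. subst v. apply gen_zero.
  - destruct Hd as [u [w [U1 [U2 E]]]].
    destruct (lift' d w) as [g [u' [G1 [G2 G3]]]].
    { split; auto. exists u. split; auto. now rewrite <- E. }
    (* Subtracting [g] removes the top term of [v], so the difference has a smaller degree bound. *)
    replace v with (vadd (vadd v (vscal (- (1)) g)) g) by vring.
    apply gen_add; auto. apply IH.
    + apply (submod_add _ _ HP); auto. apply (submod_scal _ _ HP); auto.
    + replace (vadd v (vscal (- (1)) g)) with (vadd u (vscal (- (1)) u')) by (subst; vring).
      apply (submod_add _ _ (HL d)); auto. now apply (submod_scal _ _ (HL d)).
Qed.

Lemma noeth_mono ops W W' : (forall v, W' v -> W v) -> noeth ops W -> noeth ops W'.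
Proof. intros H HN P HP HW. apply HN; auto. Qed.

Lemma noeth_two x y l : linop x -> linop y -> (forall v, x (y v) = y (x v)) ->
  noeth (x :: y :: nil) (gen (x :: y :: nil) (fun v => In v l)).
Proof.
  intros Hx Hy HC.
  apply noeth_mono with (gen (x :: y :: nil) (gen (y :: nil) (gen nil (fun v => In v l)))).
  - apply gen_incl. apply incl_refl. intros v Hv. now apply gen_in, gen_in, gen_in.
  - apply noeth_adjoin; auto. apply gen_submod.
    intros T [<-|[]]; auto. intros T [<-|[]]; auto.
    apply noeth_adjoin; auto. apply gen_submod. intros T []. intros T [].
    apply noeth_span.
Qed.

(** The ascending chain condition: the submodule generated by the whole sequence has finitely many
    generators, all of which already lie in the part generated by the first [n] terms, so [v n] lies
    there too. *)
Lemma noeth_sequence ops W (v : nat -> graded) : noeth ops W -> submod ops W -> (forall n, W (v n)) ->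
  exists n, gen ops (fun u => exists i, (i < n)%nat /\ u = v i) (v n).
Proof.
  intros HN HW Hv.
  destruct (HN (gen ops (fun u => exists i, u = v i))) as [l [H1 H2]].
  { apply gen_submod. }
  { apply gen_min; auto. intros u [i ->]. apply Hv. }
  set (Q := fun n => gen ops (fun u => exists i, (i < n)%nat /\ u = v i)).
  assert (QS : forall d u, Q d u -> Q (S d) u).
  { intros d u. apply gen_incl. apply incl_refl. intros w [i [Hi ->]]. apply gen_in. exists i. split; auto. }
  assert (QM : forall d e u, (d <= e)%nat -> Q d u -> Q e u).
  { intros d e u H. induction H; auto. }
  destruct (bounded_witness Q l QS) as [n Hn].
  { intros u Hu. specialize (H1 u Hu). clear Hu. revert u H1. apply gen_min.
    - split.
      + exists O. apply gen_zero.
      + intros a b [d Hd] [e He]. exists (max d e). apply gen_add. apply QM with d; auto; lia. apply QM with e; auto; lia.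
      + intros c a [d Hd]. exists d. now apply gen_scal.
      + intros T a Hin [d Hd]. exists d. now apply gen_op.
    - intros w [i ->]. exists (S i). apply gen_in. exists i. split; auto. }
  exists n. fold (Q n). apply (gen_incl ops ops (fun x => In x l)). apply incl_refl.
  exact Hn. apply H2. apply gen_in. eauto.
Qed.

(** * Solutions of monic modular differential equations *)

Lemma Dk_Cdiff k f z l : Cdiff f z l ->
  Dk k f z = (l / (RtoC (2 * PI) * Ci) - RtoC (k / 12) * (E2 z * f z))%C.
Proof. intros H. unfold Dk, dprime. now rewrite (derC_Cdiff _ _ _ H). Qed.

Lemma Dk_ext k f g z : holo f -> (forall y, UHP y -> f y = g y) -> UHP z -> Dk k f z = Dk k g z.
Proof.
  intros Hf E Hz. pose proof (holo_Cdiff f z Hf Hz) as D.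
  rewrite (Dk_Cdiff k f z _ D), (Dk_Cdiff k g z (derC f z)), E; auto.
  apply (Cdiff_ext_loc f) with (d := Im z); auto.
  intros y Hy. apply E. eapply UHP_open; eauto.
Qed.

Lemma holo_ext f g : (forall y, UHP y -> f y = g y) -> holo f -> holo g.
Proof.
  intros E Hf. apply Cdiff_holo. intros z Hz. exists (derC f z).
  apply (Cdiff_ext_loc f) with (d := Im z); auto.
  intros y Hy. apply E. eapply UHP_open; eauto. now apply holo_Cdiff.
Qed.

Lemma holo_const c : holo (fun _ => c).
Proof. apply Cdiff_holo. intros z _. eexists. apply Cdiff_const. Qed.

Lemma holo_plus f g : holo f -> holo g -> holo (fun z => f z + g z)%C.
Proof. intros Hf Hg. apply Cdiff_holo. intros z Hz. eexists. apply Cdiff_plus; apply holo_Cdiff; auto. Qed.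

Lemma holo_mult f g : holo f -> holo g -> holo (fun z => f z * g z)%C.
Proof. intros Hf Hg. apply Cdiff_holo. intros z Hz. eexists. apply Cdiff_mult; apply holo_Cdiff; auto. Qed.

Lemma holo_Dk k f : holo f -> holo (Dk k f).
Proof.
  intros Hf. apply (holo_ext (fun z => / (RtoC (2 * PI) * Ci) * derC f z + (- RtoC (k / 12)) * (E2 z * f z))%C).
  - intros z _. unfold Dk, dprime, Cdiv. ring.
  - apply holo_plus. apply (holo_mult (fun _ => / (RtoC (2 * PI) * Ci))%C). apply holo_const. now apply holo_derC.
    apply (holo_mult (fun _ => - RtoC (k / 12))%C). apply holo_const. apply holo_mult; auto. apply holo_Eis.
Qed.

Lemma Dk_const k c z : Dk k (fun _ => c) z = (- RtoC (k / 12) * (E2 z * c))%C.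
Proof.
  rewrite (Dk_Cdiff _ _ _ _ (Cdiff_const c z)). unfold Cdiv. ring.
Qed.

Lemma Dk_plus k f g z : holo f -> holo g -> UHP z -> Dk k (fun z => f z + g z)%C z = (Dk k f z + Dk k g z)%C.
Proof.
  intros Hf Hg Hz. pose proof (holo_Cdiff f z Hf Hz) as D. pose proof (holo_Cdiff g z Hg Hz) as D'.
  rewrite (Dk_Cdiff k _ _ _ (Cdiff_plus _ _ _ _ _ D D')), (Dk_Cdiff k _ _ _ D), (Dk_Cdiff k _ _ _ D').
  unfold Cdiv. ring.
Qed.

Lemma Dk_mult k l f g z : holo f -> holo g -> UHP z ->
  Dk (k + l) (fun z => f z * g z)%C z = (Dk k f z * g z + f z * Dk l g z)%C.
Proof.
  intros Hf Hg Hz. pose proof (holo_Cdiff f z Hf Hz) as D. pose proof (holo_Cdiff g z Hg Hz) as D'.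
  rewrite (Dk_Cdiff _ _ _ _ (Cdiff_mult _ _ _ _ _ D D')), (Dk_Cdiff k _ _ _ D), (Dk_Cdiff l _ _ _ D').
  replace ((k + l) / 12) with (k / 12 + l / 12) by field. rewrite RtoC_plus. unfold Cdiv. ring.
Qed.

Lemma Dk_scal k c f z : holo f -> UHP z -> Dk k (fun z => c * f z)%C z = (c * Dk k f z)%C.
Proof.
  intros Hf Hz. replace k with (0 + k) at 1 by ring.
  rewrite (Dk_mult 0 k (fun _ => c)) by (auto using holo_const).
  rewrite Dk_const. replace (0 / 12) with 0 by field. ring.
Qed.

(** * Holomorphic elements of H and their components *)

Lemma Hel_nil : Hel nil.
Proof. intros p []. Qed.

Lemma Hel_cons p h : holo (snd p) -> Hel h -> Hel (p :: h).
Proof. intros H1 H2 q [<-|Hq]; auto. Qed.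

Lemma Hel_inv p h : Hel (p :: h) -> holo (snd p) /\ Hel h.
Proof. intros H. split. apply H. now left. intros q Hq. apply H. now right. Qed.

Lemma Hel_hom k f : holo f -> Hel (hom k f).
Proof. intros H. apply Hel_cons; auto. apply Hel_nil. Qed.

Lemma Hel_app h1 h2 : Hel h1 -> Hel h2 -> Hel (h1 ++ h2).
Proof. intros H1 H2 p Hp. apply in_app_or in Hp. destruct Hp; auto. Qed.

Lemma Hel_scale c h : Hel h -> Hel (Hscale c h).
Proof.
  intros H p Hp. apply in_map_iff in Hp. destruct Hp as [q [<- Hq]]. simpl.
  apply (holo_mult (fun _ => c)). apply holo_const. auto.
Qed.

Lemma Hel_delta h : Hel h -> Hel (delta h).
Proof.
  intros H p Hp. apply in_map_iff in Hp. destruct Hp as [q [<- Hq]]. apply holo_Dk. auto.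
Qed.

Lemma Hel_e4 h : Hel h -> Hel (e4 h).
Proof.
  intros H p Hp. apply in_map_iff in Hp. destruct Hp as [q [<- Hq]]. simpl.
  apply holo_mult; auto. apply holo_Eis.
Qed.

Lemma Hel_e6 h : Hel h -> Hel (e6 h).
Proof.
  intros H p Hp. apply in_map_iff in Hp. destruct Hp as [q [<- Hq]]. simpl.
  apply holo_mult; auto. apply holo_Eis.
Qed.

Lemma Hel_mul h1 h2 : Hel h1 -> Hel h2 -> Hel (Hmul h1 h2).
Proof.
  intros H1 H2 p Hp. apply in_flat_map in Hp. destruct Hp as [q [Hq Hp]].
  apply in_map_iff in Hp. destruct Hp as [r [<- Hr]]. simpl. apply holo_mult; auto.
Qed.

Lemma Hel_Ralg a : Ralg a -> forall h, Hel h -> Hel (a h).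
Proof.
  induction 1; intros h Hh; auto using Hel_scale, Hel_delta, Hel_e4, Hel_e6.
  - apply Hel_app; auto.
  - unfold Opcomp; auto.
Qed.

Definition repr (h : H) : graded := fun w z => Defs.comp h w (proj1_sig z).

Lemma repr_ext h1 h2 : (forall w z, UHP z -> Defs.comp h1 w z = Defs.comp h2 w z) -> repr h1 = repr h2.
Proof. intros E. extensionality w. extensionality z. apply E. apply (proj2_sig z). Qed.

Lemma repr_Heq h1 h2 : repr h1 = repr h2 <-> Heq h1 h2.
Proof.
  split.
  - intros E w z Hz. exact (f_equal (fun u : graded => u w (exist _ z Hz)) E).
  - apply repr_ext.
Qed.

Lemma comp_cons p h w z : Defs.comp (p :: h) w z = (Defs.comp (p :: nil) w z + Defs.comp h w z)%C.
Proof. simpl. destruct (Req_EM_T (fst p) w); ring. Qed.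

Lemma comp_app h1 h2 w z : Defs.comp (h1 ++ h2) w z = (Defs.comp h1 w z + Defs.comp h2 w z)%C.
Proof.
  induction h1. simpl; ring. simpl app. rewrite comp_cons, (comp_cons a h1), IHh1. ring.
Qed.

Lemma repr_app h1 h2 : repr (h1 ++ h2) = vadd (repr h1) (repr h2).
Proof. extensionality w. extensionality z. apply comp_app. Qed.

Lemma repr_cons p h : repr (p :: h) = vadd (repr (p :: nil)) (repr h).
Proof. apply (repr_app (p :: nil) h). Qed.

Lemma repr_nil : repr nil = vzero.
Proof. reflexivity. Qed.

Lemma comp_scale c h w z : Defs.comp (Hscale c h) w z = (c * Defs.comp h w z)%C.
Proof. induction h; simpl. ring. destruct (Req_EM_T (fst a) w); rewrite IHh; ring. Qed.

Lemma repr_scale c h : repr (Hscale c h) = vscal c (repr h).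
Proof. extensionality w. extensionality z. apply comp_scale. Qed.

Lemma repr_add_op a b h : repr (Opadd a b h) = vadd (repr (a h)) (repr (b h)).
Proof. apply repr_app. Qed.

Lemma holo_comp h w : Hel h -> holo (Defs.comp h w).
Proof.
  induction h; intros Hh. apply holo_const. apply Hel_inv in Hh. destruct Hh as [H1 H2].
  apply (holo_ext (fun z => if Req_EM_T (fst a) w then (snd a z + Defs.comp h w z)%C else Defs.comp h w z)).
  reflexivity. destruct (Req_EM_T (fst a) w); auto. apply holo_plus; auto.
Qed.

(** Multiplication by the homogeneous element [(g, n)] seen on components. An arbitrary [g] is
    allowed because products of modules multiply by their generators, besides [E4] and [E6]. *)
Definition mulop (n : R) (g : C -> C) (v : graded) : graded :=
  fun w z => (v (w - n)%R z * g (proj1_sig z))%C.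

Lemma mulop_linop n g : linop (mulop n g).
Proof.
  split; intros; unfold mulop; vring.
Qed.

Lemma mulop_comm n m f g v : mulop n f (mulop m g v) = mulop m g (mulop n f v).
Proof.
  unfold mulop. extensionality w. extensionality z.
  replace (w - n - m) with (w - m - n) by ring. ring.
Qed.

Lemma repr_map_mul n g h :
  repr (map (fun p => (fst p + n, fun z => (g z * snd p z)%C)) h) = mulop n g (repr h).
Proof.
  extensionality w. extensionality z. unfold repr, mulop. induction h. simpl. ring.
  simpl. rewrite IHh. destruct (Req_EM_T (fst a + n) w), (Req_EM_T (fst a) (w - n)); try ring; exfalso; lra.
Qed.

Lemma repr_e4 h : repr (e4 h) = mulop 4 E4 (repr h).
Proof. apply repr_map_mul. Qed.

Lemma repr_e6 h : repr (e6 h) = mulop 6 E6 (repr h).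
Proof. apply repr_map_mul. Qed.

Lemma repr_single_shift n g p :
  mulop n g (repr (p :: nil)) = repr ((fst p + n, fun z => (snd p z * g z)%C) :: nil).
Proof.
  rewrite <- repr_map_mul. apply repr_ext. intros w z _. simpl.
  destruct (Req_EM_T (fst p + n) w); ring.
Qed.

(** In the list, pieces of equal weight are differentiated one by one; additivity of [Dk] on
    holomorphic functions collects them. It follows that [delta] respects equality in [H]. *)
Lemma comp_delta h w z : Hel h -> UHP z -> Defs.comp (delta h) w z = Dk (w - 2) (Defs.comp h (w - 2)) z.
Proof.
  intros Hh Hz. induction h.
  - simpl. change (Defs.comp nil (w - 2)) with (fun _ : C => RtoC 0). rewrite Dk_const. ring.
  - pose proof (Hel_inv _ _ Hh) as [H1 H2]. specialize (IHh H2).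
    change (Defs.comp (delta (a :: h)) w z) with (if Req_EM_T (fst a + 2) w
      then (Dk (fst a) (snd a) z + Defs.comp (delta h) w z)%C else Defs.comp (delta h) w z).
    rewrite IHh. symmetry. destruct (Req_EM_T (fst a + 2) w) as [E|E].
    + assert (E2 : fst a = w - 2) by lra.
      rewrite (Dk_ext (w - 2) _ (fun z => snd a z + Defs.comp h (w - 2)%R z)%C); auto using holo_comp.
      rewrite Dk_plus by auto using holo_comp. now rewrite E2.
      intros y _. simpl. destruct (Req_EM_T (fst a) (w - 2)); auto. contradiction.
    + apply Dk_ext; auto using holo_comp.
      intros y _. simpl. destruct (Req_EM_T (fst a) (w - 2)); auto. exfalso; lra.
Qed.

(** * Modules stable under delta *)

Definition mops : list (graded -> graded) := mulop 4 E4 :: mulop 6 E6 :: nil.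

(** Each entry of the list is a generator by itself, hence homogeneous; this is what later lets a
    module be projected onto a single weight. *)
Definition gens (l : H) (v : graded) : Prop := exists p, In p l /\ v = repr (p :: nil).

Notation span l := (gen mops (gens l)).

(** Only generators are tested; stability of the whole span follows from the commutation of [delta]
    with [e4] and [e6], which rests on Ramanujan's identities. *)
Definition stable (l : H) : Prop := Hel l /\ forall p, In p l -> span l (repr (delta (p :: nil))).

Lemma span_e4 l v : span l v -> span l (mulop 4 E4 v).
Proof. intros. apply gen_op; auto. now left. Qed.

Lemma span_e6 l v : span l v -> span l (mulop 6 E6 v).
Proof. intros. apply gen_op; auto. right; now left. Qed.

Lemma repr_delta_Heq h1 h2 : Hel h1 -> Hel h2 -> repr h1 = repr h2 -> repr (delta h1) = repr (delta h2).
Proof.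
  intros H1 H2 E. apply repr_Heq in E. apply repr_ext. intros w z Hz.
  rewrite !comp_delta by auto. apply Dk_ext; auto using holo_comp.
Qed.

Lemma repr_delta_e4 h : Hel h ->
  repr (delta (e4 h)) = vadd (mulop 4 E4 (repr (delta h))) (vscal (RtoC (-1/3)) (mulop 6 E6 (repr h))).
Proof.
  intros Hh. extensionality w. extensionality z0. destruct z0 as [z Hz].
  unfold vadd, vscal, mulop, repr. simpl proj1_sig.
  rewrite comp_delta by auto using Hel_e4.
  rewrite (Dk_ext (w - 2) _ (fun z => E4 z * Defs.comp h (w - 6)%R z)%C); auto using holo_comp, Hel_e4.
  (* The weight is split so that the Leibniz rule differentiates [E4] in its own weight 4, where
     Ramanujan's identity applies. *)
  - replace (w - 2) with (4 + (w - 6)) by ring. pose proof (holo_Eis 240 3 : holo E4). rewrite Dk_mult, Dk_E4 by auto using holo_comp.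
    rewrite comp_delta by auto. replace (w - 4 - 2) with (w - 6) by ring. ring.
  - intros y Hy. pose proof (f_equal (fun u : graded => u (w - 2) (exist _ y Hy)) (repr_e4 h)) as E.
    unfold repr, mulop in E. simpl proj1_sig in E. rewrite E. replace (w - 2 - 4) with (w - 6) by ring. ring.
Qed.

Lemma repr_delta_e6 h : Hel h ->
  repr (delta (e6 h)) = vadd (mulop 6 E6 (repr (delta h))) (vscal (RtoC (-1/2)) (mulop 4 E4 (mulop 4 E4 (repr h)))).
Proof.
  intros Hh. extensionality w. extensionality z0. destruct z0 as [z Hz].
  unfold vadd, vscal, mulop, repr. simpl proj1_sig.
  rewrite comp_delta by auto using Hel_e6.
  rewrite (Dk_ext (w - 2) _ (fun z => E6 z * Defs.comp h (w - 8)%R z)%C); auto using holo_comp, Hel_e6.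
  - replace (w - 2) with (6 + (w - 8)) by ring. pose proof (holo_Eis (-504) 5 : holo E6). rewrite Dk_mult, Dk_E6 by auto using holo_comp.
    rewrite comp_delta by auto. replace (w - 6 - 2) with (w - 8) by ring. replace (w - 4 - 4) with (w - 8) by ring. ring.
  - intros y Hy. pose proof (f_equal (fun u : graded => u (w - 2) (exist _ y Hy)) (repr_e6 h)) as E.
    unfold repr, mulop in E. simpl proj1_sig in E. rewrite E. replace (w - 2 - 6) with (w - 8) by ring. ring.
Qed.

Lemma repr_delta_scale c h : Hel h -> repr (delta (Hscale c h)) = vscal c (repr (delta h)).
Proof.
  intros Hh. extensionality w. extensionality z0. destruct z0 as [z Hz].
  unfold vscal, repr. simpl proj1_sig. rewrite !comp_delta by auto using Hel_scale.
  rewrite (Dk_ext (w - 2) _ (fun z => c * Defs.comp h (w - 2)%R z)%C); auto using holo_comp, Hel_scale, comp_scale.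
  apply Dk_scal; auto using holo_comp.
Qed.

(** [delta] is not an operator on [graded], so the induction on the span builds a list [u]
    representing [v]. The clause [span l (repr u)] is carried along because [delta (e4 u)] involves
    [e6 u] besides [delta u]. *)
Lemma span_lift l : stable l -> forall v, span l v ->
  exists u, Hel u /\ repr u = v /\ span l (repr u) /\ span l (repr (delta u)).
Proof.
  intros [Hl Hs]. apply gen_min.
  - split.
    + exists nil. split. apply Hel_nil. split. reflexivity. split; apply gen_zero.
    + intros u v [u' [U1 [U2 [U3 U4]]]] [v' [V1 [V2 [V3 V4]]]]. exists (u' ++ v'). split. now apply Hel_app.
      split. now rewrite repr_app, U2, V2.
      unfold delta. rewrite map_app, !repr_app. split; now apply gen_add.
    + intros c u [u' [U1 [U2 [U3 U4]]]]. exists (Hscale c u'). split. now apply Hel_scale.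
      split. now rewrite repr_scale, U2. rewrite repr_delta_scale, repr_scale by auto. split; now apply gen_scal.
    + intros T u [<-|[<-|[]]] [u' [U1 [U2 [U3 U4]]]].
      * exists (e4 u'). split. now apply Hel_e4. split. now rewrite repr_e4, U2.
        rewrite repr_delta_e4, repr_e4 by auto. split. now apply span_e4.
        apply gen_add. now apply span_e4. now apply gen_scal, span_e6.
      * exists (e6 u'). split. now apply Hel_e6. split. now rewrite repr_e6, U2.
        rewrite repr_delta_e6, repr_e6 by auto. split. now apply span_e6.
        apply gen_add. now apply span_e6. now apply gen_scal, span_e4, span_e4.
  - intros v [p [Hp ->]]. exists (p :: nil). split. apply Hel_cons; auto. apply Hel_nil.
    split; auto. split; auto. apply gen_in. now exists p.
Qed.

Lemma span_delta l h : stable l -> Hel h -> span l (repr h) -> span l (repr (delta h)).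
Proof.
  intros Hs Hh H. destruct (span_lift l Hs _ H) as [u [U1 [U2 [_ U3]]]].
  now rewrite (repr_delta_Heq h u).
Qed.

Lemma span_Ralg l a : stable l -> Ralg a -> forall h, Hel h -> span l (repr h) -> span l (repr (a h)).
Proof.
  intros Hs Ha. induction Ha; intros h Hh H.
  - rewrite repr_scale. now apply gen_scal.
  - now apply span_delta.
  - rewrite repr_e4. now apply span_e4.
  - rewrite repr_e6. now apply span_e6.
  - rewrite repr_add_op. apply gen_add; auto.
  - apply IHHa1; auto. now apply Hel_Ralg.
Qed.

(** The analogue of integrality for arbitrary elements of [H], homogeneous or not, so that one
    notion serves both the single [S_k] and their direct sum. *)
Definition finite_type (h : H) : Prop := exists l, stable l /\ span l (repr h).

Lemma span_app_l l1 l2 v : span l1 v -> span (l1 ++ l2) v.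
Proof.
  apply gen_incl. apply incl_refl. intros u [p [Hp ->]]. apply gen_in. exists p. split; auto.
  apply in_or_app; auto.
Qed.

Lemma span_app_r l1 l2 v : span l2 v -> span (l1 ++ l2) v.
Proof.
  apply gen_incl. apply incl_refl. intros u [p [Hp ->]]. apply gen_in. exists p. split; auto.
  apply in_or_app; auto.
Qed.

Lemma stable_app l1 l2 : stable l1 -> stable l2 -> stable (l1 ++ l2).
Proof.
  intros [H1 S1] [H2 S2]. split. now apply Hel_app.
  intros p Hp. apply in_app_or in Hp. destruct Hp; [apply span_app_l | apply span_app_r]; auto.
Qed.

Lemma finite_type_add h1 h2 : finite_type h1 -> finite_type h2 -> finite_type (h1 ++ h2).
Proof.
  intros [l1 [S1 G1]] [l2 [S2 G2]]. exists (l1 ++ l2). split. now apply stable_app.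
  rewrite repr_app. apply gen_add; [now apply span_app_l | now apply span_app_r].
Qed.

Lemma finite_type_repr h1 h2 : repr h1 = repr h2 -> finite_type h1 -> finite_type h2.
Proof. intros E [l [S G]]. exists l. split; auto. now rewrite <- E. Qed.

Lemma finite_type_Ralg a h : Ralg a -> Hel h -> finite_type h -> finite_type (a h).
Proof. intros Ha Hh [l [S G]]. exists l. split; auto. now apply span_Ralg. Qed.

(** * Products of stable modules *)

Lemma gen_map ops G G' T : linop T -> (forall x, In x ops -> forall v, T (x v) = x (T v)) ->
  (forall v, G v -> gen ops G' (T v)) -> forall v, gen ops G v -> gen ops G' (T v).
Proof.
  intros HT HC HG. apply gen_min; auto. split.
  - rewrite linop_zero by auto. apply gen_zero.
  - intros u v Hu Hv. rewrite (linop_add _ HT). now apply gen_add.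
  - intros c u Hu. rewrite (linop_scal _ HT). now apply gen_scal.
  - intros x u Hx Hu. rewrite HC by auto. now apply gen_op.
Qed.

Lemma span_mulop n g G' G v : (forall v, G v -> gen mops G' (mulop n g v)) ->
  gen mops G v -> gen mops G' (mulop n g v).
Proof.
  intros HG. apply gen_map; auto. apply mulop_linop.
  intros x [<-|[<-|[]]] u; apply mulop_comm.
Qed.

Definition pmul (p q : R * (C -> C)) : R * (C -> C) :=
  (fst p + fst q, fun z => (snd p z * snd q z)%C).

Lemma In_Hmul p q l1 l2 : In p l1 -> In q l2 -> In (pmul p q) (Hmul l1 l2).
Proof.
  intros Hp Hq. apply in_flat_map. exists p. split; auto. apply in_map_iff. now exists q.
Qed.

Lemma mulop_single_r p q : mulop (fst q) (snd q) (repr (p :: nil)) = repr (pmul p q :: nil).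
Proof. apply repr_single_shift. Qed.

Lemma mulop_single_l p q : mulop (fst p) (snd p) (repr (q :: nil)) = repr (pmul p q :: nil).
Proof.
  rewrite repr_single_shift. apply repr_ext. intros w z _. unfold pmul. simpl.
  rewrite (Rplus_comm (fst q)). destruct (Req_EM_T (fst p + fst q) w); ring.
Qed.

Lemma span_mul_r l1 l2 q v : In q l2 -> span l1 v -> span (Hmul l1 l2) (mulop (fst q) (snd q) v).
Proof.
  intros Hq. apply span_mulop. intros u [p [Hp ->]]. rewrite mulop_single_r. apply gen_in.
  exists (pmul p q). split; auto. now apply In_Hmul.
Qed.

Lemma span_mul_l l1 l2 p v : In p l1 -> span l2 v -> span (Hmul l1 l2) (mulop (fst p) (snd p) v).
Proof.
  intros Hp. apply span_mulop. intros u [q [Hq ->]]. rewrite mulop_single_l. apply gen_in.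
  exists (pmul p q). split; auto. now apply In_Hmul.
Qed.

Lemma repr_delta_pmul p q : holo (snd p) -> holo (snd q) -> repr (delta (pmul p q :: nil)) =
  vadd (mulop (fst q) (snd q) (repr (delta (p :: nil)))) (mulop (fst p) (snd p) (repr (delta (q :: nil)))).
Proof.
  intros Hp Hq. unfold delta. cbn [map].
  rewrite !repr_single_shift, <- repr_cons. apply repr_ext. intros w z Hz. unfold pmul. cbn [Defs.comp fold_right fst snd].
  replace (fst q + 2 + fst p) with (fst p + fst q + 2) by ring.
  replace (fst p + 2 + fst q) with (fst p + fst q + 2) by ring.
  destruct (Req_EM_T (fst p + fst q + 2) w); auto.
  rewrite Dk_mult by auto. ring.
Qed.

(** By the Leibniz rule [delta] of a product of generators is [q * delta p + p * delta q].
    Multiplication by [q] commutes with [e4] and [e6], so it carries the span of [l1] into the span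
    of the products, and likewise for [p]. *)
Lemma stable_mul l1 l2 : stable l1 -> stable l2 -> stable (Hmul l1 l2).
Proof.
  intros [H1 S1] [H2 S2]. split. now apply Hel_mul.
  intros r Hr. apply in_flat_map in Hr. destruct Hr as [p [Hp Hr]].
  apply in_map_iff in Hr. destruct Hr as [q [<- Hq]]. change (fst p + fst q, fun z => (snd p z * snd q z)%C) with (pmul p q).
  rewrite repr_delta_pmul by auto. apply gen_add; [apply span_mul_r | apply span_mul_l]; auto.
Qed.

(** Multiplication by [h] as an operator on [graded]; being linear and commuting with [mops], it
    falls under [gen_map]. *)
Fixpoint mulH (h : H) (v : graded) : graded :=
  match h with nil => vzero | q :: h => vadd (mulop (fst q) (snd q) v) (mulH h v) end.

Lemma mulH_linop h : linop (mulH h).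
Proof.
  induction h as [|q h IH]; split; intros; simpl; try (vring; fail).
  - rewrite (linop_add _ (mulop_linop _ _)), (linop_add _ IH). vring.
  - rewrite (linop_scal _ (mulop_linop _ _)), (linop_scal _ IH). vring.
Qed.

Lemma mulH_comm h n g v : mulH h (mulop n g v) = mulop n g (mulH h v).
Proof.
  induction h as [|q h IH]; simpl.
  - symmetry. apply linop_zero, mulop_linop.
  - now rewrite IH, mulop_comm, (linop_add _ (mulop_linop n g)).
Qed.

Lemma mulH_single h p : mulH h (repr (p :: nil)) = mulop (fst p) (snd p) (repr h).
Proof.
  induction h as [|q h IH]; simpl mulH.
  - rewrite repr_nil. symmetry. apply linop_zero, mulop_linop.
  - now rewrite IH, (repr_cons q h), (linop_add _ (mulop_linop _ _)), mulop_single_r, mulop_single_l.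
Qed.

Lemma repr_Hmul h1 h2 : repr (Hmul h1 h2) = mulH h2 (repr h1).
Proof.
  induction h1 as [|p h1 IH].
  - symmetry. apply linop_zero, mulH_linop.
  - simpl Hmul. rewrite repr_app, repr_cons, (linop_add _ (mulH_linop h2)), <- IH. f_equal.
    clear. induction h2 as [|q h2 IH]; simpl. reflexivity.
    rewrite repr_cons, IH, mulop_single_r. reflexivity.
Qed.

Lemma finite_type_mul h1 h2 : finite_type h1 -> finite_type h2 -> finite_type (Hmul h1 h2).
Proof.
  intros [l1 [S1 G1]] [l2 [S2 G2]]. exists (Hmul l1 l2). split. now apply stable_mul.
  rewrite repr_Hmul. revert G1. apply gen_map.
  - apply mulH_linop.
  - intros x [<-|[<-|[]]] u; apply mulH_comm.
  - intros v [p [Hp ->]]. rewrite mulH_single. now apply span_mul_l.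
Qed.

(** * From monic operators to spans of iterated derivatives and back *)

Lemma span_Malg G a : Malg a -> forall h, gen mops G (repr h) -> gen mops G (repr (a h)).
Proof.
  induction 1; intros h Hh.
  - rewrite repr_scale. now apply gen_scal.
  - rewrite repr_e4. apply gen_op; auto. now left.
  - rewrite repr_e6. apply gen_op; auto. right; now left.
  - rewrite repr_add_op. apply gen_add; auto.
  - apply IHMalg1; auto.
Qed.

Lemma repr_lowterms_succ n m h :
  repr (lowterms (S n) m h) = vadd (repr (lowterms n m h)) (repr (m n (Opiter n delta h))).
Proof. apply repr_app. Qed.

Lemma span_lowterms n m h j : (forall i, Malg (m i)) -> (j <= n)%nat ->
  gen mops (fun u => exists i, (i < n)%nat /\ u = repr (Opiter i delta h)) (repr (lowterms j m h)).
Proof.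
  intros Hm. induction j; intros Hj.
  - apply gen_zero.
  - rewrite repr_lowterms_succ. apply gen_add. apply IHj; lia.
    apply span_Malg; auto. apply gen_in. exists j. split; auto.
Qed.

(** Turns membership in a span back into an operator: induction on the span builds the coefficients
    [m i] in C[E4, E6]. It supplies the lower terms of the monic operator. *)
Lemma lowterms_span n h v :
  gen mops (fun u => exists i, (i < n)%nat /\ u = repr (Opiter i delta h)) v ->
  exists m, (forall i, Malg (m i)) /\ v = repr (lowterms n m h).
Proof.
  revert v. apply gen_min.
  - split.
    + exists (fun _ => Opconst 0). split. intros; constructor.
      clear. induction n. reflexivity. rewrite repr_lowterms_succ, <- IHn. unfold Opconst. rewrite repr_scale. vring.
    + intros u v [m1 [M1 ->]] [m2 [M2 ->]]. exists (fun i => Opadd (m1 i) (m2 i)). split. intros; apply Malg_add; auto.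
      clear. induction n. cbn [lowterms]; rewrite !repr_nil; vring. rewrite !repr_lowterms_succ, <- IHn, repr_add_op. vring.
    + intros c u [m1 [M1 ->]]. exists (fun i => Opcomp (Opconst c) (m1 i)). split. intros; apply Malg_comp; [apply Malg_const | auto].
      clear. induction n. cbn [lowterms]; rewrite !repr_nil; vring. rewrite !repr_lowterms_succ, <- IHn. unfold Opcomp, Opconst. rewrite repr_scale. vring.
    + intros T u HT [m1 [M1 ->]].
      assert (exists e, Malg e /\ forall h, repr (e h) = T (repr h)) as [e [He1 He2]].
      { destruct HT as [<-|[<-|[]]]; [exists e4 | exists e6]; split; try constructor; [apply repr_e4 | apply repr_e6]. }
      assert (HTl : linop T) by (destruct HT as [<-|[<-|[]]]; apply mulop_linop).
      exists (fun i => Opcomp e (m1 i)). split. intros; apply Malg_comp; auto.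
      clear -He2 HTl. induction n. now apply linop_zero. rewrite !repr_lowterms_succ, <- IHn.
      unfold Opcomp. now rewrite He2, (linop_add _ HTl).
  - intros v [j [Hj ->]].
    (* Kronecker coefficients select the single iterate [j]. *)
    exists (fun i => if Nat.eqb i j then Opconst 1 else Opconst 0). split. intros; destruct Nat.eqb; constructor.
    assert (G : forall k, repr (lowterms k (fun i => if Nat.eqb i j then Opconst 1 else Opconst 0) h) =
      if Nat.ltb j k then repr (Opiter j delta h) else vzero).
    { induction k. reflexivity. rewrite repr_lowterms_succ, IHk.
      destruct (Nat.eqb_spec k j), (Nat.ltb_spec j k), (Nat.ltb_spec j (S k)); try lia;
      unfold Opconst; rewrite repr_scale; subst; vring. }
    rewrite G. destruct (Nat.ltb_spec j n); auto; lia.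
Qed.

Lemma Malg_Ralg a : Malg a -> Ralg a.
Proof. induction 1; constructor; auto. Qed.

(** The iterate [Opiter 0 delta] is the identity, which enters [Ralg] only as scaling by 1; function
    extensionality identifies the two. *)
Lemma Opconst_1 : Opconst 1 = (fun h => h).
Proof.
  extensionality h. unfold Opconst, Hscale. rewrite <- (map_id h) at 2. apply map_ext. intros [k f]. simpl.
  f_equal. extensionality z. ring.
Qed.

Lemma Ralg_iter n : Ralg (Opiter n delta).
Proof.
  induction n. simpl. rewrite <- Opconst_1. constructor. apply Ralg_comp; auto. constructor.
Qed.

(** [lowterms 0] returns the empty list, which no constructor of [Ralg] provides; scaling by 0 has
    the same components, so an operator agreeing up to [repr] is built instead. *)
Lemma Ralg_lowterms n m : (forall i, Malg (m i)) ->
  exists b, Ralg b /\ forall h, repr (b h) = repr (lowterms n m h).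
Proof.
  intros Hm. induction n as [|n [b [B1 B2]]].
  - exists (Opconst 0). split. constructor. intros h. unfold Opconst. rewrite repr_scale. simpl. rewrite repr_nil. vring.
  - exists (Opadd b (Opcomp (m n) (Opiter n delta))). split.
    + constructor; auto. constructor. now apply Malg_Ralg. apply Ralg_iter.
    + intros h. now rewrite repr_lowterms_succ, repr_add_op, B2.
Qed.

Lemma Opiter_hom k f n : exists g, Opiter n delta (hom k f) = hom (k + 2 * INR n) g.
Proof.
  induction n as [|n [g IH]].
  - exists f. simpl. unfold hom. do 2 f_equal. ring.
  - eexists. simpl Opiter. unfold Opcomp. rewrite IH. unfold delta, hom. simpl map.
    rewrite S_INR. do 2 f_equal. ring.
Qed.

(** The module is generated by the iterates of order less than [n]. Leading coefficient 1 lets the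
    equation be solved for the iterate of order [n], so [delta] of the last generator stays inside.
    For [n = 0] the list is empty and [f] vanishes. *)
Lemma inS_finite_type k f : inS k f -> finite_type (hom k f).
Proof.
  intros [Hf [a [Ha [[n [m [Hm Ea]]] Hz]]]].
  set (it := fun i => Opiter i delta (hom k f)).
  assert (Hit : forall i, Hel (it i)). { intros i. apply Hel_Ralg. apply Ralg_iter. now apply Hel_hom. }
  set (l := flat_map it (seq 0 n)).
  assert (Gin : forall i, (i < n)%nat -> gens l (repr (it i))).
  { intros i Hi. destruct (Opiter_hom k f i) as [g Eg]. exists (k + 2 * INR i, g). split.
    apply in_flat_map. exists i. split. apply in_seq; lia. unfold it. rewrite Eg. now left.
    unfold it. now rewrite Eg. }
  assert (Gn : span l (repr (it n))).
  { assert (Hh := Hel_hom k f Hf).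
    apply repr_Heq in Hz. rewrite repr_nil in Hz. specialize (Ea _ Hh). apply repr_Heq in Ea.
    rewrite Ea, repr_add_op in Hz. fold (it n) in Hz.
    replace (repr (it n)) with (vscal (- (1)) (repr (lowterms n m (hom k f)))).
    - apply gen_scal. apply (gen_incl mops mops (fun u => exists i, (i < n)%nat /\ u = repr (it i))).
      apply incl_refl. intros v [i [Hi ->]]. apply gen_in, Gin, Hi. now apply span_lowterms.
    - replace (repr (it n)) with (vadd (vadd (repr (it n)) (repr (lowterms n m (hom k f)))) (vscal (- (1)) (repr (lowterms n m (hom k f))))) by vring.
      rewrite Hz. vring. }
  assert (Gall : forall i, (i <= n)%nat -> span l (repr (it i))).
  { intros i Hi. assert (i < n \/ i = n)%nat as [K| ->] by lia; auto. apply gen_in, Gin, K. }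
  exists l. split; [|apply (Gall O); lia]. split.
  - intros p Hp. apply in_flat_map in Hp. destruct Hp as [i [_ Hi]]. exact (Hit i p Hi).
  - intros p Hp. apply in_flat_map in Hp. destruct Hp as [i [Hi Hp]]. apply in_seq in Hi.
    (* Each iterate of a homogeneous element is a one-entry list, so [delta] of the generator [p] is
       the next iterate. *)
    assert (E : p :: nil = it i).
    { destruct (Opiter_hom k f i) as [g Eg]. unfold it in *. rewrite Eg in *. destruct Hp as [<-|[]]. reflexivity. }
    rewrite E. apply (Gall (S i)). lia.
Qed.

Lemma finite_type_inS k f : holo f -> finite_type (hom k f) -> inS k f.
Proof.
  intros Hf [l [Sl Gl]]. split; auto. pose proof (Hel_hom k f Hf) as Hh.
  (* All iterates stay in the stable span, which is Noetherian; some iterate is therefore a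
     combination of the earlier ones. *)
  destruct (noeth_sequence mops (span l) (fun i => repr (Opiter i delta (hom k f)))) as [n Hn].
  - apply noeth_mono with (gen mops (fun v => In v (map (fun p => repr (p :: nil)) l))).
    + apply gen_incl. apply incl_refl. intros v [p [Hp ->]]. apply gen_in, in_map_iff. now exists p.
    + apply noeth_two; auto using mulop_linop, mulop_comm.
  - apply gen_submod.
  - intros n. apply span_Ralg; auto. apply Ralg_iter.
  - apply lowterms_span in Hn. destruct Hn as [m [Hm En]].
    (* Opposite coefficients: the relation expresses the iterate of order [n] by the lower ones, and
       the monic operator is their difference. *)
    set (m' := fun i => Opcomp (Opconst (- (1))) (m i)).
    assert (Hm' : forall i, Malg (m' i)) by (intros; apply Malg_comp; [apply Malg_const | auto]).
    assert (E' : forall j, repr (lowterms j m' (hom k f)) = vscal (- (1)) (repr (lowterms j m (hom k f)))).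
    { induction j. cbn [lowterms]; rewrite !repr_nil; vring. rewrite !repr_lowterms_succ, IHj. unfold m', Opcomp, Opconst. rewrite repr_scale. vring. }
    destruct (Ralg_lowterms n m' Hm') as [b [B1 B2]].
    exists (Opadd (Opiter n delta) b). split; [|split].
    + constructor; auto. apply Ralg_iter.
    + exists n, m'. split; auto. intros h _. apply repr_Heq. now rewrite !repr_add_op, B2.
    + apply repr_Heq. rewrite repr_add_op, B2, E', <- En, repr_nil. vring.
Qed.

Lemma inS_iff k f : inS k f <-> holo f /\ finite_type (hom k f).
Proof.
  split.
  - intros H. split. apply H. now apply inS_finite_type.
  - intros [H1 H2]. now apply finite_type_inS.
Qed.

(** * Passing to weight components *)

Definition proj (w : R) (v : graded) : graded := fun w' => if Req_EM_T w w' then v w' else vzero w'.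

Lemma proj_mulop w n g v : proj w (mulop n g v) = mulop n g (proj (w - n) v).
Proof.
  extensionality w'. extensionality z. unfold proj, mulop, vzero.
  destruct (Req_EM_T w w'), (Req_EM_T (w - n) (w' - n)); try ring; exfalso; lra.
Qed.

Lemma proj_linop w : linop (proj w).
Proof.
  split; intros; unfold proj, vadd, vscal, vzero; extensionality w'; extensionality z;
  destruct (Req_EM_T w w'); ring.
Qed.

(** The span is a graded subspace: its generators are homogeneous, and [e4] and [e6] shift all
    weights by a constant. *)
Lemma span_proj l v : span l v -> forall w, span l (proj w v).
Proof.
  revert v. apply (gen_min mops (gens l) (fun v => forall w, span l (proj w v))).
  - split.
    + intros w. rewrite linop_zero by apply proj_linop. apply gen_zero.
    + intros u v Hu Hv w. rewrite (linop_add _ (proj_linop w)). now apply gen_add.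
    + intros c u Hu w. rewrite (linop_scal _ (proj_linop w)). now apply gen_scal.
    + intros T u [<-|[<-|[]]] Hu w; rewrite proj_mulop; [apply span_e4 | apply span_e6]; auto.
  - intros v [p [Hp ->]] w. destruct (Req_dec w (fst p)) as [->|N].
    + replace (proj (fst p) (repr (p :: nil))) with (repr (p :: nil)). apply gen_in. now exists p.
      extensionality w'. extensionality z. unfold proj, vzero, repr. simpl. destruct (Req_EM_T (fst p) w'); auto.
    + replace (proj w (repr (p :: nil))) with vzero. apply gen_zero.
      extensionality w'. extensionality z. unfold proj, vzero, repr. simpl.
      destruct (Req_EM_T w w'), (Req_EM_T (fst p) w'); auto. congruence.
Qed.

Lemma repr_hom_comp w h : repr (hom w (Defs.comp h w)) = proj w (repr h).
Proof.
  extensionality w'. extensionality z. unfold proj, vzero, repr. simpl.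
  destruct (Req_EM_T w w'); auto. subst. ring.
Qed.

Lemma finite_type_inSsum h : Hel h -> finite_type h -> inSsum h.
Proof.
  intros Hh [l [S G]] w. apply finite_type_inS. now apply holo_comp.
  exists l. split; auto. rewrite repr_hom_comp. now apply span_proj.
Qed.

Lemma comp_not_weight h w z : ~ In w (map fst h) -> Defs.comp h w z = RtoC 0.
Proof.
  induction h as [|p h IH]; simpl; auto. intros N. destruct (Req_EM_T (fst p) w). tauto. apply IH. tauto.
Qed.

(** Only the weights listed in [h] contribute, and each component brings its own stable module. The
    induction truncates [h] to the weights in [ws] by a membership test, so that a repeated weight
    adds nothing. *)
Lemma inSsum_finite_type h : inSsum h -> finite_type h.
Proof.
  intros Hs.
  assert (G : forall ws, exists l, stable l /\ span l (fun w z => if in_dec Req_EM_T w ws then repr h w z else RtoC 0)).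
  { induction ws as [|w ws [l [S G]]].
    - exists nil. split. split. apply Hel_nil. intros p []. apply gen_zero.
    - destruct (in_dec Req_EM_T w ws) as [I|N].
      + exists l. split; auto. match goal with |- span l ?v => match type of G with span l ?u => replace v with u end end; auto.
        extensionality w'. extensionality z. destruct (in_dec Req_EM_T w' ws), (in_dec Req_EM_T w' (w :: ws)); auto.
        contradict n. now right. destruct i as [->|]; contradiction.
      + destruct (inS_finite_type _ _ (Hs w)) as [l' [S' G']]. exists (l ++ l'). split. now apply stable_app.
        rewrite repr_hom_comp in G'. apply (span_app_l l l') in G. apply (span_app_r l l') in G'.
        pose proof (gen_add _ _ _ _ G G') as K.
        match goal with |- gen _ _ ?v => match type of K with gen _ _ ?u => replace v with u end end; auto.
        extensionality w'. extensionality z. unfold vadd, proj, vzero.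
        destruct (in_dec Req_EM_T w' ws), (in_dec Req_EM_T w' (w :: ws)), (Req_EM_T w w'); try ring; subst; try contradiction; exfalso.
        * apply n. now right.
        * destruct i; contradiction.
        * apply n0. now left. }
  destruct (G (map fst h)) as [l [S K]]. exists l. split; auto.
  replace (repr h) with (fun w z => if in_dec Req_EM_T w (map fst h) then repr h w z else RtoC 0); auto.
  extensionality w. extensionality z. destruct (in_dec Req_EM_T w (map fst h)); auto.
  symmetry. now apply comp_not_weight.
Qed.

(** * Modular forms *)

(** The span of the constant 1 is C[E4, E6] itself, and [delta] kills 1 because its weight is 0. *)
Lemma stable_one : stable Hone.
Proof.
  split. apply Hel_hom, holo_const. intros p [<-|[]].
  replace (repr (delta ((0, fun _ : C => RtoC 1) :: nil))) with vzero. apply gen_zero.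
  extensionality w. extensionality z. unfold repr, delta, vzero. simpl. destruct (Req_EM_T (0 + 2) w); auto.
  rewrite Dk_const. replace (0 / 12) with 0 by field. ring.
Qed.

Lemma repr_hom_ext k f g : (forall z, f z = g z) -> repr (hom k f) = repr (hom k g).
Proof. intros E. apply repr_ext. intros w z _. simpl. now rewrite E. Qed.

(** C[E4, E6] is closed under products: multiplication by [f] commutes with the action of the ring,
    so only its value at the generator 1 matters, which is [f]. *)
Lemma span_one_mul k f v : span Hone v -> span Hone (repr (hom k f)) -> span Hone (mulop k f v).
Proof.
  intros Hv Hf. revert Hv. apply span_mulop. intros u [p [[<-|[]] ->]].
  rewrite repr_single_shift. simpl.
  match goal with |- gen _ _ ?v => replace v with (repr (hom k f)) end; auto.
  unfold hom. rewrite Rplus_0_l. apply repr_hom_ext. intros; ring.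
Qed.

Lemma span_MF k f : MF k f -> holo f /\ span Hone (repr (hom k f)).
Proof.
  assert (G1 : span Hone (repr (hom 0 (fun _ => RtoC 1)))).
  { apply gen_in. exists (0, fun _ => RtoC 1). split; auto. now left. }
  induction 1 as [k|c| | |k f g Hf [F1 F2] Hg [K1 K2]|k l f g Hf [F1 F2] Hg [K1 K2]].
  - split. apply holo_const. replace (repr (hom k (fun _ => RtoC 0))) with vzero. apply gen_zero.
    extensionality w. extensionality z. unfold repr, vzero. simpl. destruct (Req_EM_T k w); auto. ring.
  - split. apply holo_const. replace (repr (hom 0 (fun _ => c))) with (vscal c (repr (hom 0 (fun _ => RtoC 1)))).
    now apply gen_scal. rewrite <- repr_scale. apply (repr_hom_ext 0). intros; simpl; ring.
  - split. apply holo_Eis. apply span_e4 in G1. unfold hom in G1. rewrite repr_single_shift in G1. simpl in G1.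
    rewrite Rplus_0_l in G1. rewrite (repr_hom_ext 4 E4 (fun z => 1 * E4 z)%C). exact G1. intros; ring.
  - split. apply holo_Eis. apply span_e6 in G1. unfold hom in G1. rewrite repr_single_shift in G1. simpl in G1.
    rewrite Rplus_0_l in G1. rewrite (repr_hom_ext 6 E6 (fun z => 1 * E6 z)%C). exact G1. intros; ring.
  - split. now apply holo_plus. replace (repr (hom k (fun z => f z + g z)%C)) with (vadd (repr (hom k f)) (repr (hom k g))).
    now apply gen_add. rewrite <- repr_app. apply repr_ext. intros w z _. simpl. destruct (Req_EM_T k w); ring.
  - split. now apply holo_mult.
    pose proof (span_one_mul l g _ F2 K2) as K. unfold hom at 1 in K. rewrite repr_single_shift in K. exact K.
Qed.

Theorem theorem4p3 :
  (forall (k l : R),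
     (* (1) S_k + S_k ⊂ S_k *)
     (forall f g, inS k f -> inS k g -> inS k (fun z => Cplus (f z) (g z))) /\
     (* (2) S_k S_l ⊂ S_{k+l} *)
     (forall f g, inS k f -> inS l g -> inS (k + l) (fun z => Cmult (f z) (g z))) /\
     (* (3) R_k S_l ⊂ S_{k+l} *)
     (forall (a : Op) f, Rk k a -> inS l f ->
        exists g, Heq (a (hom l f)) (hom (k + l) g) /\ inS (k + l) g) /\
     (* (4) M_k ⊂ S_k *)
     (forall f, MF k f -> inS k f)) /\
  (* consequently (+)_k S_k is a C-subalgebra of H ... *)
  (inSsum Hone /\
   (forall h1 h2, Hel h1 -> Hel h2 -> inSsum h1 -> inSsum h2 -> inSsum (Hadd h1 h2)) /\
   (forall h1 h2, Hel h1 -> Hel h2 -> inSsum h1 -> inSsum h2 -> inSsum (Hmul h1 h2)) /\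
   (forall c h, Hel h -> inSsum h -> inSsum (Hscale c h)) /\
  (* ... and a left R-submodule of H *)
   (forall a h, Ralg a -> Hel h -> inSsum h -> inSsum (a h))).
Proof.
  split.
  - intros k l. split; [|split; [|split]].
    + intros f g Hf Hg. apply inS_iff in Hf. apply inS_iff in Hg. apply inS_iff.
      destruct Hf as [F1 F2], Hg as [G1 G2]. split. now apply holo_plus.
      apply (finite_type_repr (hom k f ++ hom k g)). 2: now apply finite_type_add.
      apply repr_ext. intros w z _. simpl. destruct (Req_EM_T k w); ring.
    + intros f g Hf Hg. apply inS_iff in Hf. apply inS_iff in Hg. apply inS_iff.
      destruct Hf as [F1 F2], Hg as [G1 G2]. split. now apply holo_mult.
      exact (finite_type_mul _ _ F2 G2).
    + intros a f [Ha Hhom] Hf. apply inS_iff in Hf. destruct Hf as [F1 F2].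
      destruct (Hhom l f F1) as [g [Hg E]]. rewrite Rplus_comm in E. exists g. split; auto.
      apply inS_iff. split; auto. apply (finite_type_repr (a (hom l f))). now apply repr_Heq.
      apply finite_type_Ralg; auto. now apply Hel_hom.
    + intros f Hf. apply span_MF in Hf. apply inS_iff. split. apply Hf.
      exists Hone. split. apply stable_one. apply Hf.
  - split; [|split; [|split; [|split]]].
    + apply finite_type_inSsum. apply Hel_hom, holo_const.
      exists Hone. split. apply stable_one. apply (span_MF 0 (fun _ => RtoC 1)). constructor.
    + intros h1 h2 H1 H2 S1 S2. apply finite_type_inSsum. now apply Hel_app.
      apply finite_type_add; now apply inSsum_finite_type.
    + intros h1 h2 H1 H2 S1 S2. apply finite_type_inSsum. now apply Hel_mul.
      apply finite_type_mul; now apply inSsum_finite_type.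
    + intros c h Hh Sh. apply finite_type_inSsum. now apply Hel_scale.
      apply (finite_type_Ralg (Opconst c)); auto. constructor. now apply inSsum_finite_type.
    + intros a h Ha Hh Sh. apply finite_type_inSsum. now apply Hel_Ralg.
      apply finite_type_Ralg; auto. now apply inSsum_finite_type.
Qed.
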